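(* Let $d\in\mathbb Z$, let $(\mathcal A,s_{d+1}M_{\mathcal A})$ and $(\mathcal B,s_{d+1}M_{\mathcal B})$ be $d$-pre-Calabi-Yau categories and let $(\Phi_0,s_{d+1}\Phi):(\mathcal A,s_{d+1}M_{\mathcal A})\to(\mathcal B,s_{d+1}M_{\mathcal B})$ be a strict $d$-pre-Calabi-Yau morphism. Then the two maps $$s\varphi_{\mathcal A}:(\mathcal A\oplus\mathcal B^*[d-1],sm_{\mathcal A\oplus\mathcal B^*})\to(\mathcal A\oplus\mathcal A^*[d-1],sm_{\mathcal A\oplus\mathcal A^*}),\qquad s\varphi_{\mathcal B}:(\mathcal A\oplus\mathcal B^*[d-1],sm_{\mathcal A\oplus\mathcal B^*})\to(\mathcal B\oplus\mathcal B^*[d-1],sm_{\mathcal B\oplus\mathcal B^*}),$$ given by $s\varphi_{\mathcal A}(sa)=sa$, $s\varphi_{\mathcal A}(tf)=t(f\circ\tilde\Phi)$, $s\varphi_{\mathcal B}(sa)=\Phi(sa)$, $s\varphi_{\mathcal B}(tf)=tf$ for $sa\in{}_x\mathcal A_y[1]$, $tf\in{}_{\Phi_0(x)}\mathcal B^*_{\Phi_0(y)}[d]$ (identity, respectively $\Phi_0$, on objects, and with all higher components zero), are strict cyclic $A_\infty$-morphisms (with respect to the bilinear forms $\Gamma^\Phi$ on $\mathcal A\oplus\mathcal B^*[d-1]$, $\Gamma^{\mathcal A}$ on $\mathcal A\oplus\mathcal A^*[d-1]$ and $\Gamma^{\mathcal B}$ on $\mathcal B\oplus\mathcal B^*[d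-1]$).
   Context: **Conventions.** $\Bbbk$ is a field of characteristic different from $2,3$; $\otimes=\otimes_\Bbbk$. For a graded space $V$, $V[n]^i=V^{n+i}$ and $s_n:V\to V[n]$ (also $V[m]\to V[m+n]$) is the identity on underlying sets, of degree $-n$; $s=s_1$. The Koszul sign rule is used everywhere: $(f\otimes g)(v\otimes w)=(-1)^{|g||v|}f(v)\otimes g(w)$, and exchanging two adjacent homogeneous elements $v,w$ produces $(-1)^{|v||w|}$. $V^*$ is the graded dual. Products are products of graded spaces. A graded quiver $\mathcal A$ has a set of objects $\mathcal O_{\mathcal A}$ and graded spaces ${}_y\mathcal A_x$; $\mathcal A^*$ has the same objects and ${}_y\mathcal A^*_x=({}_x\mathcal A_y)^*$. For a tuple $\bar x=(x_1,\dots,x_n)$ of objects ($n\ge1$): $\lg(\bar x)=n$, $\mathrm{lt}(\bar x)=x_1$, $\mathrm{rt}(\bar x)=x_n$, $\mathcal A[1]^{\otimes\bar x}={}_{x_1}\mathcal A_{x_2}[1]\otimes\cdots\otimes{}_{x_{n-1}}\mathcal A_{x_n}[1]$ ($=\Bbbk$ if $n=1$); $\sqcup$ is concatenation. A *type* is a finite nonempty sequence $\bar{\bar x}=(\bar x^1,\dots,\bar x^n)$ of nonempty tuples, with $\lg(\bar x^1)\ge2$ if $n=1$. $\overline{sa}^i$ denotes a homogeneous pure tensor in $\mathcal A[1]^{\otimes\bar x^i}$, $|\overline{sa}^i|$ its total degree. $t=s_d$ denotes the shift $\mathcal A^*\to\mathcal A^*[d]$, $\mathcal B^*\to\mathcal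 B^*[d]$. **$A_\infty$-categories.** An $A_\infty$-structure on a graded quiver $\mathcal Q$ is a family $sm$ of degree $1$ maps $sm^{\bar x}:\mathcal Q[1]^{\otimes\bar x}\to{}_{\mathrm{lt}(\bar x)}\mathcal Q_{\mathrm{rt}(\bar x)}[1]$, $\lg(\bar x)\ge2$, with $\sum sm\circ(\mathrm{id}^{\otimes}\otimes sm\otimes\mathrm{id}^{\otimes})=0$ on every $\mathcal Q[1]^{\otimes\bar x}$ (sum over all insertions of $sm$ on a nonempty block of consecutive inputs). An $A_\infty$-morphism $(F_0,sf):\mathcal Q\to\mathcal R$ is a map $F_0$ on objects and degree $0$ maps $sf^{\bar x}:\mathcal Q[1]^{\otimes\bar x}\to{}_{F_0(\mathrm{lt}(\bar x))}\mathcal R_{F_0(\mathrm{rt}(\bar x))}[1]$, $\lg(\bar x)\ge2$, with $\sum sf\circ(\mathrm{id}^\otimes\otimes sm_{\mathcal Q}\otimes\mathrm{id}^\otimes)=\sum sm_{\mathcal R}\circ(sf\otimes\cdots\otimes sf)$ (right sum over all decompositions into consecutive nonempty blocks). It is strict if $sf^{\bar x}=0$ whenever $\lg(\bar x)>2$. A bilinear form of degree $d$ on $\mathcal Q$ is a family of homogeneous maps ${}_y\Gamma_x:{}_y\mathcal Q_x[1]\otimes{}_x\mathcal Q_y[1]\to\Bbbk$ of degree $d+2$. $sm$ is almost cyclic with respect to $\Gamma$ if for $q_i\in{}_{x_i}\mathcal Q_{x_{i+1}}$ ($i<n$), $q_n\in{}_{x_n}\mathcal Q_{x_1}$, ${}_{x_1}\Gamma_{x_n}(sm(sq_1,\dots,sq_{n-1}),sq_n)=(-1)^{|sq_n|\sum_{i<n}|sq_i|}{}_{x_n}\Gamma_{x_{n-1}}(sm(sq_n,sq_1,\dots,sq_{n-2}),sq_{n-1})$.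 An $A_\infty$-morphism $(F_0,sf)$ between almost cyclic $A_\infty$-categories with bilinear forms $\gamma$ (source) and $\Gamma$ (target) is cyclic if ${}_{F_0(x)}\Gamma_{F_0(y)}(sf(sa),sf(sb))={}_x\gamma_y(sa,sb)$ for $a\in{}_x\mathcal Q_y$, $b\in{}_y\mathcal Q_x$, and for each $n\ge3$ and each cyclically composable $sq_1,\dots,sq_n$, $\sum_{i=1}^{n-1}\Gamma(sf(sq_1,\dots,sq_i),sf(sq_{i+1},\dots,sq_n))=0$. **Pre-Calabi-Yau structures.** $\mathrm{Multi}_d(\mathcal A)$ is the product over all types of the graded spaces of (sums of homogeneous) linear maps $$F^{\bar{\bar x}}:\mathcal A[1]^{\otimes\bar x^1}\otimes\cdots\otimes\mathcal A[1]^{\otimes\bar x^n}\to{}_{\mathrm{lt}(\bar x^1)}\mathcal A_{\mathrm{rt}(\bar x^2)}[-d]\otimes\cdots\otimes{}_{\mathrm{lt}(\bar x^n)}\mathcal A_{\mathrm{rt}(\bar x^1)}[-d].$$ $\mathrm{Multi}_d(\mathcal A)^C$: cyclically invariant elements, $F^{(\bar x^1,\dots,\bar x^n)}=\tau_{out}\circ F^{(\bar x^2,\dots,\bar x^n,\bar x^1)}\circ\tau_{in}$, where $\tau_{in}$ moves the first input block to the end and $\tau_{out}$ moves the last output factor to the front, with Koszul signs. $s_{d+1}F$ is identified with the family $(\mathrm{id}^{\otimes(n-1)}\otimes s_{d+1})\circ F^{\bar{\bar x}}$. A disc of type $(\bar x^1,\dots,\bar x^n)$ is a circle with outgoing arrows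 labelled $1,\dots,n$ clockwise; the sector between outgoing arrows $i-1$ and $i$ (arrow $0$ is arrow $n$) contains $\lg(\bar x^i)-1$ incoming arrows, separated by the objects $x^i_1,x^i_2,\dots$ read counterclockwise; the incoming arrow between $x^i_j,x^i_{j+1}$ is the input ${}_{x^i_j}\mathcal A_{x^i_{j+1}}[1]$, outgoing arrow $i$ is the $i$-th output. Outgoing arrow $i$ of one disc may be connected to an incoming arrow between $u,u'$ of another if $\mathrm{lt}(\bar x^i)=u$, $\mathrm{rt}(\bar x^{i+1})=u'$ ($\bar x^{n+1}=\bar x^1$). A two-disc diagram consists of a disc filled with $G$ and one filled with $F$, one outgoing arrow of the $G$-disc being connected to one incoming arrow of the $F$-disc, with a chosen free outgoing arrow (root). Free outgoing arrows are labelled clockwise $1,\dots,N$, the root being $N$; the type lists the objects read counterclockwise between free outgoing arrows $i-1$ and $i$. The bold arrow of each disc is its arrow on the path to the root. A disc acts by $(\mathrm{id}^\otimes\otimes s_{d+1}\otimes\mathrm{id}^\otimes)\circ F$, $s_{d+1}$ at the bold output, if its bold arrow is outgoing, and by $(-1)^{(d+1)(|F|+d+1)}F\circ(\mathrm{id}^\otimes\otimes s_{d+1}\otimes\mathrm{id}^\otimes)$, $s_{d+1}:\mathcal A[-d]\to\mathcal A[1]$ at the bold input, if it is incoming (discs being relabelled cyclically if needed). The evaluation takes the inputs in the order of the type, permutes (Koszul signs) so that the inputs of the $G$-disc are leftmost in order, applies $G$, permutes so that the inputs of the $F$-disc are leftmost in order, applies $F$, and permutes the outputs into the order $1,\dots,N$.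 $(s_{d+1}F\circ_{nec}s_{d+1}G)^{\bar{\bar z}}$ is the sum of evaluations over all such diagrams of type $\bar{\bar z}$. A $d$-pre-Calabi-Yau structure on $\mathcal A$ is a degree $1$ element $s_{d+1}M_{\mathcal A}\in\mathrm{Multi}_d(\mathcal A)^C[d+1]$ with $s_{d+1}M_{\mathcal A}\circ_{nec}s_{d+1}M_{\mathcal A}=0$. **The structure $sm_{\mathcal A\oplus\mathcal A^*}$.** It equals $\mathsf j(s_{d+1}M_{\mathcal A})$, where for $s_{d+1}\phi\in\mathrm{Multi}_d(\mathcal A)[d+1]$, $\mathsf j(s_{d+1}\phi)=s\psi$ is defined on words $w=(\overline{sa}^n,tf^{n-1},\overline{sa}^{n-1},\dots,tf^1,\overline{sa}^1)$ in $\mathcal A[1]\oplus\mathcal A^*[d]$, $\overline{sa}^i\in\mathcal A[1]^{\otimes\bar x^i}$, $tf^i\in{}_{\mathrm{rt}(\bar x^{i+1})}\mathcal A^*_{\mathrm{lt}(\bar x^i)}[d]$: the $\mathcal A$-valued part of $\psi(w)$ is $(-1)^\epsilon\big(\bigotimes_{i=1}^{n-1}(f^i\circ s_d)\otimes s_d\big)\big(\phi^{(\bar x^1,\dots,\bar x^n)}(\overline{sa}^1,\dots,\overline{sa}^n)\big)$, $$\epsilon=\sum_{i=1}^{n-1}|tf^i|\sum_{j=i+1}^n|\overline{sa}^j|+|\phi|\sum_{i=1}^{n-1}|tf^i|+d(n-1)+\sum_{1\le i<j\le n}|\overline{sa}^i||\overline{sa}^j|+\sum_{1\le i<j\le n-1}|tf^i||tf^j|;$$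 the $\mathcal A^*[d-1]$-valued part is zero for $n=1$ and for $n\ge2$ is $u$ with, for $sb\in{}_{\mathrm{rt}(\bar x^1)}\mathcal A_{\mathrm{lt}(\bar x^n)}[1]$, $$u(s_{1-d}b)=(-1)^\delta\big(\bigotimes_{i=1}^{n-1}(f^i\circ s_d)\big)\big(\phi^{(\bar x^1\sqcup\bar x^n,\bar x^2,\dots,\bar x^{n-1})}(\overline{sa}^1\otimes sb\otimes\overline{sa}^n,\overline{sa}^2,\dots,\overline{sa}^{n-1})\big),$$ $$\delta=\epsilon+d\big(|\phi|+\sum_{i=1}^n|\overline{sa}^i|\big)+(|\overline{sa}^n|+|sb|)\sum_{i=2}^{n-1}|\overline{sa}^i|+|\overline{sa}^n||sb|,$$ where $u=s_{d-1}g$ is evaluated by $u(s_{1-d}b)=(-1)^{(d-1)|u|}g(b)$. Same for $\mathcal B$. **Strict morphisms.** A strict $d$-pre-Calabi-Yau morphism is a map $\Phi_0:\mathcal O_{\mathcal A}\to\mathcal O_{\mathcal B}$ and degree $0$ maps $\Phi^{x,y}:{}_x\mathcal A_y[1]\to{}_{\Phi_0(x)}\mathcal B_{\Phi_0(y)}[1]$ with $$(\Phi^{\mathrm{lt}(\bar x^1),\mathrm{rt}(\bar x^2)}\otimes\cdots\otimes\Phi^{\mathrm{lt}(\bar x^n),\mathrm{rt}(\bar x^1)})\circ s_{d+1}M_{\mathcal A}^{\bar{\bar x}}=s_{d+1}M_{\mathcal B}^{\Phi_0(\bar{\bar x})}\circ(\Phi^{\otimes(\lg(\bar x^1)-1)}\otimes\cdots\otimes\Phi^{\otimes(\lg(\bar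 x^n)-1)})$$ for all types (shifts of $\Phi$ understood on outputs). Denote by $\tilde\Phi:{}_x\mathcal A_y\to{}_{\Phi_0(x)}\mathcal B_{\Phi_0(y)}$ the corresponding unshifted degree $0$ map. **The quiver $\mathcal A\oplus\mathcal B^*[d-1]$, $sm_{\mathcal A\oplus\mathcal B^*}$ and the bilinear forms.** $\mathcal A\oplus\mathcal B^*[d-1]$ has objects $\mathcal O_{\mathcal A}$ and ${}_x(\mathcal A\oplus\mathcal B^*[d-1])_y={}_x\mathcal A_y\oplus{}_{\Phi_0(x)}\mathcal B^*_{\Phi_0(y)}[d-1]$; its shift by $1$ is $\mathcal A[1]\oplus\mathcal B^*[d]$. For a word $w$ in elements $sa$ of $\mathcal A[1]$ and $tf$ of $\mathcal B^*[d]$: the $\mathcal A[1]$-valued part of $sm_{\mathcal A\oplus\mathcal B^*}(w)$ is the $\mathcal A[1]$-valued part of $sm_{\mathcal A\oplus\mathcal A^*}(w')$, $w'$ being obtained by replacing each $tf$ by $t(f\circ\tilde\Phi)$; the $\mathcal B^*[d]$-valued part is the $\mathcal B^*[d]$-valued part of $sm_{\mathcal B\oplus\mathcal B^*}(w'')$, $w''$ being obtained by replacing each $sa$ by $\Phi(sa)$. $\Gamma^\Phi$ is given by ${}_y\Gamma^\Phi_x(tf,sa)=-(-1)^{|sa||tf|}{}_x\Gamma^\Phi_y(sa,tf)=(-1)^{|tf|+1}f(\tilde\Phi(a))$ for $f\in{}_{\Phi_0(y)}\mathcal B^*_{\Phi_0(x)}$, $a\in{}_x\mathcal A_y$, and vanishes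 on pairs $(tf,tg)$ and $(sa,sb)$. $\Gamma^{\mathcal A}$ and $\Gamma^{\mathcal B}$ are the same forms for $\mathcal B=\mathcal A$, $\Phi=\mathrm{id}$, and for $\mathcal A=\mathcal B$, $\Phi=\mathrm{id}$. *)

(* Defs.v *)
From HB Require Import structures.
From mathcomp Require Import all_boot all_order all_algebra.
From mathcomp Require Import generic_quotient.
From mathcomp Require Import boolp functions.

Set Implicit Arguments.
Unset Strict Implicit.
Unset Printing Implicit Defensive.

Import GRing.Theory.
Local Open Scope ring_scope.
Local Open Scope quotient_scope.

(* Conventions.  [A x y i] is the component of degree [i] of the graded space
   _x A_y.  The shifts s_n are the identity on underlying sets, so an element
   of A[1], A[-d], ... is represented by the underlying element of A, and only
   the degree used in the Koszul signs depends on the shift.  A homogeneous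
   element together with its objects and its (unshifted) degree is a [letter],
   and a homogeneous pure tensor is a sequence of letters. *)

Record quiver (k : fieldType) := Quiver {
  obj : eqType;
  hom :> obj -> obj -> int -> lmodType k }.

Section Letters.
Variables (k : fieldType) (Q : quiver k).

Record letter := Letter {
  lft : obj Q; rgt : obj Q; ldeg : int; lval : Q lft rgt ldeg }.

(* The component of a homogeneous element in [Q x y i]: its value if it lies
   there, and 0 otherwise. *)
Definition proj (x y : obj Q) (i : int) (l : letter) : Q x y i :=
  let: Letter x' y' i' a := l in
  match x' =P x, y' =P y, i' =P i with
  | ReflectT ex, ReflectT ey, ReflectT ei =>
      ecast i (Q x y i) ei (ecast y (Q x y i') ey (ecast x (Q x y' i') ex a))
  | _, _, _ => 0
  end.

Definition multilinear (W : lmodType k) (mu : seq letter -> W) : Prop :=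
  forall (l r : seq letter) x y i (c : k) (a b : Q x y i),
    mu (l ++ Letter (c *: a + b) :: r) =
      c *: mu (l ++ Letter a :: r) + mu (l ++ Letter b :: r).

(* [chain x s]: the letters s are consecutive morphisms, starting at x. *)
Fixpoint chain (x : obj Q) (s : seq letter) : bool :=
  if s is l :: s' then (lft l == x) && chain (rgt l) s' else true.

Definition composable (s : seq letter) : bool :=
  if s is l :: s' then chain (rgt l) s' else false.

(* Degree in Q[1]. *)
Definition sdeg (l : letter) : int := ldeg l - 1.
Definition wdeg (w : seq letter) : int := \sum_(l <- w) sdeg l.

End Letters.

Arguments Letter {k Q} {lft rgt ldeg} lval.

(* The tensor algebra of a quiver: formal linear combinations of words,
   identified when all multilinear maps agree on them.  It contains every
   tensor product of components of Q as the span of the words with the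
   corresponding objects and degrees. *)
Section Tensors.
Variables (k : fieldType) (Q : quiver k).

Definition fsum : Type := seq (k * seq (letter Q)).
HB.instance Definition _ := gen_eqMixin fsum.
HB.instance Definition _ := gen_choiceMixin fsum.

Definition fsum_eval (W : lmodType k) (mu : seq (letter Q) -> W) (t : fsum) : W :=
  \sum_(p <- t) p.1 *: mu p.2.

Definition fsum_eq (s t : fsum) : bool :=
  `[< forall (W : lmodType k) (mu : seq (letter Q) -> W),
        multilinear mu -> fsum_eval mu s = fsum_eval mu t >].

Lemma fsum_eq_refl : reflexive fsum_eq.
Proof. by move=> s; apply/asboolP. Qed.

Lemma fsum_eq_sym : symmetric fsum_eq.
Proof. by move=> s t; apply/asboolP/asboolP => H W mu /H. Qed.

Lemma fsum_eq_trans : transitive fsum_eq.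
Proof.
move=> t s u /asboolP st /asboolP tu; apply/asboolP => W mu muP.
by rewrite st // tu.
Qed.

Canonical fsum_equiv := EquivRel fsum_eq fsum_eq_refl fsum_eq_sym fsum_eq_trans.

Definition tens : Type := {eq_quot fsum_equiv}.
HB.instance Definition _ := EqQuotient.on tens.
HB.instance Definition _ := Choice.on tens.

(* Linear extension to the tensors of a map given on words; it is meant for
   multilinear maps, for which the choice of representative is irrelevant. *)
Definition tlift (W : lmodType k) (mu : seq (letter Q) -> W) (t : tens) : W :=
  fsum_eval mu (repr t).

Lemma fsum_eqP (s t : fsum) :
  reflect (forall (W : lmodType k) (mu : seq (letter Q) -> W),
             multilinear mu -> fsum_eval mu s = fsum_eval mu t)
          (\pi_tens s == \pi_tens t).
Proof. by rewrite piE; apply: asboolP. Qed.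

Lemma tlift_pi (W : lmodType k) (mu : seq (letter Q) -> W) (s : fsum) :
  multilinear mu -> tlift mu (\pi_tens s) = fsum_eval mu s.
Proof.
move=> muP; rewrite /tlift.
by have /eqP/fsum_eqP := reprK (\pi_tens s); apply.
Qed.

Definition tadd (s t : tens) : tens := \pi_tens (repr s ++ repr t).
Definition tscale (c : k) (t : tens) : tens :=
  \pi_tens [seq (c * p.1, p.2) | p <- repr t].
Definition topp (t : tens) : tens := tscale (-1) t.
Definition tzero : tens := \pi_tens [::].

Lemma tensP (s t : tens) :
  (forall (W : lmodType k) (mu : seq (letter Q) -> W),
     multilinear mu -> tlift mu s = tlift mu t) <-> s = t.
Proof.
split=> [H|-> //]; rewrite -[s]reprK -[t]reprK; apply/eqP/fsum_eqP.
exact: H.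
Qed.

Lemma tlift_add (W : lmodType k) (mu : seq (letter Q) -> W) s t :
  multilinear mu -> tlift mu (tadd s t) = tlift mu s + tlift mu t.
Proof. by move=> muP; rewrite tlift_pi // /fsum_eval big_cat. Qed.

Lemma tlift_scale (W : lmodType k) (mu : seq (letter Q) -> W) c t :
  multilinear mu -> tlift mu (tscale c t) = c *: tlift mu t.
Proof.
move=> muP; rewrite tlift_pi // /fsum_eval big_map /tlift /fsum_eval scaler_sumr.
by apply: eq_bigr => p _; rewrite scalerA.
Qed.

Lemma tlift_zero (W : lmodType k) (mu : seq (letter Q) -> W) :
  multilinear mu -> tlift mu tzero = 0.
Proof. by move=> muP; rewrite tlift_pi // /fsum_eval big_nil. Qed.

Lemma taddA : associative tadd.
Proof. by move=> s t u; apply/tensP => W mu muP; rewrite !tlift_add // addrA. Qed.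

Lemma taddC : commutative tadd.
Proof. by move=> s t; apply/tensP => W mu muP; rewrite !tlift_add // addrC. Qed.

Lemma tadd0 : left_id tzero tadd.
Proof.
by move=> t; apply/tensP => W mu muP; rewrite tlift_add // tlift_zero // add0r.
Qed.

Lemma taddN : left_inverse tzero topp tadd.
Proof.
move=> t; apply/tensP => W mu muP.
by rewrite tlift_add // tlift_scale // tlift_zero // scaleN1r addNr.
Qed.

HB.instance Definition _ := GRing.isZmodule.Build tens taddA taddC tadd0 taddN.

Lemma tscaleA a b t : tscale a (tscale b t) = tscale (a * b) t.
Proof. by apply/tensP => W mu muP; rewrite !tlift_scale // scalerA. Qed.

Lemma tscale1 : left_id 1 tscale.
Proof. by move=> t; apply/tensP => W mu muP; rewrite !tlift_scale // scale1r. Qed.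

Lemma tscaleDr : right_distributive tscale +%R.
Proof.
move=> a s t; apply/tensP => W mu muP.
by rewrite !(tlift_scale, tlift_add) // scalerDr.
Qed.

Lemma tscaleDl t : {morph tscale^~ t : a b / a + b}.
Proof.
move=> a b; apply/tensP => W mu muP.
by rewrite !(tlift_scale, tlift_add) // scalerDl.
Qed.

HB.instance Definition _ :=
  GRing.Zmodule_isLmodule.Build k tens tscaleA tscale1 tscaleDr tscaleDl.

Definition tpure (w : seq (letter Q)) : tens := \pi_tens [:: (1, w)].

Lemma tlift_pure (W : lmodType k) (mu : seq (letter Q) -> W) w :
  multilinear mu -> tlift mu (tpure w) = mu w.
Proof. by move=> muP; rewrite tlift_pi // /fsum_eval big_seq1 scale1r. Qed.

Lemma tlift_linear (W : lmodType k) (mu : seq (letter Q) -> W) c s t :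
  multilinear mu -> tlift mu (c *: s + t) = c *: tlift mu s + tlift mu t.
Proof.
by move=> muP; rewrite -tlift_scale // -tlift_add.
Qed.

Lemma tpure_multilinear : multilinear tpure.
Proof.
move=> l r x y i c a b; apply/tensP => W mu muP.
by rewrite tlift_linear // !tlift_pure.
Qed.

Definition tspan (P : pred (seq (letter Q))) (t : tens) : Prop :=
  exists2 s : fsum, all (fun p => P p.2) s &
                    t = \sum_(p <- s) p.1 *: tpure p.2.

End Tensors.

Section Signs.
Variable k : fieldType.

Definition sgn (n : int) : k := (-1) ^ n.

(* Koszul sign of the permutation turning v_0, v_1, ... (of degrees ds) into
   v_{p_0}, v_{p_1}, ... *)
Definition koszul (ds : seq int) (p : seq nat) : k :=
  sgn (\sum_(0 <= r < size p)
         \sum_(r.+1 <= s < size p | (nth 0%N p s < nth 0%N p r)%N)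
           ds`_(nth 0%N p r) * ds`_(nth 0%N p s)).

End Signs.

Section Dual.
Variables (k : fieldType) (V : lmodType k).

Definition linear_pred : {pred V -> k^o} := fun f => `[< linear f >].

Record dual := Dual { dual_fun :> V -> k^o; _ : dual_fun \in linear_pred }.

HB.instance Definition _ := [isSub for dual_fun].
HB.instance Definition _ := gen_eqMixin dual.
HB.instance Definition _ := gen_choiceMixin dual.

Lemma linear_pred_submod : submod_closed linear_pred.
Proof.
split.
  by apply/asboolP => c a b /=; rewrite scaler0 addr0.
move=> c f g /asboolP fl /asboolP gl; apply/asboolP => e a b.
rewrite !fctE fl gl !scalerDr !scalerA [c * e]mulrC.
by rewrite addrACA.
Qed.

HB.instance Definition _ :=
  GRing.isSubmodClosed.Build k (V -> k^o) linear_pred linear_pred_submod.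
HB.instance Definition _ := [SubChoice_isSubLmodule of dual by <:].

End Dual.

Section Multi.
Variables (k : fieldType) (d : int).

(* A tuple of objects with a pure tensor of A[1] over it: the first object,
   followed by the letters.  A block with no letters is a tuple of length 1
   with the tensor 1. *)
Definition block (A : quiver k) : Type := (obj A * seq (letter A))%type.

Section Blocks.
Variable A : quiver k.
Implicit Types (b : block A) (bs : seq (block A)) (v : seq (letter A)).

Definition blt b : obj A := b.1.
Definition brt b : obj A := last b.1 [seq rgt l | l <- b.2].
Definition bdeg b : int := wdeg b.2.
Definition bsdeg bs : int := \sum_(b <- bs) bdeg b.
Definition btake n b : block A := (b.1, take n b.2).
Definition bdrop n b : block A := (brt (btake n b), drop n b.2).

Definition is_type bs : bool :=
  match bs with
  | [::] => false
  | [:: b] => (0 < size b.2)%N && chain b.1 b.2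
  | _ :: _ => all (fun b => chain b.1 b.2) bs
  end.

(* Degree in A[-d]. *)
Definition odeg (l : letter A) : int := ldeg l + d.
Definition vdeg v : int := \sum_(l <- v) odeg l.

(* Homogeneous elements of degree e of Multi_d(A): families, indexed by the
   types, of multilinear maps on pure tensors.  The value outside types is
   normalized to 0. *)
Record multi (e : int) := Multi {
  mfun :> seq (block A) -> tens A;
  multi_dom : forall bs, ~~ is_type bs -> mfun bs = 0;
  multi_lin : forall pre x post, multilinear (fun w => mfun (pre ++ (x, w) :: post));
  multi_cod : forall bs, is_type bs ->
    tspan [pred v | [&& [seq lft l | l <- v] == [seq blt b | b <- bs],
                        [seq rgt l | l <- v] == rot 1 [seq brt b | b <- bs] &
                        vdeg v == bsdeg bs + e]] (mfun bs) }.

(* tau_out: the last output factor is moved to the front. *)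
Definition tau_out : tens A -> tens A :=
  tlift (fun v =>
    if v is h :: t then
      let: (r, l) := (belast h t, last h t) in
      sgn k (odeg l * vdeg r) *: tpure (l :: r)
    else 0).

Definition cyclic_invariant (F : seq (block A) -> tens A) : Prop :=
  forall b bs, is_type (b :: bs) ->
    F (b :: bs) = sgn k (bdeg b * bsdeg bs) *: tau_out (F (rcons bs b)).

(* id (x) ... (x) id (x) s_{d+1} on A[-d] (x) ... (x) A[-d]. *)
Definition sout : tens A -> tens A :=
  tlift (fun v =>
    if v is h :: t then sgn k ((d + 1) * vdeg (belast h t)) *: tpure v else 0).

(* Degree of an output word whose last factor has been shifted by s_{d+1}. *)
Definition svdeg v : int := vdeg v - (d + 1).

(* The necklace product s_{d+1}F o_nec s_{d+1}G, where eF is the degree of F in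
   Multi_d(A).  Using the cyclic relabelling of discs, every two-disc diagram of
   type zs = (z_1, ..., z_N) is of exactly one of the following forms.
   - [root_F1]: the root is the last output of F and G has a single output.
     Then some z_j is a concatenation L Y R, G has type (Y) and F has type
     (..., z_{j-1}, L g R, z_{j+1}, ...), g being the output of G.
   - [root_F2]: the root is the last output of F, and the last output g of G is
     connected to F.  Then, for some j < l, z_j = Y R and z_l = L Y', the type
     of G is (Y, z_{j+1}, ..., z_{l-1}, Y') and the type of F is
     (..., z_{j-1}, L g R, z_{l+1}, ...).
   - [root_G]: the root is the last output of G, and the output g of G connected
     to F is not the last one; the bold arrow of F is an incoming arrow, taken
     to lie in the first sector of F.  Then, for some j < l, z_j = E Y and
     z_l = Y' R, the type of G is (..., z_{j-1}, Y, Y', z_{l+1}, ...), its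
     output between Y and Y' is g, and the type of F is
     (E g R, z_{j+1}, ..., z_{l-1}).
   The first Koszul sign brings the inputs of G to the left, the second one the
   inputs of F, and the third one orders the outputs. *)
Section Necklace.
Variables (eF : int) (F G : seq (block A) -> tens A).

Definition root_F1 pre z post (m n : nat) : tens A :=
  let L := take m z.2 in
  let Y := bdrop m (btake n z) in
  let R := drop n z.2 in
  koszul k [:: bsdeg pre; wdeg L; bdeg Y; wdeg R; bsdeg post]
           [:: 2; 0; 1; 3; 4]%N *:
  tlift (fun gs =>
    if gs is [:: g] then
      koszul k [:: sdeg g; bsdeg pre; wdeg L; wdeg R; bsdeg post]
               [:: 1; 2; 0; 3; 4]%N *:
      sout (F (pre ++ (z.1, L ++ g :: R) :: post))
    else 0) (sout (G [:: Y])).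

Definition root_F2 pre zj mid zl post (m n : nat) : tens A :=
  let: (Y, R) := (btake m zj, drop m zj.2) in
  let: (L, Y') := (take n zl.2, bdrop n zl) in
  koszul k [:: bsdeg pre; bdeg Y; wdeg R; bsdeg mid; wdeg L; bdeg Y'; bsdeg post]
           [:: 1; 3; 5; 0; 2; 4; 6]%N *:
  tlift (fun gs =>
    if gs is h :: t then
      let: (K, g) := (belast h t, last h t) in
      koszul k [:: vdeg K; sdeg g; bsdeg pre; wdeg R; wdeg L; bsdeg post]
               [:: 2; 4; 1; 3; 5; 0]%N *:
      tlift (fun fs =>
        let: (f1, f2) := (take (size pre) fs, drop (size pre) fs) in
        koszul k [:: vdeg f1; svdeg f2; vdeg K] [:: 0; 2; 1]%N *:
        tpure (f1 ++ K ++ f2))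
      (sout (F (pre ++ (zl.1, L ++ g :: R) :: post)))
    else 0) (sout (G (Y :: rcons mid Y'))).

Definition root_G pre zj mid zl post (m n : nat) : tens A :=
  let: (E, Y) := (take m zj.2, bdrop m zj) in
  let: (Y', R) := (btake n zl, drop n zl.2) in
  koszul k [:: bsdeg pre; wdeg E; bdeg Y; bsdeg mid; bdeg Y'; wdeg R; bsdeg post]
           [:: 0; 2; 4; 6; 1; 3; 5]%N *:
  tlift (fun gs =>
    if drop (size pre) gs is g :: K2 then
      let K1 := take (size pre) gs in
      koszul k [:: vdeg K1; odeg g; svdeg K2; wdeg E; bsdeg mid; wdeg R]
               [:: 3; 1; 5; 4; 0; 2]%N *:
      ((sgn k ((d + 1) * (eF + d + 1)) * sgn k ((d + 1) * wdeg E)) *: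
      tlift (fun fs =>
        koszul k [:: vdeg fs; vdeg K1; svdeg K2] [:: 1; 0; 2]%N *:
        tpure (K1 ++ fs ++ K2))
      (F ((zj.1, E ++ g :: R) :: mid)))
    else 0) (sout (G (pre ++ Y :: Y' :: post))).

Definition necklace (zs : seq (block A)) : tens A :=
  \sum_(0 <= j < size zs)
    if drop j zs is zj :: r then
      let pre := take j zs in
      \sum_(0 <= m < size zj.2) \sum_(m.+1 <= n < (size zj.2).+1)
        root_F1 pre zj r m n
      + \sum_(0 <= q < size r)
          if drop q r is zl :: post then
            \sum_(0 <= m < (size zj.2).+1) \sum_(0 <= n < (size zl.2).+1)
              (root_F2 pre zj (take q r) zl post m n
               + root_G pre zj (take q r) zl post m n)
          else 0
    else 0.

End Necklace.

(* The element s_{d+1}M of Multi_d(A)[d+1] has degree 1, so that M has degree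
   1 + (d + 1). *)
Definition preCY_degree : int := 1 + (d + 1).

Record preCY := PreCY {
  preCY_op :> multi preCY_degree;
  preCY_cyclic : cyclic_invariant preCY_op;
  preCY_eq : forall zs, is_type zs ->
    necklace preCY_degree preCY_op preCY_op zs = 0 }.

End Blocks.

Section Strict.
Variables A B : quiver k.

Definition lmap (phi0 : obj A -> obj B)
    (phi : forall x y i, {linear A x y i -> B (phi0 x) (phi0 y) i})
    (l : letter A) : letter B :=
  Letter (phi (lft l) (rgt l) (ldeg l) (lval l)).

(* The maps Phi^{x,y} of degree 0 are given through the underlying unshifted
   maps. *)
Record strict_morphism (MA : preCY A) (MB : preCY B) := StrictMorphism {
  phi0 : obj A -> obj B;
  phi : forall x y i, {linear A x y i -> B (phi0 x) (phi0 y) i};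
  phi_strict : forall bs, is_type bs ->
    tlift (fun v => tpure [seq lmap phi l | l <- v]) (sout (MA bs)) =
    sout (MB [seq (phi0 b.1, [seq lmap phi l | l <- b.2]) | b <- bs]) }.

End Strict.

(* The graded dual: the component from y to x is the dual of the component of A
   from x to y, and its part of degree i is the dual of the part of degree -i. *)
Definition dualq (A : quiver k) : quiver k :=
  Quiver (fun x y i => (dual (A y x (- i)) : lmodType k)).

Definition pairing (A : quiver k) (f : letter (dualq A)) (v : letter A) : k :=
  (lval f : dual _) (@proj k A (rgt f) (lft f) (- ldeg f) v).

(* Degree of tf in A^*[d]. *)
Definition tdeg (A : quiver k) (f : letter (dualq A)) : int := ldeg f - d.

(* The quiver A (+) B^*[d-1]. *)
Definition sumq (A B : quiver k) (phi0 : obj A -> obj B) : quiver k :=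
  Quiver (fun x y i =>
    ((A x y i * dualq B (phi0 x) (phi0 y) (i + (d - 1))%R)%type : lmodType k)).

Definition fst_letter (A B : quiver k) (phi0 : obj A -> obj B)
    (l : letter (sumq phi0)) : letter A :=
  @Letter k A (lft l) (rgt l) (ldeg l) (lval l).1.

Definition snd_letter (A B : quiver k) (phi0 : obj A -> obj B)
    (l : letter (sumq phi0)) : letter (dualq B) :=
  @Letter k (dualq B) (phi0 (lft l)) (phi0 (rgt l)) (ldeg l + (d - 1)) (lval l).2.

Definition doubleq (A : quiver k) : quiver k := @sumq A A idfun.

Section Double.
Variables (A : quiver k) (e : int) (M : multi A e).
Implicit Types (bs : seq (block A)) (fs : seq (letter (dualq A))).
Implicit Types v : seq (letter A).

(* (f^1 o s_d) (x) ... (x) (f^{n-1} o s_d) (x) s_d applied to v, in _x A_y^i. *)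
Fixpoint contract_last fs v (x y : obj A) (i : int) : A x y i :=
  match fs, v with
  | [::], [:: l] => proj x y i l
  | f :: fs', l :: v' =>
      (sgn k (odeg l * (\sum_(g <- fs') tdeg g - d)) * pairing f l) *:
      contract_last fs' v' x y i
  | _, _ => 0
  end.

(* (f^1 o s_d) (x) ... (x) (f^{n-1} o s_d) applied to v. *)
Fixpoint contract fs v : k :=
  match fs, v with
  | [::], [::] => 1
  | f :: fs', l :: v' =>
      (sgn k (odeg l * \sum_(g <- fs') tdeg g) * pairing f l) * contract fs' v'
  | _, _ => 0
  end.

Definition jeps bs fs : int :=
  let ds := [seq bdeg b | b <- bs] in
  let ts := [seq tdeg f | f <- fs] in
  let n := size bs in
  \sum_(0 <= i < n.-1) ts`_i * (\sum_(i.+1 <= j < n) ds`_j)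
  + e * (\sum_(0 <= i < n.-1) ts`_i)
  + d * (n.-1)%:Z
  + \sum_(0 <= i < n) \sum_(i.+1 <= j < n) ds`_i * ds`_j
  + \sum_(0 <= i < n.-1) \sum_(i.+1 <= j < n.-1) ts`_i * ts`_j.

Definition jfst bs fs x y i : A x y i :=
  sgn k (jeps bs fs) *: tlift (fun v => contract_last fs v x y i) (M bs).

Definition jdelta bs fs (sb : int) : int :=
  let ds := [seq bdeg b | b <- bs] in
  let n := size bs in
  jeps bs fs + d * (e + \sum_(0 <= i < n) ds`_i)
  + (ds`_n.-1 + sb) * (\sum_(1 <= i < n.-1) ds`_i)
  + ds`_n.-1 * sb.

(* For u = s_{d-1}g in A^*[d-1], of degree i, this is the value g(b). *)
Definition jsnd_fun bs fs x y i (b : A y x (- (i + (d - 1)))) : k^o :=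
  if bs is b1 :: b2 :: r then
    let: (mid, bn) := (belast b2 r, last b2 r) in
    (sgn k ((d - 1) * i) * sgn k (jdelta bs fs (sdeg (Letter b)))) *:
    tlift (contract fs : _ -> k^o) (M ((b1.1, b1.2 ++ Letter b :: bn.2) :: mid))
  else 0.

Lemma proj_linear (x y u v : obj A) (i j : int) : linear (fun a : A u v j =>
  proj x y i (Letter a)).
Proof.
move=> c a b /=; case: eqP => [ex|_]; last by rewrite scaler0 addr0.
case: eqP => [ey|_]; last by rewrite scaler0 addr0.
case: eqP => [ei|_]; last by rewrite scaler0 addr0.
by case: y / ey; case: x / ex; case: i / ei.
Qed.

Lemma pairing_linear (f : letter (dualq A)) (u v : obj A) (j : int) :
  linear (fun a : A u v j => pairing f (Letter a) : k^o).
Proof.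
move=> c a b; rewrite /pairing proj_linear.
by case: (lval f : dual _) => g /= /asboolP ->.
Qed.

Lemma contract_multilinear fs : multilinear (contract fs : _ -> k^o).
Proof.
elim: fs => [|f fs IH] [|l w] r x y i c a b /=.
- by rewrite scaler0 addr0.
- by rewrite scaler0 addr0.
- rewrite pairing_linear /odeg /= mulrDr mulrDl; congr (_ + _).
  rewrite -[LHS]/(_ * (c * _ : k) * _ : k) -[RHS]/(c * _ : k).
  by rewrite [_ * (c * _)]mulrCA; apply/esym/mulrA.
- rewrite [contract _ (_ ++ _)]IH mulrDr; congr (_ + _).
  by rewrite -[LHS]/(_ * (c * _ : k) : k) -[RHS]/(c * _ : k) mulrCA.
Qed.

Lemma contract_last_multilinear fs x y i :
  multilinear (fun v => contract_last fs v x y i).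
Proof.
elim: fs => [|f fs IH] [|l w] r u v j c a b /=.
- by case: r => [|? ?] /=; rewrite ?scaler0 ?addr0 //; apply: proj_linear.
- by case: w => [|? ?] /=; rewrite scaler0 addr0.
- rewrite pairing_linear /odeg /= mulrDr scalerDl; congr (_ + _).
  by rewrite -[X in X *: _]/(_ * (c * _)) mulrCA scalerA.
- by rewrite IH scalerDr !scalerA [c * _]mulrC.
Qed.

Lemma jsnd_linear bs fs x y i : @jsnd_fun bs fs x y i \in @linear_pred k _.
Proof.
apply/asboolP => c a b; rewrite /jsnd_fun.
case: bs => [|b1 [|b2 r]]; rewrite ?scaler0 ?addr0 //=.
have := @multi_lin _ _ M [::] b1.1 (belast b2 r) b1.2 (last b2 r).2 _ _ _ c a b.
rewrite /= => ->; rewrite tlift_linear; last exact: contract_multilinear.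
by rewrite scalerDr !scalerA [c * _]mulrC.
Qed.

Definition jsnd bs fs x y i : dualq A x y (i + (d - 1)) :=
  Dual (@jsnd_linear bs fs x y i).

(* All the ways of choosing, in each letter (a, f) of a word in A (+) A^*[d-1],
   either a or f.  A choice is returned as the blocks sa^1, ..., sa^n and the
   functionals f^1, ..., f^{n-1}, in the order opposite to that of the word
   (sa^n, tf^{n-1}, sa^{n-1}, ..., tf^1, sa^1).  The current block is (x, acc). *)
Fixpoint choices (x : obj A) (acc : seq (letter A)) (w : seq (letter (doubleq A))) :
    seq (seq (block A) * seq (letter (dualq A))) :=
  if w is l :: w' then
    choices x (rcons acc (fst_letter l)) w'
    ++ [seq (rcons p.1 (x, acc), rcons p.2 (snd_letter l))
         | p <- choices (rgt l) [::] w']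
  else [:: ([:: (x, acc)], [::])].

(* The multilinear extension to all words of the map j(s_{d+1}M). *)
Definition jmap (w : seq (letter (doubleq A))) (x y : obj A) (i : int) :
    doubleq A x y i :=
  if w is l :: _ then
    \sum_(p <- choices (lft l) [::] w)
      ((jfst p.1 p.2 x y i, jsnd p.1 p.2 x y i) : doubleq A x y i)
  else 0.

End Double.

End Multi.

Section AInfinity.
Variable k : fieldType.

(* A family of multilinear maps out of the spaces Q[1] (x) ... (x) Q[1], with
   values in the components of R; on a word w from x to y, only the values in
   the components from F0 x to F0 y are meaningful. *)
Definition operation (Q R : quiver k) : Type :=
  seq (letter Q) -> forall (x y : obj R) (i : int), R x y i.

Definition out (Q R : quiver k) (F0 : obj Q -> obj R) (e : int)
    (op : operation Q R) (h : letter Q) (t : seq (letter Q)) : letter R :=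
  Letter (op (h :: t) (F0 (lft h)) (F0 (rgt (last h t))) (wdeg (h :: t) + e + 1)).

(* op is multilinear of degree e with respect to the degrees of Q[1] and R[1]. *)
Definition homogeneous (Q R : quiver k) (F0 : obj Q -> obj R) (e : int)
    (op : operation Q R) : Prop :=
  (forall x y i, multilinear (fun w => op w x y i)) /\
  (forall h t i, composable (h :: t) -> i != wdeg (h :: t) + e + 1 ->
     op (h :: t) (F0 (lft h)) (F0 (rgt (last h t))) i = 0).

(* The sum of op o (id (x) sm (x) id), evaluated at w. *)
Definition insertions (Q R : quiver k) (sm : operation Q Q) (op : operation Q R)
    (w : seq (letter Q)) (x y : obj R) (n : int) : R x y n :=
  \sum_(0 <= i < size w) \sum_(i.+1 <= j < (size w).+1)
    if drop i (take j w) is h :: t then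
      sgn k (wdeg (take i w)) *:
      op (take i w ++ out idfun 1 sm h t :: drop j w) x y n
    else 0.

(* The decompositions of a word into consecutive nonempty words, each of them
   given by its first letter and the remaining ones. *)
Fixpoint splits (T : Type) (s : seq T) : seq (seq (T * seq T)) :=
  if s is x :: s' then
    flatten [seq ((x, [::]) :: p) ::
                 (if p is (h, t) :: p' then [:: (x, h :: t) :: p'] else [::])
            | p <- splits s']
  else [:: [::]].

Definition Ainf_structure (Q : quiver k) (sm : operation Q Q) : Prop :=
  homogeneous idfun 1 sm /\
  (forall h t n, composable (h :: t) ->
     insertions sm sm (h :: t) (lft h) (rgt (last h t)) n = 0).

Definition Ainf_morphism (Q R : quiver k) (smQ : operation Q Q)
    (smR : operation R R) (F0 : obj Q -> obj R) (sf : operation Q R) : Prop :=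
  [/\ Ainf_structure smQ, Ainf_structure smR, homogeneous F0 0 sf &
      forall h t n, composable (h :: t) ->
        insertions smQ sf (h :: t) (F0 (lft h)) (F0 (rgt (last h t))) n =
        \sum_(p <- splits (h :: t))
          smR [seq out F0 0 sf b.1 b.2 | b <- p]
            (F0 (lft h)) (F0 (rgt (last h t))) n].

Definition strict_operation (Q R : quiver k) (sf : operation Q R)
    (F0 : obj Q -> obj R) : Prop :=
  forall h t n, composable (h :: t) -> (0 < size t)%N ->
    sf (h :: t) (F0 (lft h)) (F0 (rgt (last h t))) n = 0.

(* Only the values of Gamma on pairs in _y Q_x[1] (x) _x Q_y[1] are meaningful. *)
Definition bilinear_form (Q : quiver k) (e : int)
    (Gamma : letter Q -> letter Q -> k) : Prop :=
  [/\ forall x y i j (b : Q x y j),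
        scalar (fun a : Q y x i => Gamma (Letter a) (Letter b)),
      forall x y i j (a : Q y x i),
        scalar (fun b : Q x y j => Gamma (Letter a) (Letter b)) &
      forall x y i j (a : Q y x i) (b : Q x y j),
        sdeg (Letter a) + sdeg (Letter b) + (e + 2) != 0 ->
        Gamma (Letter a) (Letter b) = 0].

(* Here z is the last letter q_n, and h :: t is the word q_1, ..., q_{n-1}. *)
Definition almost_cyclic (Q : quiver k) (sm : operation Q Q)
    (Gamma : letter Q -> letter Q -> k) : Prop :=
  forall h t z, composable (h :: t) ->
    lft z = rgt (last h t) -> rgt z = lft h ->
    Gamma (out idfun 1 sm h t) z =
    sgn k (sdeg z * wdeg (h :: t)) *
    Gamma (out idfun 1 sm z (belast h t)) (last h t).

Definition almost_cyclic_Ainf (Q : quiver k) (e : int) (sm : operation Q Q)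
    (Gamma : letter Q -> letter Q -> k) : Prop :=
  [/\ Ainf_structure sm, bilinear_form e Gamma & almost_cyclic sm Gamma].

Definition cyclic_Ainf_morphism (Q R : quiver k) (e : int)
    (smQ : operation Q Q) (gamma : letter Q -> letter Q -> k)
    (smR : operation R R) (Gamma : letter R -> letter R -> k)
    (F0 : obj Q -> obj R) (sf : operation Q R) : Prop :=
  [/\ almost_cyclic_Ainf e smQ gamma, almost_cyclic_Ainf e smR Gamma,
      Ainf_morphism smQ smR F0 sf,
      forall a b : letter Q, lft b = rgt a -> rgt b = lft a ->
        Gamma (out F0 0 sf a [::]) (out F0 0 sf b [::]) = gamma a b &
      forall h t, (3 <= size (h :: t))%N -> composable (h :: t) ->
        rgt (last h t) = lft h ->
        \sum_(1 <= i < size (h :: t))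
          (if (take i (h :: t), drop i (h :: t)) is (a :: u, b :: v)
           then Gamma (out F0 0 sf a u) (out F0 0 sf b v) else 0) = 0].

(* The family whose only nonzero components are those on words with one letter,
   where it is given by f. *)
Definition linear_operation (Q R : quiver k) (f : letter Q -> letter R) :
    operation Q R :=
  fun w x y i => if w is [:: l] then proj x y i (f l) else 0.

End AInfinity.

Section NaturalForm.
Variables (k : fieldType) (d : int) (A B : quiver k) (phi0 : obj A -> obj B).
Variable phi : forall x y i, {linear A x y i -> B (phi0 x) (phi0 y) i}.

(* (tf, sa) |-> f(phi(a)), where tf and sa are components of l and l'. *)
Definition phi_pairing (l l' : letter (sumq d phi0)) : k :=
  pairing (snd_letter l) (lmap phi (fst_letter l')).

Definition natural_form (l l' : letter (sumq d phi0)) : k :=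
  sgn k (sdeg l + 1) * phi_pairing l l'
  - sgn k (sdeg l * sdeg l') * (sgn k (sdeg l' + 1) * phi_pairing l' l).

End NaturalForm.

Definition Gamma_double (k : fieldType) (d : int) (A : quiver k) :
    letter (doubleq d A) -> letter (doubleq d A) -> k :=
  @natural_form k d A A idfun
    (fun x y i => (idfun : {linear A x y i -> A x y i})).

Section MixedStructure.
Variables (k : fieldType) (d : int) (A B : quiver k).
Variables (MA : preCY d A) (MB : preCY d B) (Phi : strict_morphism MA MB).

(* f |-> f o Phi, on the graded duals. *)
Lemma pullback_linear (x y : obj A) (i : int)
    (f : dual (B (phi0 Phi x) (phi0 Phi y) i)) :
  (fun a => f (phi Phi x y i a)) \in @linear_pred k (A x y i).
Proof.
apply/asboolP => c a b; rewrite linearP.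
by case: f => g /= /asboolP ->.
Qed.

Definition pullback x y i (f : dual (B (phi0 Phi x) (phi0 Phi y) i)) :
    dual (A x y i) := Dual (pullback_linear f).

Definition mixedq : quiver k := sumq d (phi0 Phi).

Definition varphiA (l : letter mixedq) : letter (doubleq d A) :=
  @Letter k (doubleq d A) (lft l) (rgt l) (ldeg l)
    ((lval l).1, pullback (lval l).2).

Definition varphiB (l : letter mixedq) : letter (doubleq d B) :=
  @Letter k (doubleq d B) (phi0 Phi (lft l)) (phi0 Phi (rgt l)) (ldeg l)
    (phi Phi _ _ _ (lval l).1, (lval l).2).

Definition sm_mixed : operation mixedq mixedq :=
  fun w x y i =>
    ((jmap MA (map varphiA w) x y i).1,
     (jmap MB (map varphiB w) (phi0 Phi x) (phi0 Phi y) i).2).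

Definition Gamma_Phi : letter mixedq -> letter mixedq -> k :=
  natural_form (phi Phi).

End MixedStructure.

Arguments mixedq {k d A B MA MB} Phi.
Arguments varphiA {k d A B MA MB} Phi l.
Arguments varphiB {k d A B MA MB} Phi l.
Arguments sm_mixed {k d A B MA MB} Phi w x y i.
Arguments Gamma_Phi {k d A B MA MB} Phi l l'.
Arguments Gamma_double {k} d A l l'.

(* Main.v *)
From Stdlib Require Import Ring.
Require Import Defs.
From mathcomp Require Import all_boot all_order all_algebra.
From mathcomp Require Import boolp functions zify.

Set Implicit Arguments.
Unset Strict Implicit.
Unset Printing Implicit Defensive.

Import GRing.Theory.
Local Open Scope ring_scope.

(** The proof first treats one pre-Calabi-Yau category [M] on [A], with the
    operation [jmap M] on the sum of [A] and its shifted dual, and then compares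
    the two categories.

    All the identities are multilinear, so they are checked on words each of whose
    letters lies in one of the two summands ([pure_zero]). Such a word alternates
    blocks of letters of [A] and functionals, and [jmap M] is then given by a
    single value of [M], contracted with the functionals ([jmap_word]).

    Almost cyclicity of [jmap M] is the cyclic invariance of [M]: closing up the
    word with one more letter puts the blocks and the functionals on a circle, and
    the closed value does not depend, up to the Koszul sign, on the point at which
    the circle is opened ([rotates_pure]).

    The Stasheff identity has two components. A term of the component in [A] is
    determined by the two ends of the piece of the word on which the inner
    operation is evaluated, and these cuts correspond to the two-disc diagrams in
    the necklace product. The signs agree up to one that does not depend on the cut
    ([insertions_word]), so that this component is a contraction of the necklace
    square of [M], hence zero. The dual component needs no further computation.
    The scalar obtained by pairing the Stasheff sum on a word with a closing letter
    is, by almost cyclicity and by the antisymmetry of the form, invariant under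
    rotation of the closed word ([closed_stasheff_rotate]). It vanishes if the
    closing letter is a functional, by the first component. Hence it vanishes if
    the closed word contains a functional, and if it contains none, all terms
    vanish because the operation on elements of [A] has no dual component
    ([closed_stasheff0]).

    Strictness of [Phi] says that the values of [MA] are carried to those of [MB].
    After contraction this gives that the component in the first summand is pushed
    forward by [Phi] ([jmap_first]) and the dual one is pulled back ([jmap_second]).
    These are exactly the facts needed for the maps [varphiA] and [varphiB] to
    commute with the mixed operation, which takes its first component from [A] and
    its second one from [B]. The Stasheff identity of the mixed operation then holds
    componentwise, its almost cyclicity is inherited through [varphiA], which
    preserves the forms, and a linear map that commutes with the operations and
    preserves the forms is a strict cyclic morphism ([strict_cyclic_morphism]). *)

(** * Signs *)

(** Every sign is handled through the parity of its exponent: rewriting with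
    [oddzE] turns an equality of two signs into a polynomial identity over
    the field with two elements, carried by [bool], which [ring] decides. *)
Definition oddz (n : int) : bool := odd `|n|%N.

Lemma oddzD m n : oddz (m + n) = xorb (oddz m) (oddz n).
Proof.
have addbE a b : a (+) b = xorb a b by case: a; case: b.
rewrite /oddz -addbE.
have E (a b : nat) : odd `|a%:Z - b%:Z| = odd a (+) odd b.
  case: (leqP b a) => H; first by rewrite subzn // absz_nat oddB.
  by rewrite distnC subzn 1?ltnW // absz_nat oddB 1?ltnW // addbC.
case: m n => a [] b; rewrite ?NegzE.
- by rewrite -PoszD absz_nat oddD.
- by rewrite E abszN.
- by rewrite addrC E addbC abszN.
- by rewrite -opprD abszN -PoszD !abszN oddD.
Qed.

Lemma oddzN n : oddz (- n) = oddz n.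
Proof. by rewrite /oddz abszN. Qed.

Lemma oddzM m n : oddz (m * n) = oddz m && oddz n.
Proof. by rewrite /oddz abszM oddM. Qed.

Lemma sgnE (k : fieldType) n : sgn k n = (-1) ^+ oddz n.
Proof.
rewrite /oddz /sgn; case: n => n; first by rewrite absz_nat signr_odd.
by rewrite NegzE abszN absz_nat signr_odd -exprnN invr_sign.
Qed.

Lemma eq_sgn (k : fieldType) m n : oddz m = oddz n -> sgn k m = sgn k n.
Proof. by rewrite !sgnE => ->. Qed.

Lemma sgnD (k : fieldType) m n : sgn k (m + n) = sgn k m * sgn k n.
Proof. by rewrite !sgnE oddzD -signr_addb; case: (oddz m); case: (oddz n). Qed.

Lemma sgn_sq (k : fieldType) m : sgn k m * sgn k m = 1.
Proof. by rewrite sgnE; case: (oddz m); rewrite ?mulrNN mulr1. Qed.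

Lemma sgn_neq0 (k : fieldType) m : sgn k m != 0.
Proof. by rewrite sgnE signr_eq0. Qed.

Lemma oddz0 : oddz 0 = false. Proof. by []. Qed.
Lemma oddz1 : oddz 1 = true. Proof. by []. Qed.
Lemma oddzS (n : nat) : oddz n.+1 = xorb (oddz n) true.
Proof. by rewrite -addn1 PoszD oddzD. Qed.

Definition oddzE := (oddzD, oddzM, oddzN, oddz0, oddz1, oddzS).

(** * Multilinear maps on words *)

Section Tensors.
Variables (k : fieldType) (Q : quiver k).
Implicit Types (W V : lmodType k) (t : tens Q) (v : seq (letter Q)).

(** [multilinear] for a single slot; the objects and the degree may vary, as
    everything else in the word may depend on them. *)
Definition letter_linear W (f : letter Q -> W) : Prop :=
  forall x y i (c : k) (a b : Q x y i),
    f (Letter (c *: a + b)) = c *: f (Letter a) + f (Letter b).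

Lemma multilinear0 W (mu : seq (letter Q) -> W) l r x y i :
  multilinear mu -> mu (l ++ Letter (0 : Q x y i) :: r) = 0.
Proof.
move=> muP; have := muP l r x y i (-1) 0 0.
by rewrite scaler0 addr0 scaleN1r addNr.
Qed.

Lemma multilinear_zero W (mu : seq (letter Q) -> W) l z r :
  multilinear mu -> lval z = 0 -> mu (l ++ z :: r) = 0.
Proof. by case: z => x y i a muP /= ->; apply: multilinear0. Qed.

Lemma letter_linear0 W (f : letter Q -> W) x y i :
  letter_linear f -> f (Letter (0 : Q x y i)) = 0.
Proof.
by move=> fP; have := fP x y i (-1) 0 0; rewrite scaler0 addr0 scaleN1r addNr.
Qed.

Lemma eq_multilinear W (mu nu : seq (letter Q) -> W) :
  mu =1 nu -> multilinear mu -> multilinear nu.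
Proof. by move=> e muP l r x y i c a b; rewrite -!e. Qed.

Lemma multilinear_letter W (mu : seq (letter Q) -> W) l r :
  multilinear mu -> letter_linear (fun g => mu (l ++ g :: r)).
Proof. by move=> muP x y i c a b; apply: muP. Qed.

Lemma multilinear_mid W (mu : seq (letter Q) -> W) l r :
  multilinear mu -> multilinear (fun v => mu (l ++ v ++ r)).
Proof.
move=> muP l' r' x y i c a b.
by rewrite -!catA /= !(catA l l'); apply: muP.
Qed.

(** Koszul signs depend on the degrees of the letters only, so multiplying by
    one does not destroy multilinearity. *)
Lemma multilinear_shape W (c : seq (letter Q) -> k) (mu : seq (letter Q) -> W) :
  (forall v v', map (@ldeg _ _) v = map (@ldeg _ _) v' -> c v = c v') ->
  multilinear mu -> multilinear (fun v => c v *: mu v).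
Proof.
move=> cP muP l r x y i e a b; rewrite muP scalerDr !scalerA [_ * e]mulrC.
by congr (_ * _ *: _ + _ *: _); apply: cP; rewrite !map_cat.
Qed.

Lemma letter_linear_shape W (c : letter Q -> k) (f : letter Q -> W) :
  (forall l l', ldeg l = ldeg l' -> c l = c l') ->
  letter_linear f -> letter_linear (fun l => c l *: f l).
Proof.
move=> cP fP x y i e a b; rewrite fP scalerDr !scalerA [_ * e]mulrC.
by congr (_ * _ *: _ + _ *: _); apply: cP.
Qed.

Lemma multilinear_linear W V (h : W -> V) (mu : seq (letter Q) -> W) :
  linear h -> multilinear mu -> multilinear (fun v => h (mu v)).
Proof. by move=> hP muP l r x y i c a b; rewrite muP hP. Qed.

Lemma letter_linear_linear W V (h : W -> V) (f : letter Q -> W) :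
  linear h -> letter_linear f -> letter_linear (fun l => h (f l)).
Proof. by move=> hP fP x y i c a b; rewrite fP hP. Qed.

Lemma multilinear_last W (f : seq (letter Q) -> letter Q -> W) :
  (forall K, letter_linear (f K)) -> (forall g, multilinear (f^~ g)) ->
  multilinear (fun v => if v is h :: t then f (belast h t) (last h t) else 0).
Proof.
move=> f1 f2; pose F v := if v is h :: t then f (belast h t) (last h t) else 0.
have FE K g : F (rcons K g) = f K g.
  by case: K => [//|h t]; rewrite /= belast_rcons last_rcons.
move=> l r x y i c a b; rewrite -!/(F _).
elim/last_ind: r => [|r z _]; first by rewrite !cats1 !FE f1.
by rewrite -!rcons_cons -!rcons_cat !FE f2.
Qed.

Lemma multilinear_at W p (f : seq (letter Q) -> letter Q -> seq (letter Q) -> W) :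
  (forall l r, letter_linear (fun g => f l g r)) ->
  (forall g r, multilinear (fun l => f l g r)) ->
  (forall l g, multilinear (f l g)) ->
  multilinear (fun v => if drop p v is g :: r then f (take p v) g r else 0).
Proof.
move=> f1 f2 f3 l r x y i c a b; rewrite !drop_cat !take_cat.
case: (ltngtP p (size l)) => H.
- by case: (drop p l) => [|g s] /=; [apply: f1|apply: f3].
- rewrite -subnSK //=; case: (drop _ r) => [|g s]; first by rewrite scaler0 addr0.
  exact: f2.
- by rewrite H subnn /= cats0 f1.
Qed.

Lemma multilinear_split W p (mu : seq (letter Q) -> W) u :
  multilinear mu -> multilinear (fun v => mu (take p v ++ u ++ drop p v)).
Proof.
move=> muP l r x y i c a b; rewrite !drop_cat !take_cat.
case: (ltngtP p (size l)) => H.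
- by rewrite !catA; apply: muP.
- by rewrite -subnSK //= -!catA; apply: muP.
- by rewrite H subnn /= cats0 !catA; apply: muP.
Qed.

Lemma eq_tlift W (mu nu : seq (letter Q) -> W) t : mu =1 nu -> tlift mu t = tlift nu t.
Proof. by move=> e; apply: eq_bigr => p _; rewrite e. Qed.

Lemma tlift_comp W V (h : W -> V) (mu : seq (letter Q) -> W) t :
  linear h -> h (tlift mu t) = tlift (fun v => h (mu v)) t.
Proof.
move=> hP; have h0 : h 0 = 0.
  by have := hP (-1) 0 0; rewrite scaler0 addr0 scaleN1r addNr.
rewrite /tlift /fsum_eval; elim: (repr t : seq _) => [|p s IH].
  by rewrite !big_nil.
by rewrite !big_cons hP IH.
Qed.

Lemma tlift_funD W (mu nu : seq (letter Q) -> W) c t :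
  tlift (fun v => c *: mu v + nu v) t = c *: tlift mu t + tlift nu t.
Proof.
rewrite /tlift /fsum_eval scaler_sumr -big_split; apply: eq_bigr => p _ /=.
by rewrite scalerDr !scalerA [_ * c]mulrC.
Qed.

Lemma tlift_funZ W (mu : seq (letter Q) -> W) c t :
  tlift (fun v => c *: mu v) t = c *: tlift mu t.
Proof.
apply/esym; apply: (tlift_comp (h := fun w => c *: w)) => e a b.
by rewrite scalerDr !scalerA mulrC.
Qed.

Lemma tlift_lin W (mu : seq (letter Q) -> W) : multilinear mu -> linear (tlift mu).
Proof. by move=> muP c a b; rewrite tlift_linear. Qed.

Lemma tlift0 W (mu : seq (letter Q) -> W) : multilinear mu -> tlift mu 0 = 0.
Proof. exact: tlift_zero. Qed.

Lemma tliftD W (mu : seq (letter Q) -> W) s t :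
  multilinear mu -> tlift mu (s + t) = tlift mu s + tlift mu t.
Proof. exact: tlift_add. Qed.

Lemma tliftZ W (mu : seq (letter Q) -> W) c t :
  multilinear mu -> tlift mu (c *: t) = c *: tlift mu t.
Proof. exact: tlift_scale. Qed.

Lemma tlift_sum W (mu : seq (letter Q) -> W) I (r : seq I) P (F : I -> tens Q) :
  multilinear mu ->
  tlift mu (\sum_(i <- r | P i) F i) = \sum_(i <- r | P i) tlift mu (F i).
Proof.
by move=> muP; apply: (big_morph _ (fun s t => tliftD s t muP) (tlift0 muP)).
Qed.

(** A tensor in the span of the words satisfying [P] only sees the values on
    these words. *)
Lemma tlift_ext W P (mu nu : seq (letter Q) -> W) t :
  tspan P t -> multilinear mu -> multilinear nu ->
  (forall v, P v -> mu v = nu v) -> tlift mu t = tlift nu t.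
Proof.
case=> s sP -> muP nuP e; rewrite !tlift_sum //.
elim: s sP => [|p s IH] /=; first by rewrite !big_nil.
case/andP=> Pp sP; rewrite !big_cons IH // !tliftZ // !tlift_pure //.
by rewrite e.
Qed.

End Tensors.

Section Shift.
Variables (k : fieldType) (d : int) (A : quiver k).
Implicit Types (v : seq (letter A)) (t : tens A) (W : lmodType k).

Lemma vdegE v : vdeg d v = \sum_(i <- map (@ldeg _ _) v) (i + d).
Proof. by rewrite big_map. Qed.

Lemma vdeg_cat v v' : vdeg d (v ++ v') = vdeg d v + vdeg d v'.
Proof. by rewrite /vdeg big_cat. Qed.

Lemma vdeg_cons l v : vdeg d (l :: v) = odeg d l + vdeg d v.
Proof. by rewrite /vdeg big_cons. Qed.

Lemma vdeg_rcons v l : vdeg d (rcons v l) = vdeg d v + odeg d l.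
Proof. by rewrite -cats1 vdeg_cat vdeg_cons /vdeg big_nil addr0. Qed.

Lemma vdeg_nil : vdeg d (Nil (letter A)) = 0.
Proof. by rewrite /vdeg big_nil. Qed.

Lemma vdeg_shape v v' : map (@ldeg _ _) v = map (@ldeg _ _) v' -> vdeg d v = vdeg d v'.
Proof. by rewrite !vdegE => ->. Qed.

Definition sout_word v : tens A :=
  if v is h :: t then sgn k ((d + 1) * vdeg d (belast h t)) *: tpure v else 0.

Lemma sout_word_multilinear : multilinear sout_word.
Proof.
pose c v := if v is h :: t then sgn k ((d + 1) * vdeg d (belast h t)) else 0.
apply: (@eq_multilinear _ _ _ (fun v => c v *: tpure v)).
  by case=> [|h t]; rewrite /= ?scale0r.
apply: multilinear_shape (@tpure_multilinear _ _) => v v'.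
elim/last_ind: v => [|v z _]; elim/last_ind: v' => [|v' z' _] //=;
  rewrite ?map_rcons.
- by move/(congr1 size); rewrite size_rcons.
- by move/(congr1 size); rewrite size_rcons.
move/rcons_inj=> [e _].
have cE w y : c (rcons w y) = sgn k ((d + 1) * vdeg d w).
  by case: w => [|? ?]; rewrite /= ?belast_rcons.
by rewrite !cE (vdeg_shape e).
Qed.

Lemma sout_linear : linear (@sout k d A).
Proof. by move=> c s t; apply: tlift_linear; apply: sout_word_multilinear. Qed.

(** The sign of [s_{d+1}] on the last output can be moved from the tensor to the
    map that consumes it. *)
Lemma tlift_sout W (mu nu : seq (letter A) -> W) P t :
  tspan P t -> multilinear mu -> multilinear nu -> ~~ P [::] ->
  (forall h v, P (h :: v) ->
     sgn k ((d + 1) * vdeg d (belast h v)) *: mu (h :: v) = nu (h :: v)) ->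
  tlift mu (sout d t) = tlift nu t.
Proof.
move=> tP muP nuP P0 e; rewrite /sout (tlift_comp _ _ (tlift_lin muP)).
apply: (tlift_ext tP) => //.
  apply: (@multilinear_linear _ _ _ _ (tlift mu)); first exact: tlift_lin.
  exact: sout_word_multilinear.
case=> [P0'|h v Pv]; first by rewrite P0' in P0.
by rewrite tliftZ // tlift_pure // e.
Qed.

End Shift.

(** * Quadratic sign exponents *)

Section Sums.
Implicit Types s t : seq int.

Definition sumz s : int := \sum_(x <- s) x.

(** The second elementary symmetric function of [s], that is the exponent of the
    sign of a complete reversal. *)
Fixpoint psum s : int := if s is x :: s' then x * sumz s' + psum s' else 0.

(** The exponent of the sign for moving each functional, of degree [t_i], past all
    the blocks with a larger index, of degrees [s_j]. *)
Fixpoint xsum t s : int :=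
  match t, s with
  | a :: t', _ :: s' => a * sumz s' + xsum t' s'
  | _, _ => 0
  end.

Lemma sumz_cons x s : sumz (x :: s) = x + sumz s.
Proof. by rewrite /sumz big_cons. Qed.

Lemma sumz_nil : sumz [::] = 0.
Proof. by rewrite /sumz big_nil. Qed.

Lemma sumz_cat s t : sumz (s ++ t) = sumz s + sumz t.
Proof. by rewrite /sumz big_cat. Qed.

Lemma sumz_rcons s x : sumz (rcons s x) = sumz s + x.
Proof. by rewrite -cats1 sumz_cat sumz_cons sumz_nil addr0. Qed.

Lemma psum_cat s t : psum (s ++ t) = psum s + psum t + sumz s * sumz t.
Proof.
elim: s => [|x s IH] /=; first by rewrite sumz_nil mul0r addr0 add0r.
rewrite IH sumz_cat sumz_cons mulrDr mulrDl -!addrA; congr (_ + _).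
by rewrite (addrCA (x * sumz t)) (addrCA (x * sumz t) (psum t)).
Qed.

Lemma psum_rcons s x : psum (rcons s x) = psum s + sumz s * x.
Proof. by rewrite -cats1 psum_cat /= sumz_cons sumz_nil mulr0 !addr0. Qed.

Lemma xsum_cat t1 t2 s1 s2 : size t1 = size s1 ->
  xsum (t1 ++ t2) (s1 ++ s2) = xsum t1 s1 + sumz t1 * sumz s2 + xsum t2 s2.
Proof.
elim: t1 s1 => [|a t IH] [|b s] //=; first by rewrite sumz_nil mul0r !add0r.
case=> /IH ->; rewrite sumz_cat sumz_cons mulrDr mulrDl -!addrA; congr (_ + _).
by rewrite (addrCA (a * sumz s2)).
Qed.

(** The first entry of [s] does not contribute to [xsum]; this form makes it
    disappear. *)
Definition xtail t s : int := xsum t (0 :: s).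

Lemma xsum_head t a s : xsum t (a :: s) = xtail t s.
Proof. by case: t. Qed.

Lemma xtail_cons (t : int) (ts : seq int) x s : xtail (t :: ts) (x :: s) = t * (x + sumz s) + xtail ts s.
Proof. by rewrite /xtail /= sumz_cons -/(xtail _ _) -(xsum_head _ x). Qed.

End Sums.

(** * Contraction of outputs with functionals *)

Section Contraction.
Variables (k : fieldType) (d : int) (A : quiver k).
Implicit Types (fs : seq (letter (dualq A))) (v : seq (letter A)).

Definition tdegs fs : seq int := [seq tdeg d f | f <- fs].

Definition tsum fs : int := sumz (tdegs fs).

Lemma tsumE fs : \sum_(g <- fs) tdeg d g = tsum fs.
Proof. by rewrite /tsum /sumz big_map. Qed.

(** [contract] without its Koszul signs. All the sign computations are done on
    these unsigned contractions, which are compatible with concatenation. *)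
Fixpoint ucontract fs v : k^o :=
  match fs, v with
  | [::], [::] => 1
  | f :: fs', l :: v' => pairing f l * ucontract fs' v'
  | _, _ => 0
  end.

Definition ucontract_last fs v (x y : obj A) (i : int) : A x y i :=
  if v is h :: t then ucontract fs (belast h t) *: proj x y i (last h t) else 0.

Lemma ucontract_last_rcons fs v g x y i : ucontract_last fs (rcons v g) x y i = ucontract fs v *: proj x y i g.
Proof. by case: v => [//|h t]; rewrite /= belast_rcons last_rcons. Qed.

Lemma proj_neq0 x y i (l : letter A) :
  proj x y i l != 0 -> [/\ lft l = x, rgt l = y & ldeg l = i].
Proof.
case: l => x' y' i' a /=; case: eqP => [ex|_]; last by rewrite eqxx.
case: eqP => [ey|_]; last by rewrite eqxx.
by case: eqP => [ei|_]; last by rewrite eqxx.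
Qed.

Lemma proj_id x y i (a : A x y i) : proj x y i (Letter a) = a.
Proof.
rewrite /proj; case: eqP => // ex; case: eqP => // ey; case: eqP => // ei.
by rewrite !eq_axiomK.
Qed.

Lemma Letter_proj x y i (l : letter A) :
  lft l = x -> rgt l = y -> ldeg l = i -> Letter (proj x y i l) = l.
Proof. by case: l => x' y' i' a ex ey ei; subst; rewrite proj_id. Qed.

Lemma dual_linear (V : lmodType k) (f : dual V) : linear f.
Proof. by case: f => f /= /asboolP. Qed.

Lemma dual_apply0 (V : lmodType k) (f : dual V) : f 0 = 0.
Proof.
have := dual_linear f (-1) 0 0.
by rewrite scaler0 addr0 scaleN1r addNr.
Qed.

Lemma pairing_neq0 (f : letter (dualq A)) (l : letter A) : pairing f l != 0 ->
  [/\ lft l = rgt f, rgt l = lft f & ldeg l = - ldeg f].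
Proof.
rewrite /pairing => H; apply: proj_neq0; apply/eqP => E.
by move: H; rewrite E dual_apply0 eqxx.
Qed.

Lemma pairing_odeg (f : letter (dualq A)) (l : letter A) :
  pairing f l != 0 -> odeg d l = - tdeg d f.
Proof. by case/pairing_neq0=> _ _ e; rewrite /odeg /tdeg e opprB addrC. Qed.

Lemma dual_funD (V : lmodType k) c (f g : dual V) x : (c *: f + g) x = c *: f x + g x.
Proof.
by have := linearP (\val : dual V -> _) c f g => /(congr1 (fun h => h x)).
Qed.

Lemma pairing_letter_linear l :
  letter_linear (fun f : letter (dualq A) => pairing f l : k^o).
Proof. by move=> x y i c a b; apply: dual_funD. Qed.

(** A nonzero pairing forces the degree of the output to be opposite to the one
    of the functional, so the sign of [contract] is constant on the words where
    it does not vanish. *)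
Lemma contractE fs v : contract d fs v = sgn k (psum (tdegs fs)) * ucontract fs v.
Proof.
elim: fs v => [|f fs IH] [|l v] /=; rewrite ?mulr0 ?mulr1 //.
rewrite IH tsumE sgnD.
have [->|/pairing_odeg ->] := eqVneq (pairing f l) 0.
  by rewrite !(mulr0, mul0r).
rewrite (@eq_sgn _ (- _ * _) (tdeg d f * tsum fs)); first by rewrite -!mulrA; congr (_ * _); rewrite mulrCA.
by rewrite !oddzM oddzN.
Qed.

Lemma contract_lastE fs v x y i :
  contract_last d fs v x y i =
  sgn k (psum (tdegs fs) + d * tsum fs) *: ucontract_last fs v x y i.
Proof.
elim: fs v => [|f fs IH] [|l v] /=; rewrite ?scaler0 //.
  rewrite /tsum sumz_nil mulr0 addr0 scale1r.
  by case: v => [|l' v] /=; rewrite ?scale1r ?scale0r.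
rewrite IH tsumE.
case: v => [|l' v] /=.
  by rewrite scale0r !scaler0.
rewrite !scalerA -mulrA; congr (_ *: _).
have [->|/pairing_odeg ->] := eqVneq (pairing f l) 0.
  by rewrite !(mulr0, mul0r).
rewrite !mulrA; congr (_ * _); rewrite mulrAC; congr (_ * _); rewrite -sgnD.
rewrite /tsum /= sumz_cons; apply: eq_sgn; rewrite !oddzE.
by ring.
Qed.

Lemma ucontract_multilinear fs : multilinear (ucontract fs).
Proof.
apply: (@eq_multilinear _ _ _
  (fun v => (sgn k (psum (tdegs fs))) *: (contract d fs v : k^o))).
  by move=> v; rewrite contractE scalerA sgn_sq scale1r.
by apply: multilinear_shape => //; apply: contract_multilinear.
Qed.

Lemma ucontract_last_multilinear fs x y i : multilinear (fun v => ucontract_last fs v x y i).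
Proof.
apply: (@eq_multilinear _ _ _
  (fun v => sgn k (psum (tdegs fs) + d * tsum fs) *: contract_last d fs v x y i)).
  by move=> v; rewrite contract_lastE scalerA sgn_sq scale1r.
by apply: multilinear_shape => //; apply: contract_last_multilinear.
Qed.

Lemma ucontract_multilinear_funs v : multilinear (fun fs => ucontract fs v).
Proof.
elim: v => [|l v IH] [|f u] r x y i c a b /=; rewrite ?scaler0 ?addr0 //.
  by rewrite pairing_letter_linear mulrDl scalerAl.
by rewrite IH mulrDr scalerAr.
Qed.

Lemma ucontract_last_multilinear_funs v x y i : multilinear (fun fs => ucontract_last fs v x y i).
Proof.
move=> l r x' y' j c a b; case: v => [|h t] /=; first by rewrite scaler0 addr0.
by rewrite ucontract_multilinear_funs scalerDl scalerA.
Qed.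

Lemma ucontract_size fs v : ucontract fs v != 0 -> size v = size fs.
Proof.
elim: fs v => [|f fs IH] [|l v] //=; rewrite ?eqxx //.
by rewrite mulf_eq0 negb_or => /andP[_ /IH ->].
Qed.

(** This is how degrees are known in the sign computations: either the
    contraction vanishes, or the total degree of the outputs is determined by
    the functionals. *)
Lemma ucontract_vdeg fs v : ucontract fs v != 0 -> vdeg d v = - tsum fs.
Proof.
rewrite /tsum; elim: fs v => [|f fs IH] [|l v] //=; rewrite ?eqxx //.
  by rewrite sumz_nil vdeg_nil oppr0.
rewrite mulf_eq0 negb_or => /andP[/pairing_odeg e /IH e'].
by rewrite vdeg_cons e e' sumz_cons (opprD (tdeg d f)).
Qed.

Lemma ucontract_cat f1 f2 v1 v2 : size f1 = size v1 ->
  ucontract (f1 ++ f2) (v1 ++ v2) = ucontract f1 v1 * ucontract f2 v2.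
Proof.
elim: f1 v1 => [|f f1 IH] [|l v1] //=; first by rewrite mul1r.
by case=> /IH ->; rewrite mulrA.
Qed.

End Contraction.

(** * Words of pure letters *)

Section Words.
Variables (k : fieldType) (Q : quiver k).
Implicit Types (bs pre post : seq (block Q)) (fs : seq (letter Q)).

(** The word [(sa^n, tf^{n-1}, ..., tf^1, sa^1)] from its blocks and functionals,
    which are listed, as in the definition of the operation, in the order
    opposite to that of the word. *)
Fixpoint word bs fs : seq (letter Q) :=
  match bs, fs with
  | b :: bs', f :: fs' => word bs' fs' ++ f :: b.2
  | b :: _, [::] => b.2
  | [::], _ => [::]
  end.

Lemma word_cat s1 s2 f1 u f2 : size s1 = (size f1).+1 ->
  word (s1 ++ s2) (f1 ++ u :: f2) = word s2 f2 ++ u :: word s1 f1.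
Proof.
elim: s1 f1 => [|b s1 IH] [|f f1] //= [].
  by move/size0nil=> ->.
by move/IH=> ->; rewrite -catA.
Qed.

(** Cutting a word inside a block. *)
Lemma word_glue pre post f1 f2 x x' y L R : size pre = size f1 ->
  word (pre ++ (x, L ++ R) :: post) (f1 ++ f2) =
  word ((x', L) :: post) f2 ++ word (rcons pre (y, R)) f1.
Proof.
elim: pre f1 => [|b pre IH] [|f f1] //=.
  by case: f2 => [|f f2] //=; rewrite -catA.
by case=> /IH ->; rewrite -catA.
Qed.

(** The conditions on the objects under which [word bs fs] is composable from [X]
    to [Y]. *)
Record wf (X Y : obj Q) bs fs : Prop := Wf {
  wf_chain : all (fun b => chain b.1 b.2) bs;
  wf_lt : [seq blt b | b <- bs] = rcons [seq rgt f | f <- fs] X;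
  wf_rt : [seq brt b | b <- bs] = Y :: [seq lft f | f <- fs] }.

Lemma wf_size X Y bs fs : wf X Y bs fs -> size bs = (size fs).+1.
Proof. by case=> _ _ /(congr1 size) /=; rewrite !size_map. Qed.

End Words.

Section Pure.
Variables (k : fieldType) (d : int) (A B : quiver k) (phi0 : obj A -> obj B).
Local Notation S := (sumq d phi0).

Definition isA (l : letter S) : Prop := (lval l).2 = 0.
Definition isF (l : letter S) : Prop := (lval l).1 = 0.

Fixpoint allP (T : Type) (P : T -> Prop) (s : seq T) : Prop :=
  if s is x :: s' then P x /\ allP P s' else True.

Lemma allP_cat T (P : T -> Prop) s t : allP P (s ++ t) <-> allP P s /\ allP P t.
Proof.
elim: s => [|x s IH] /=; first by split=> [?|[]].
by rewrite IH; tauto.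
Qed.

Lemma allP_rcons T (P : T -> Prop) s x : allP P (rcons s x) <-> allP P s /\ P x.
Proof. by rewrite -cats1 allP_cat /=; tauto. Qed.

Definition pure (bs : seq (block S)) (fs : seq (letter S)) : Prop :=
  allP (fun b => allP isA b.2) bs /\ allP isF fs.

Lemma chain_cat (Q : quiver k) x (s t : seq (letter Q)) :
  chain x (s ++ t) = chain x s && chain (last x [seq rgt l | l <- s]) t.
Proof. by elim: s x => [|l s IH] x //=; rewrite IH andbA. Qed.

Definition shape (Q : quiver k) (l : letter Q) := (lft l, rgt l, ldeg l).

(** A letter of the direct sum is the sum of its two components, so a multilinear
    map that vanishes on the composable words whose letters lie in one of the two
    summands vanishes on every composable word. The letters are decomposed one by
    one from the right end of the growing word [word bs fs]: a new letter either
    extends the first block or opens a new one. *)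
Lemma pure_zero (W : lmodType k) (mu : seq (letter S) -> W) X Y w :
  multilinear mu -> chain X w -> last X [seq rgt l | l <- w] = Y ->
  (forall bs fs, wf X Y bs fs -> pure bs fs ->
     map (@shape S) (word bs fs) = map (@shape S) w -> mu (word bs fs) = 0) ->
  mu w = 0.
Proof.
move=> muP chw lw H.
(* [u] is the part of the word that is still to be decomposed. *)
have step (u : seq (letter S)) bs fs Y0 : wf X Y0 bs fs -> pure bs fs ->
    chain Y0 u -> last Y0 [seq rgt l | l <- u] = Y ->
    map (@shape S) (word bs fs ++ u) = map (@shape S) w -> mu (word bs fs ++ u) = 0.
  elim: u bs fs Y0 => [|l u IH] bs fs Y0 wfP pP.
    by rewrite cats0 => _ /= eY; apply: H; rewrite // -eY.
  case: l => x y i [a f] /= /andP[/eqP ex chu] lu sh.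
  have -> : ((a, f) : S x y i) = 1 *: (a, 0) + (0, f).
    by rewrite scale1r; congr pair; rewrite /= ?addr0 ?add0r.
  rewrite muP scale1r.
  have -> : mu (word bs fs ++ (Letter ((a, 0) : S x y i)) :: u) = 0.
    case: bs wfP pP sh => [|[z b] bs] [] // ch lt rt [] /= [bA bsA] fsF sh.
    have E : word ((z, rcons b (Letter ((a, 0) : S x y i))) :: bs) fs ++ u =
             word ((z, b) :: bs) fs ++ Letter ((a, 0) : S x y i) :: u.
      by case: (fs) => [|f' fs'] /=; rewrite ?cat_rcons // -!catA /= cat_rcons.
    rewrite -E; case: rt => rt1 rt2; apply: (IH _ _ y) => //; last first.
    - by rewrite E -sh !map_cat.
    - by split=> //=; split=> //; apply/allP_rcons.
    split=> //=; last by rewrite -rt2 /brt /= map_rcons last_rcons.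
    case/andP: ch => ch1 ch2; apply/andP; split=> //.
    by rewrite -cats1 chain_cat ch1 /= -[last _ _]/(brt (z, b)) rt1 ex eqxx.
  rewrite add0r.
  have E : word ((y, [::]) :: bs) (Letter ((0, f) : S x y i) :: fs) ++ u =
             word bs fs ++ Letter ((0, f) : S x y i) :: u.
    by rewrite /= -catA.
  case: wfP => ch lt rt.
  rewrite -E; apply: (IH _ _ y) => //; last first.
  - by rewrite E -sh !map_cat.
  - by case: pP => p1 p2; split=> //=.
  by split=> //=; rewrite ?lt ?rt ?ex.
by apply: (step w [:: (X, [::])] [::] X).
Qed.

End Pure.

Arguments isA {k d A B phi0} l.
Arguments isF {k d A B phi0} l.
Arguments pure {k d A B phi0} bs fs.

(** * The operation on words of pure letters *)

Section Choices.
Variables (k : fieldType) (d : int) (A : quiver k).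
Local Notation D := (doubleq d A).
Implicit Types (W : lmodType k) (bs : seq (block A)) (fs : seq (letter (dualq A))).

Definition bimultilinear W (G : seq (block A) -> seq (letter (dualq A)) -> W) : Prop :=
  (forall pre x post fs, multilinear (fun w => G (pre ++ (x, w) :: post) fs)) /\
  (forall bs, multilinear (G bs)).

Definition choice_sum W (G : seq (block A) -> seq (letter (dualq A)) -> W) x acc
    (w : seq (letter D)) : W := \sum_(p <- choices x acc w) G p.1 p.2.

Lemma bimultilinear_rcons W G b f : @bimultilinear W G ->
  bimultilinear (fun bs fs => G (rcons bs b) (rcons fs f)).
Proof.
case=> G1 G2; split=> [pre x post fs|bs] l r x' y i c a a'.
  by rewrite !rcons_cat !rcons_cons; apply: G1.
by rewrite !rcons_cat !rcons_cons; apply: G2.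
Qed.

Lemma choice_sum_cons W G x acc l w :
  @choice_sum W G x acc (l :: w) = choice_sum G x (rcons acc (fst_letter l)) w +
    choice_sum (fun bs fs => G (rcons bs (x, acc)) (rcons fs (snd_letter l))) (rgt l) [::] w.
Proof. by rewrite /choice_sum /= big_cat big_map. Qed.

Lemma choice_sum_nil W G x acc : @choice_sum W G x acc [::] = G [:: (x, acc)] [::].
Proof. by rewrite /choice_sum /= big_seq1. Qed.

(** Multilinearity in the letters already collected in the current block, which
    the induction on the remaining ones requires. *)
Lemma choice_sum_acc W G x w : @bimultilinear W G -> multilinear (fun acc => choice_sum G x acc w).
Proof.
elim: w G x => [|l w IH] G x GP.
  by move=> u v x' y i c a b; rewrite !choice_sum_nil; apply: (GP.1 [::] x [::] [::]).
move=> u v x' y i c a b; rewrite !choice_sum_cons !rcons_cat !rcons_cons.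
rewrite (IH _ _ GP) scalerDr addrACA; congr (_ + _).
rewrite /choice_sum scaler_sumr -big_split; apply: eq_bigr => p _ /=.
by rewrite -!cats1 (GP.1 _ _ [::]).
Qed.

Lemma choice_sum_multilinear W G x acc : @bimultilinear W G -> multilinear (choice_sum G x acc).
Proof.
move=> GP u; elim: u G x acc GP => [|l u IH] G x acc GP r x' y i c a b.
  rewrite /= !choice_sum_cons scalerDr addrACA; congr (_ + _).
    by rewrite -!cats1; apply: (choice_sum_acc x r GP acc [::] c a.1 b.1).
  rewrite /choice_sum scaler_sumr -big_split; apply: eq_bigr => p _ /=.
  by rewrite -!(cats1 p.2); apply: (GP.2 _ p.2 [::] _ _ _ c a.2 b.2).
rewrite !cat_cons !choice_sum_cons (IH _ _ _ GP) (IH _ _ _ (bimultilinear_rcons _ _ GP)).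
by rewrite scalerDr addrACA.
Qed.

Definition fst_block (b : block D) : block A := (b.1, [seq fst_letter l | l <- b.2]).

Lemma choice_sum_A W G x acc (B w : seq (letter D)) : @bimultilinear W G -> allP isA B ->
  choice_sum G x acc (B ++ w) = choice_sum G x (acc ++ [seq fst_letter l | l <- B]) w.
Proof.
move=> GP; elim: B acc => [|l B IH] acc /=; first by rewrite cats0.
case=> lA BA; rewrite choice_sum_cons IH // cat_rcons.
rewrite [X in _ + X]big1 ?addr0 // => p _.
rewrite -(cats1 p.2); apply: (multilinear_zero _ _ (GP.2 _)).
exact: lA.
Qed.

(** On a word of pure letters a choice of components contributes only if it takes
    the nonzero component of each letter. *)
Lemma choice_sum_word W G x acc (bs : seq (block D)) (fs : seq (letter D)) (x0 : obj D) (B : seq (letter D)) : @bimultilinear W G ->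
  pure (rcons bs (x0, B)) fs -> [seq blt b | b <- bs] = [seq rgt f | f <- fs] ->
  choice_sum G x acc (word (rcons bs (x0, B)) fs) =
  G (rcons [seq fst_block b | b <- bs] (x, acc ++ [seq fst_letter l | l <- B]))
    [seq snd_letter f | f <- fs].
Proof.
elim/last_ind: fs bs G x acc x0 B => [|fs f IH] bs G x acc x0 B GP [].
  move/allP_rcons=> [_ BA] _; case: bs => [_|] //=.
  by rewrite -[B]cats0 choice_sum_A // choice_sum_nil cats0.
move/allP_rcons=> [bsA BA] /allP_rcons[fsF fF].
case/lastP: bs bsA => [_|bs c]; first by case: fs {IH fsF}.
rewrite !map_rcons => /allP_rcons[bsA cA] /rcons_inj[e1 e2].
have sz : size (rcons bs c) = (size fs).+1.
  by rewrite size_rcons -(size_map (@blt _ _)) e1 size_map.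
rewrite -[rcons (rcons bs c) _]cats1 -[rcons fs f]cats1 (word_cat _ _ _ sz).
rewrite /= choice_sum_A // choice_sum_cons.
have z u w : choice_sum G x (rcons u (fst_letter f)) w = 0.
  by rewrite -cats1; apply: (multilinear_zero _ _ (choice_sum_acc _ _ GP)); apply: fF.
rewrite z add0r {z}; case: c {sz} cA e2 => y C /= CA yE.
rewrite IH //; first by rewrite /fst_block /= -yE.
- exact: bimultilinear_rcons.
- by split=> //; apply/allP_rcons.
Qed.

End Choices.

Section Jmap.
Variables (k : fieldType) (d : int) (A : quiver k) (e : int) (M : multi d A e).
Local Notation D := (doubleq d A).
Implicit Types (bs : seq (block A)) (fs : seq (letter (dualq A))).

Lemma dualP (V : lmodType k) (f g : dual V) : (forall x, f x = g x) -> f = g.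
Proof. by move=> H; apply: val_inj; apply: funext. Qed.

Lemma multi_lin1 x post : multilinear (fun w => M ((x, w) :: post)).
Proof. exact: (multi_lin M [::]). Qed.

Lemma bdeg_cat (x : obj A) l r u v i (a b : A u v i) :
  bdeg (x, l ++ Letter a :: r) = bdeg (x, l ++ Letter b :: r).
Proof. by rewrite /bdeg /wdeg /= !big_cat !big_cons. Qed.

Lemma jeps_shape bs bs' fs fs' : map (@bdeg _ _) bs = map (@bdeg _ _) bs' ->
  tdegs d fs = tdegs d fs' -> jeps d e bs fs = jeps d e bs' fs'.
Proof.
move=> e1 e2; rewrite /jeps e1 -!/(tdegs d _) e2.
by have -> : size bs = size bs' by rewrite -(size_map (@bdeg _ _)) e1 size_map.
Qed.

Lemma jfst_bimultilinear x y i : bimultilinear (fun bs fs => jfst M bs fs x y i).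
Proof.
split=> [pre z post fs l r u v j c a b|bs l r u v j c a b].
  rewrite /jfst multi_lin tlift_linear; last exact: contract_last_multilinear.
  rewrite scalerDr scalerA [c * _]mulrC -scalerA.
  by congr (sgn k _ *: _ + sgn k _ *: _); apply: jeps_shape => //;
    rewrite !map_cat /=; congr (_ ++ _ :: _); apply: bdeg_cat.
rewrite /jfst.
have -> : tlift (fun v0 => contract_last d (l ++ Letter (c *: a + b) :: r) v0 x y i) (M bs)
  = c *: tlift (fun v0 => contract_last d (l ++ Letter a :: r) v0 x y i) (M bs) +
   tlift (fun v0 => contract_last d (l ++ Letter b :: r) v0 x y i) (M bs).
  rewrite -tlift_funD; apply: eq_tlift => w; rewrite !contract_lastE.
  rewrite ucontract_last_multilinear_funs /tsum /tdegs !map_cat /= scalerDr.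
  by rewrite !scalerA [_ * c]mulrC.
rewrite scalerDr (scalerA c) [c * _]mulrC -scalerA.
by congr (sgn k _ *: _ + sgn k _ *: _); apply: jeps_shape => //;
   rewrite /tdegs !map_cat.
Qed.

Definition jsign bs fs (i sb : int) : k := sgn k ((d - 1) * i) * sgn k (jdelta d e bs fs sb).

Lemma jsnd_rcons b1 mid bn fs x y i (b : A y x (- (i + (d - 1)))) :
  (jsnd M (b1 :: rcons mid bn) fs x y i : dual _) b =
  jsign (b1 :: rcons mid bn) fs i (sdeg (Letter b)) *
  tlift (contract d fs : _ -> k^o) (M ((b1.1, b1.2 ++ Letter b :: bn.2) :: mid)).
Proof.
rewrite /jsnd /= /jsign; case: mid => [|b2 mid] //=.
by rewrite belast_rcons last_rcons.
Qed.

Lemma jsnd1 b fs x y i : jsnd M [:: b] fs x y i = 0.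
Proof. exact: dualP. Qed.

Lemma jdelta_shape bs bs' fs fs' sb : map (@bdeg _ _) bs = map (@bdeg _ _) bs' ->
  tdegs d fs = tdegs d fs' -> jdelta d e bs fs sb = jdelta d e bs' fs' sb.
Proof.
move=> e1 e2; rewrite /jdelta e1 (jeps_shape e1 e2).
by have -> : size bs = size bs' by rewrite -(size_map (@bdeg _ _)) e1 size_map.
Qed.

Lemma jsign_shape bs bs' fs fs' i sb : map (@bdeg _ _) bs = map (@bdeg _ _) bs' ->
  tdegs d fs = tdegs d fs' -> jsign bs fs i sb = jsign bs' fs' i sb.
Proof. by move=> e1 e2; rewrite /jsign (jdelta_shape _ e1 e2). Qed.

Lemma mulr_scale (a c : k) (x y : k^o) :
  a * (c *: x + y) = c *: (a * x : k^o) + a * y :> k^o.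
Proof.
by rewrite mulrDr; congr (_ + _); rewrite -[LHS]/(a * (c * x) : k) mulrCA.
Qed.

Lemma jsnd_bimultilinear x y i : bimultilinear (fun bs fs => jsnd M bs fs x y i).
Proof.
have cm fs : multilinear (contract d fs : _ -> k^o) by apply: contract_multilinear.
split=> [pre z post fs l r u v j c a b|bs l r u v j c a b].
  have E1 : jsign (pre ++ (z, l ++ Letter (c *: a + b) :: r) :: post) fs i =1
            jsign (pre ++ (z, l ++ Letter a :: r) :: post) fs i.
    move=> s; apply: jsign_shape => //.
    by rewrite !map_cat /= (bdeg_cat _ _ _ _ a).
  have E2 : jsign (pre ++ (z, l ++ Letter (c *: a + b) :: r) :: post) fs i =1
            jsign (pre ++ (z, l ++ Letter b :: r) :: post) fs i.
    move=> s; apply: jsign_shape => //.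
    by rewrite !map_cat /= (bdeg_cat _ _ _ _ b).
  apply: dualP => w; rewrite dual_funD.
  case: pre E1 E2 => [|b1 pre] E1 E2; rewrite ?cat0s ?cat_cons.
    case/lastP: post E1 E2 => [|mid bn] E1 E2; first by rewrite /= scaler0 addr0.
    rewrite !jsnd_rcons /= -E1 -E2 -!catA /= multi_lin1 tlift_linear //.
    exact: mulr_scale.
  case/lastP: post E1 E2 => [|post bn] E1 E2.
    rewrite !cats1 !jsnd_rcons /= -!(cats1 pre) -E1 -E2.
    rewrite -!(cat_rcons (Letter w)) !catA multi_lin1 tlift_linear //.
    exact: mulr_scale.
  rewrite -!rcons_cons -!rcons_cat !jsnd_rcons /= !rcons_cat !rcons_cons -E1 -E2.
  rewrite -!(cat_cons (b1.1, _)) multi_lin tlift_linear //.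
  exact: mulr_scale.
apply: dualP => w; rewrite dual_funD; cbv beta.
case: bs => [|b1 bs]; first by rewrite /= scaler0 addr0.
case/lastP: bs => [|mid bn]; first by rewrite /= scaler0 addr0.
rewrite !jsnd_rcons.
rewrite (@jsign_shape _ (b1 :: rcons mid bn) _ (l ++ Letter a :: r)) //; last by rewrite /tdegs !map_cat.
rewrite [X in _ = _ + X * _](@jsign_shape _ (b1 :: rcons mid bn) _ (l ++ Letter a :: r)) //; last by rewrite /tdegs !map_cat.
rewrite -mulr_scale; congr (_ * _); rewrite -tlift_funD; apply: eq_tlift => s.
rewrite !contractE ucontract_multilinear_funs /tdegs !map_cat /=.
exact: mulr_scale.
Qed.

Definition jpair bs fs x y i : D x y i := (jfst M bs fs x y i, jsnd M bs fs x y i).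

Lemma jpair_bimultilinear x y i : bimultilinear (fun bs fs => jpair bs fs x y i).
Proof.
split=> [pre z post fs|bs] l r u v j c a b; rewrite /jpair.
  by rewrite (jfst_bimultilinear x y i).1 (jsnd_bimultilinear x y i).1.
by rewrite (jfst_bimultilinear x y i).2 (jsnd_bimultilinear x y i).2.
Qed.

Lemma jmapE l w x y i :
  jmap M (l :: w) x y i = choice_sum (fun bs fs => jpair bs fs x y i) (lft l) [::] (l :: w).
Proof. by []. Qed.

Lemma jmap_multilinear x y i : multilinear (fun w => jmap M w x y i).
Proof.
have H z := @choice_sum_multilinear _ d _ _ _ z [::] (jpair_bimultilinear x y i).
move=> [|l u] r x' y' j c a b; rewrite ?cat0s ?cat_cons !jmapE.
  exact: (H x' [::] r x' y' j c a b).
exact: (H (lft l) (l :: u) r x' y' j c a b).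
Qed.

End Jmap.

(** * The signs of the operation *)

Section SignFormulas.
Variables (k : fieldType) (d : int) (A : quiver k).
Implicit Types (bs : seq (block A)) (fs : seq (letter (dualq A))).

Definition bdegs bs : seq int := [seq bdeg b | b <- bs].

Lemma bsdegE bs : bsdeg bs = sumz (bdegs bs).
Proof. by rewrite /bsdeg /sumz big_map. Qed.

Lemma sumz_nth (s : seq int) : \sum_(0 <= i < size s) s`_i = sumz s.
Proof. by rewrite /sumz [RHS](big_nth 0). Qed.

Lemma nth_psum (s : seq int) :
  \sum_(0 <= i < size s) \sum_(i.+1 <= j < size s) s`_i * s`_j = psum s.
Proof.
elim: s => [|x s IH] /=; first by rewrite big_nil.
rewrite big_nat_recl // big_add1 /=; congr (_ + _).
  by rewrite -sumz_nth mulr_sumr.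
by rewrite -IH; apply: eq_bigr => i _; rewrite big_add1.
Qed.

Lemma nth_xsum (t s : seq int) : size s = (size t).+1 ->
  \sum_(0 <= i < size t) t`_i * (\sum_(i.+1 <= j < size s) s`_j) = xsum t s.
Proof.
elim: t s => [|a t IH] [|b s] //=; first by rewrite big_nil.
case=> sz; rewrite big_nat_recl // big_add1 /=; congr (_ + _).
  by rewrite sumz_nth.
by rewrite -IH //; apply: eq_bigr => i _; rewrite big_add1.
Qed.

(** The sums over index ranges of the definition in a recursive form, which can be
    computed on concatenations. *)
Lemma jepsE e bs fs : size bs = (size fs).+1 ->
  jeps d e bs fs = xsum (tdegs d fs) (bdegs bs) + e * tsum d fs + d * (size fs)%:Z
    + psum (bdegs bs) + psum (tdegs d fs).
Proof.
move=> sz; rewrite /jeps sz [_.+1.-1]/= -!/(bdegs bs) -!/(tdegs d fs).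
have st : size (tdegs d fs) = size fs by rewrite size_map.
have sb : size (bdegs bs) = (size fs).+1 by rewrite size_map.
have := (nth_psum (bdegs bs), nth_psum (tdegs d fs), sumz_nth (tdegs d fs)).
rewrite st sb => E; rewrite !E {E}.
have := @nth_xsum (tdegs d fs) (bdegs bs); rewrite st sb => -> //.
Qed.

Lemma jdeltaE e b1 mid bn fs sb : size (rcons mid bn) = size fs ->
  let bs := b1 :: rcons mid bn in
  jdelta d e bs fs sb = jeps d e bs fs + d * (e + bsdeg bs)
    + (bdeg bn + sb) * bsdeg mid + bdeg bn * sb.
Proof.
move=> sz bs; rewrite /jdelta -!/(bdegs bs).
have s2 : size bs = size (bdegs bs) by rewrite size_map.
rewrite {1}s2 sumz_nth -bsdegE.
have -> : (bdegs bs)`_(size bs).-1 = bdeg bn.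
  by rewrite s2 nth_last /bdegs /= map_rcons last_rcons.
have -> // : \sum_(1 <= i < (size bs).-1) (bdegs bs)`_i = bsdeg mid.
rewrite /bs /= size_rcons big_add1 /= bsdegE -sumz_nth size_map.
apply: eq_big_nat => i /andP[_ ilt]; rewrite /bdegs map_rcons nth_rcons.
by rewrite size_map ilt.
Qed.

End SignFormulas.

Section Structure.
Variables (k : fieldType) (d : int) (A : quiver k).
Local Notation e := (preCY_degree d).
Local Notation D := (doubleq d A).
Implicit Types (bs : seq (block A)) (fs : seq (letter (dualq A))).
Implicit Types (v : seq (letter A)) (W : lmodType k).

Record output bs v : Prop := Output {
  output_lt : [seq lft l | l <- v] = [seq blt b | b <- bs];
  output_rt : [seq rgt l | l <- v] = rot 1 [seq brt b | b <- bs];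
  output_deg : vdeg d v = bsdeg bs + e }.

Lemma output_size bs v : output bs v -> size v = size bs.
Proof. by case=> /(congr1 size); rewrite !size_map. Qed.

Variable M : multi d A e.

(** Maps applied to a value of a multilinear operation need only be compared on
    words with the prescribed objects and total degree. *)
Lemma multi_ext W (mu nu : seq (letter A) -> W) bs :
  multilinear mu -> multilinear nu ->
  (is_type bs -> forall v, output bs v -> mu v = nu v) ->
  tlift mu (M bs) = tlift nu (M bs).
Proof.
move=> muP nuP H; have [tP|nt] := boolP (is_type bs); last first.
  by rewrite (multi_dom M nt) !tlift0.
apply: tlift_ext (multi_cod M tP) _ _ _ => // v /and3P[/eqP o1 /eqP o2 /eqP o3].
exact: H.
Qed.

Lemma multilinear_const0 W : multilinear (fun _ : seq (letter A) => 0 : W).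
Proof. by move=> *; rewrite scaler0 addr0. Qed.

Lemma multi_zero W (mu : seq (letter A) -> W) bs : multilinear mu ->
  (is_type bs -> forall v, output bs v -> mu v = 0) -> tlift mu (M bs) = 0.
Proof.
move=> muP H; rewrite (multi_ext (nu := fun=> 0) muP) //; last exact: multilinear_const0.
by rewrite /tlift /fsum_eval big1 // => p _; rewrite scaler0.
Qed.

Lemma multi_sout W (mu nu : seq (letter A) -> W) bs :
  multilinear mu -> multilinear nu ->
  (is_type bs -> forall v g, output bs (rcons v g) ->
     sgn k ((d + 1) * vdeg d v) *: mu (rcons v g) = nu (rcons v g)) ->
  tlift mu (sout d (M bs)) = tlift nu (M bs).
Proof.
move=> muP nuP H; have [tP|nt] := boolP (is_type bs); last first.
  rewrite (multi_dom M nt) /sout !tlift0 //; exact: sout_word_multilinear.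
apply: tlift_sout (multi_cod M tP) _ _ _ _ => //.
  by case: bs {H} tP => //= b bs _; apply/negP=> /and3P[].
move=> h v /and3P[/eqP o1 /eqP o2 /eqP o3]; rewrite lastI.
by apply: H => //; rewrite -lastI.
Qed.

(** The operation with all its outputs contracted, and with all of them but the
    last one: up to sign, the values of the two components of [jmap]. *)
Definition ucontracted bs fs : k^o := tlift (ucontract fs) (M bs).

Definition ucontracted_last bs fs x y i : A x y i := tlift (fun v => ucontract_last fs v x y i) (M bs).

Lemma ucontracted_deg bs fs : ucontracted bs fs != 0 -> bsdeg bs + e = - tsum d fs.
Proof.
move=> H; apply/eqP/negP => N; case/eqP: H; apply: multi_zero.
  exact: (ucontract_multilinear d).
move=> _ v [_ _ o]; apply/eqP/negP => /negP /(ucontract_vdeg d) E.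
by case: N; rewrite -o E.
Qed.

Lemma ucontracted_last_deg bs fs x y i : ucontracted_last bs fs x y i != 0 -> i = bsdeg bs + tsum d fs + 2.
Proof.
move=> H; apply/eqP/negP => N; case/eqP: H; apply: multi_zero.
  exact: (ucontract_last_multilinear d).
move=> _; elim/last_ind => [|v g _] // [_ _]; rewrite vdeg_rcons => o.
rewrite ucontract_last_rcons; have [->|/(ucontract_vdeg d) E] := eqVneq (ucontract fs v) 0.
  by rewrite scale0r.
have [->|/proj_neq0[_ _ eg]] := eqVneq (proj x y i g) 0; first by rewrite scaler0.
by case: N; move: o; rewrite -eg E /odeg /preCY_degree; lia.
Qed.

(** The part of the sign exponent that survives once the Koszul signs of the
    contraction are taken into account: since the degree [d + 2] of [M] has the
    parity of [d], they cancel the terms in the degree of [M], and the pairs of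
    functionals. *)
Definition jfst_sign bs fs : int :=
  xsum (tdegs d fs) (bdegs bs) + d * (size fs)%:Z + psum (bdegs bs).

Lemma jfstE bs fs x y i : size bs = (size fs).+1 ->
  jfst M bs fs x y i = sgn k (jfst_sign bs fs) *: ucontracted_last bs fs x y i.
Proof.
move=> sz; rewrite /jfst /ucontracted_last jepsE //.
rewrite (eq_tlift _ (fun v => contract_lastE d fs v x y i)) tlift_funZ scalerA -sgnD.
congr (_ *: _); apply: eq_sgn; rewrite /jfst_sign /preCY_degree !oddzE.
ring.
Qed.

(** In [jdelta] the terms in [d] disappear for degree reasons: the contraction is
    zero unless the total degree of the inputs is the one that makes it scalar. *)
Lemma jsndE b1 mid bn fs x y i (b : A y x (- (i + (d - 1)))) :
  size (rcons mid bn) = size fs ->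
  let sb := sdeg (Letter b) in
  (jsnd M (b1 :: rcons mid bn) fs x y i : dual _) b =
  sgn k (jfst_sign (b1 :: rcons mid bn) fs + sb + (bdeg bn + sb) * bsdeg mid
          + bdeg bn * sb) *
  ucontracted ((b1.1, b1.2 ++ Letter b :: bn.2) :: mid) fs.
Proof.
move=> sz sb; rewrite jsnd_rcons /jsign jdeltaE // jepsE /=; last by rewrite sz.
have cE : contract d fs =1 (fun v => sgn k (psum (tdegs d fs)) *: ucontract fs v).
  exact: contractE.
rewrite (@eq_tlift _ _ k^o _ _ _ cE) tlift_funZ -/(ucontracted _ _) -!sgnD.
rewrite -[_ *: ucontracted _ _]/(_ * ucontracted _ _) [LHS]mulrA -sgnD.
set c := ucontracted _ _; have [->|/ucontracted_deg cN] := eqVneq c 0; first by rewrite !mulr0.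
congr (_ * _); apply: eq_sgn.
move/(congr1 oddz): cN; rewrite /jfst_sign !bsdegE /= !sumz_cons.
have iE : oddz i = xorb (oddz sb) (oddz d).
  by rewrite -(oddzN sb) -(oddzN d) -oddzD; congr oddz; rewrite /sb /sdeg /=; lia.
have -> : bdeg (b1.1, b1.2 ++ Letter b :: bn.2) = bdeg b1 + (sb + bdeg bn).
  by rewrite /bdeg /wdeg /= big_cat big_cons.
rewrite /bdegs map_rcons psum_rcons !sumz_rcons /tsum -/sb !oddzE iE => /esym E.
rewrite E {E}; case: (oddz d); ring.
Qed.

End Structure.

(** * The three kinds of necklace terms *)

Section MoreMultilinear.
Variables (k : fieldType) (Q : quiver k).
Implicit Types (W V : lmodType k).

Lemma multilinear_single W (f : letter Q -> W) : letter_linear f ->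
  multilinear (fun v => if v is [:: g] then f g else 0).
Proof.
move=> fP [|l u] r x y i c a b /=.
  by case: r => [|? ?]; rewrite ?fP // scaler0 addr0.
by case: u => [|? ?] /=; rewrite scaler0 addr0.
Qed.

Lemma multilinear_tlift W (Q' : quiver k) (F : seq (letter Q) -> seq (letter Q') -> W)
    (t : tens Q') : (forall v, multilinear (F^~ v)) ->
  multilinear (fun K => tlift (F K) t).
Proof.
move=> FP l r x y i c a b; rewrite -tlift_funD; apply: eq_tlift => v.
exact: FP.
Qed.

Lemma match_rcons W (f : seq (letter Q) -> letter Q -> W) K g :
  (if rcons K g is h :: t then f (belast h t) (last h t) else 0) = f K g.
Proof. by case: K => [//|h t]; rewrite /= belast_rcons last_rcons. Qed.

End MoreMultilinear.

Section Terms.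
Variables (k : fieldType) (d : int) (A : quiver k).
Local Notation e := (preCY_degree d).
Variable M : multi d A e.
Implicit Types (bs pre mid post : seq (block A)) (fs f fin : seq (letter (dualq A))).
Implicit Types (v : seq (letter A)) (W : lmodType k) (zj zl : block A).
Implicit Types (i : int).

(** All outputs but the last are contracted with [fin], and the last one is fed
    into a slot of another operation. *)
Definition plug_last W fin (phi : letter A -> W) v : W :=
  if v is h :: t then ucontract fin (belast h t) *: phi (last h t) else 0.

Lemma plug_last_rcons W fin (phi : letter A -> W) K g :
  plug_last fin phi (rcons K g) = ucontract fin K *: phi g.
Proof. by case: K => [//|h t]; rewrite /plug_last /= belast_rcons last_rcons. Qed.

Lemma plug_last_multilinear W fin (phi : letter A -> W) :
  letter_linear phi -> multilinear (plug_last fin phi).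
Proof.
move=> phiP; apply: (multilinear_last (f := fun K g => ucontract fin K *: phi g)) => [K|g].
  by apply: letter_linear_shape.
move=> l r x y i c a b; rewrite (ucontract_multilinear d).
by rewrite scalerDl -scalerA.
Qed.

(** Feeding the value of an operation into a slot of another one is the same as
    contracting the tensor of its outputs except for the output connected to that
    slot: the left-hand side occurs in the Stasheff identity, the right-hand side
    in the necklace product. *)
Lemma plug_jfst W (phi : letter A -> W) b bs fin I : letter_linear phi ->
  size bs = size fin -> I = bsdeg (b :: bs) + tsum d fin + 2 ->
  phi (Letter (jfst M (b :: bs) fin (blt (last b bs)) (brt b) I)) =
  sgn k (jfst_sign d (b :: bs) fin) *: tlift (plug_last fin phi) (M (b :: bs)).
Proof.
move=> phiP sz eI; rewrite jfstE /=; last by rewrite sz.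
set X := blt _; set Y := brt _.
have hP : linear (fun a : A X Y I => phi (Letter a)) by move=> c a a'; apply: phiP.
have hZ c a : phi (Letter (c *: a : A X Y I)) = c *: phi (Letter a).
  by rewrite -[c *: a]addr0 hP letter_linear0 // addr0.
rewrite hZ /ucontracted_last (tlift_comp _ _ hP); congr (_ *: _).
apply: multi_ext.
  apply: (multilinear_linear (mu := fun v => ucontract_last fin v X Y I) hP).
  exact: (ucontract_last_multilinear d).
  exact: plug_last_multilinear.
move=> _; elim/last_ind => [|K g _] [].
  by move=> o; have := congr1 size o.
rewrite !map_rcons vdeg_rcons => o1 o2 o3; rewrite ucontract_last_rcons plug_last_rcons.
have [->|/(ucontract_vdeg d) E] := eqVneq (ucontract fin K) 0.
  by rewrite !scale0r letter_linear0.
rewrite hZ Letter_proj //.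
- by move: o1; rewrite lastI map_rcons => /rcons_inj[].
- by move: o2; rewrite /= rot1_cons => /rcons_inj[].
- by rewrite eI; move: o3; rewrite E /odeg /preCY_degree; lia.
Qed.

Lemma slot_linear W (mu : seq (letter A) -> W) pre x L R post : multilinear mu ->
  letter_linear (fun g => tlift mu (M (pre ++ (x, L ++ g :: R) :: post))).
Proof.
move=> muP; apply: letter_linear_linear; first exact: tlift_lin.
by move=> u v j c a b; apply: multi_lin.
Qed.

(** The sign by which a contracted necklace term differs from a Stasheff term. It
    depends on the whole word but not on the way it is cut, which is why the sum of
    the Stasheff terms is a multiple of the contracted necklace product. *)
Definition necklace_sign fs bs : int := jfst_sign d bs fs + psum (tdegs d fs).

Lemma sout_ucontracted_last bs fs x y i :
  tlift (fun v => contract_last d fs v x y i) (sout d (M bs)) =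
  sgn k (tsum d fs + psum (tdegs d fs)) *: ucontracted_last M bs fs x y i.
Proof.
rewrite /ucontracted_last -tlift_funZ; apply: multi_sout => //.
- exact: contract_last_multilinear.
- by apply: multilinear_shape => //; apply: (ucontract_last_multilinear d).
move=> _ v g' _; rewrite contract_lastE ucontract_last_rcons !scalerA.
have [->|/(ucontract_vdeg d) ->] := eqVneq (ucontract fs v) 0; first by rewrite !mulr0 !scale0r.
by rewrite -sgnD; congr (_ * _ *: _); apply: eq_sgn; rewrite !oddzE; ring.
Qed.

Lemma jfst_sign_cat pre b post f1 f2 : size f1 = size pre ->
  jfst_sign d (pre ++ b :: post) (f1 ++ f2) =
  xsum (tdegs d f1) (bdegs pre) + tsum d f1 * (bdeg b + bsdeg post)
  + xtail (tdegs d f2) (bdegs post) + d * (size f1 + size f2)%:Z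
  + (psum (bdegs pre) + (bdeg b * bsdeg post + psum (bdegs post))
     + bsdeg pre * (bdeg b + bsdeg post)).
Proof.
move=> sz; rewrite /jfst_sign /tdegs /bdegs !map_cat xsum_cat ?size_map //.
rewrite size_cat psum_cat /= sumz_cons -!/(bdegs _) -!bsdegE.
by rewrite xsum_head.
Qed.

Lemma psum_tdegs_cat f1 f2 :
  psum (tdegs d (f1 ++ f2)) = psum (tdegs d f1) + psum (tdegs d f2) + tsum d f1 * tsum d f2.
Proof. by rewrite /tdegs map_cat psum_cat. Qed.

Lemma tsum_cat f1 f2 : tsum d (f1 ++ f2) = tsum d f1 + tsum d f2.
Proof. by rewrite /tsum /tdegs map_cat sumz_cat. Qed.

Lemma wdeg_take_drop m (w : seq (letter A)) : wdeg w = wdeg (take m w) + wdeg (drop m w).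
Proof. by rewrite -{1}(cat_take_drop m w) /wdeg big_cat. Qed.

Lemma bdeg_slot (x : obj A) L (o : letter A) R :
  bdeg (x, L ++ o :: R) = wdeg L + (sdeg o + wdeg R).
Proof. by rewrite /bdeg /wdeg /= big_cat big_cons. Qed.

Lemma bsdeg_cat bs bs' : bsdeg (bs ++ bs') = bsdeg bs + bsdeg bs'.
Proof. by rewrite /bsdeg big_cat. Qed.

Lemma bsdeg_cons b bs : bsdeg (b :: bs) = bdeg b + bsdeg bs.
Proof. by rewrite /bsdeg big_cons. Qed.

Lemma bsdeg_nil : bsdeg (Nil (block A)) = 0.
Proof. by rewrite /bsdeg big_nil. Qed.

(** Diagrams in which the disc of the inner operation has a single output and the
    root lies on the outer one: the corresponding Stasheff term inserts the
    operation on a piece [Yb] of a single block. *)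
Lemma necklace_F1 pre z post m n f1 f2 x y i :
  let L := take m z.2 in
  let Yb := bdrop m (btake n z) in
  let R := drop n z.2 in
  size f1 = size pre -> size f2 = size post -> (m <= n)%N ->
  sgn k (necklace_sign (f1 ++ f2) (pre ++ z :: post)) *:
    tlift (fun v => contract_last d (f1 ++ f2) v x y i) (root_F1 d M M pre z post m n) =
  sgn k (wdeg L + bsdeg post + tsum d f2) *:
    jfst M (pre ++ (z.1, L ++ Letter (jfst M [:: Yb] [::] (blt Yb) (brt Yb) (bdeg Yb + 2)) :: R) :: post) (f1 ++ f2) x y i.
Proof.
move=> L Yb R sz1 sz2 mn; set o := Letter _.
pose nu v := contract_last d (f1 ++ f2) v x y i.
have nuP : multilinear nu by apply: contract_last_multilinear.
pose phi g := ucontracted_last M (pre ++ (z.1, L ++ g :: R) :: post) (f1 ++ f2) x y i.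
have phiP : letter_linear phi by apply/slot_linear/(ucontract_last_multilinear d).
have zE : bdeg z = wdeg L + bdeg Yb + wdeg R.
  rewrite /bdeg (wdeg_take_drop n) (wdeg_take_drop m (take n _)).
  by rewrite /L take_takel.
rewrite jfstE; last by rewrite !size_cat /= sz1 sz2 addnS.
rewrite -/(phi o) /o (plug_jfst (b := Yb) (bs := [::]) (fin := [::]) phiP) //; last by rewrite bsdeg_cons bsdeg_nil /tsum sumz_nil !addr0.
rewrite /root_F1 -/L -/Yb -/R tliftZ // (tlift_comp _ _ (tlift_lin nuP)).
rewrite !scalerA -!sgnD -!tlift_funZ; apply: multi_sout.
- apply: multilinear_shape => //; apply: (multilinear_linear (tlift_lin nuP)).
  apply: multilinear_single; apply: letter_linear_shape => [l l' el|].
    by rewrite /sdeg el.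
  apply: letter_linear_linear; first exact: sout_linear.
  by move=> u v j c a b; apply: multi_lin.
- by apply: multilinear_shape => //; apply: plug_last_multilinear.
move=> _ v g out; have := output_size out; rewrite size_rcons => -[/size0nil v0].
move: out; rewrite {}v0 => -[_ _]; rewrite vdeg_cons vdeg_nil bsdeg_cons bsdeg_nil => gE.
rewrite mulr0 !scalerA tliftZ // sout_ucontracted_last -/(phi g) !scalerA [ucontract _ _]/= mulr1 [last _ _]/=.
rewrite /koszul unlock /= -!sgnD; congr (_ *: _); apply: eq_sgn.
have -> : sdeg g = bdeg Yb + 1 by move: gE; rewrite /odeg /sdeg /preCY_degree; lia.
rewrite /necklace_sign !jfst_sign_cat // tsum_cat psum_tdegs_cat bdeg_slot zE /jfst_sign /=.
have -> : sdeg o = bdeg Yb + 1 by rewrite /sdeg /=; lia.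
rewrite sumz_nil !oddzE; ring.
Qed.

Lemma bdegs_rcons bs b : bdegs (rcons bs b) = rcons (bdegs bs) (bdeg b).
Proof. by rewrite /bdegs map_rcons. Qed.

(** The shape of a word whose piece running from the block [c] to the block [b] is
    cut out. *)
Lemma jfst_sign_cat2 pre b mid c post f1 fin f2 : size f1 = size pre ->
  size fin = (size mid).+1 ->
  jfst_sign d (pre ++ b :: mid ++ c :: post) (f1 ++ fin ++ f2) =
  xsum (tdegs d f1) (bdegs pre)
  + tsum d f1 * (bdeg b + (bsdeg mid + (bdeg c + bsdeg post)))
  + (xtail (tdegs d fin) (bdegs mid) + tsum d fin * (bdeg c + bsdeg post)
     + xtail (tdegs d f2) (bdegs post))
  + d * (size f1 + (size fin + size f2))%:Z
  + (psum (bdegs pre)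
     + (bdeg b * (bsdeg mid + (bdeg c + bsdeg post)) +
        (psum (bdegs mid) + (bdeg c * bsdeg post + psum (bdegs post)) + bsdeg mid * (bdeg c + bsdeg post)))
     + bsdeg pre * (bdeg b + (bsdeg mid + (bdeg c + bsdeg post)))).
Proof.
move=> sz1 szin; rewrite jfst_sign_cat // bsdeg_cat bsdeg_cons size_cat.
congr (_ + _ + _ + _); last first.
  rewrite /bdegs map_cat -!/(bdegs _) psum_cat /= sumz_cons -!bsdegE.
  by rewrite -addrA.
have -> : bdegs (mid ++ c :: post) = bdegs mid ++ bdeg c :: bdegs post.
  by rewrite /bdegs map_cat.
have -> : tdegs d (fin ++ f2) = tdegs d fin ++ tdegs d f2 by rewrite /tdegs map_cat.
rewrite -(xsum_head _ 0) -cat_cons xsum_cat ?size_map //= ?size_map //.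
by rewrite sumz_cons -bsdegE !xsum_head.
Qed.

Lemma bsdeg_rcons bs b : bsdeg (rcons bs b) = bsdeg bs + bdeg b.
Proof. by rewrite -cats1 bsdeg_cat bsdeg_cons bsdeg_nil addr0. Qed.

Lemma jfst_sign_ends b mid c fin : size fin = (size mid).+1 ->
  jfst_sign d (b :: rcons mid c) fin =
  xtail (tdegs d fin) (bdegs mid) + tsum d fin * bdeg c + d * (size fin)%:Z
  + (bdeg b * (bsdeg mid + bdeg c) + (psum (bdegs mid) + bsdeg mid * bdeg c)).
Proof.
move=> szin; have := @jfst_sign_cat2 [::] b mid c [::] [::] fin [::] (erefl _) szin.
rewrite cats0 cats1 cat0s => ->; rewrite !bsdeg_nil /tsum /= !sumz_nil.
by rewrite addn0 !(addr0, add0r, mulr0, mul0r).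
Qed.

(** Diagrams with the root on the outer operation and the last output of the inner
    one connected to it: the piece of the word to which the inner operation is
    applied starts in the block [zl] and ends in the block [zj], and its value in
    the summand [A] becomes an input of the outer one. *)
Lemma necklace_F2 pre zj mid zl post m n f1 fin f2 x y i :
  let Y := btake m zj in let R := drop m zj.2 in
  let L := take n zl.2 in let Y' := bdrop n zl in
  let I := bsdeg (Y :: rcons mid Y') + tsum d fin + 2 in
  size f1 = size pre -> size fin = (size mid).+1 -> size f2 = size post ->
  sgn k (necklace_sign (f1 ++ fin ++ f2) (pre ++ zj :: mid ++ zl :: post)) *:
    tlift (fun v => contract_last d (f1 ++ fin ++ f2) v x y i)
      (root_F2 d M M pre zj mid zl post m n) =
  sgn k (wdeg L + bsdeg post + tsum d f2) *:
    jfst M (pre ++ (zl.1, L ++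
       Letter (jfst M (Y :: rcons mid Y') fin (blt Y') (brt Y) I) :: R) :: post)
     (f1 ++ f2) x y i.
Proof.
move=> Y R L Y' I sz1 szin sz2; set o := Letter _.
pose nu v := contract_last d (f1 ++ fin ++ f2) v x y i.
have nuP : multilinear nu by apply: contract_last_multilinear.
pose phi g := ucontracted_last M (pre ++ (zl.1, L ++ g :: R) :: post) (f1 ++ f2) x y i.
have phiP : letter_linear phi by apply/slot_linear/(ucontract_last_multilinear d).
have zjE : bdeg zj = bdeg Y + wdeg R by rewrite /bdeg (wdeg_take_drop m).
have zlE : bdeg zl = wdeg L + bdeg Y' by rewrite /bdeg (wdeg_take_drop n).
have szin' : size (rcons mid Y') = size fin by rewrite size_rcons szin.
rewrite jfstE; last by rewrite !size_cat /= sz1 sz2 addnS.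
rewrite -/(phi o) /o; have := plug_jfst (b := Y) phiP szin' (erefl I).
rewrite last_rcons => ->.
pose f := fun K g => koszul k [:: vdeg d K; sdeg g; bsdeg pre; wdeg R; wdeg L; bsdeg post]
               [:: 2; 4; 1; 3; 5; 0]%N *:
      tlift (fun u =>
        koszul k [:: vdeg d (take (size pre) u); svdeg d (drop (size pre) u); vdeg d K] [:: 0; 2; 1]%N *:
        tpure (take (size pre) u ++ K ++ drop (size pre) u))
      (sout d (M (pre ++ (zl.1, L ++ g :: R) :: post))).
rewrite /root_F2 -/L -/Y -/Y' -/R tliftZ // (tlift_comp _ _ (tlift_lin nuP)).
rewrite !scalerA -!sgnD -!tlift_funZ; apply: multi_sout.
- apply: multilinear_shape => //; apply: (multilinear_linear (tlift_lin nuP)).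
  apply: (multilinear_last (f := f)) => [K|g]; rewrite /f.
    apply: letter_linear_shape => [l l' el|]; first by rewrite /sdeg el.
    apply: letter_linear_linear; first apply: tlift_lin.
      apply: multilinear_shape => [v v' ev|].
        rewrite /svdeg (@vdeg_shape _ d _ (take _ v) (take (size pre) v')); last by rewrite !map_take ev.
        by rewrite (@vdeg_shape _ d _ (drop _ v) (drop (size pre) v')) // !map_drop ev.
      by apply: multilinear_split; apply: tpure_multilinear.
    apply: letter_linear_linear; first exact: sout_linear.
    by move=> u v j c a b; apply: multi_lin.
  apply: multilinear_shape => [v v' ev|]; first by rewrite (vdeg_shape d ev).
  apply: multilinear_tlift => v; apply: multilinear_shape => [w w' ew|].
    by rewrite (vdeg_shape d ew).
  by apply: multilinear_mid; apply: tpure_multilinear.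
- by apply: multilinear_shape => //; apply: plug_last_multilinear.
move=> _ K g out; have := output_size out; rewrite size_rcons /= => -[szK].
case: out => _ _; rewrite vdeg_rcons => gE; rewrite plug_last_rcons.
rewrite [X in tlift nu X](_ : _ = f K g); last exact: match_rcons.
(* The exponent collected when the outputs of the outer operation are contracted
   and the outputs [K] of the inner one are inserted among them. *)
pose s := (d + 1) * (tsum d f1 + tsum d f2)
  + (bsdeg pre + (wdeg L + (sdeg g + wdeg R) + bsdeg post) + 1 + tsum d f1) * tsum d fin
  + psum (tdegs d (f1 ++ fin ++ f2)) + d * tsum d (f1 ++ fin ++ f2).
have -> : tlift nu (f K g) = koszul k [:: vdeg d K; sdeg g; bsdeg pre; wdeg R; wdeg L; bsdeg post]
               [:: 2; 4; 1; 3; 5; 0]%N *: (sgn k s *: (ucontract fin K *: phi g)).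
  rewrite /f tliftZ // (tlift_comp _ _ (tlift_lin nuP)); congr (_ *: _).
  rewrite /phi /ucontracted_last scalerA -tlift_funZ; apply: multi_sout.
  - apply: (multilinear_linear (tlift_lin nuP)); apply: multilinear_shape => [v v' ev|].
      rewrite /svdeg (@vdeg_shape _ d _ (take _ v) (take (size pre) v')); last by rewrite !map_take ev.
      by rewrite (@vdeg_shape _ d _ (drop _ v) (drop (size pre) v')) // !map_drop ev.
    by apply: multilinear_split; apply: tpure_multilinear.
  - by apply: multilinear_shape => //; apply: (ucontract_last_multilinear d).
  move=> _ v g' outv; have := output_size outv; rewrite size_rcons size_cat /= addnS => -[szv].
  have pv : (size pre <= size v)%N by rewrite szv leq_addr.
  case: outv => _ _; rewrite bsdeg_cat bsdeg_cons bdeg_slot.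
  rewrite -(cat_take_drop (size pre) v); set v1 := take _ v; set v2 := drop _ v.
  have szv1 : size v1 = size pre by rewrite size_takel.
  rewrite rcons_cat take_size_cat // drop_size_cat // vdeg_cat => vE.
  rewrite tliftZ // tlift_pure // /nu contract_lastE -!rcons_cat !ucontract_last_rcons.
  rewrite !ucontract_cat ?szv1 ?szK ?size_rcons ?szin //.
  have [->|/(ucontract_vdeg d) v1E] := eqVneq (ucontract f1 v1) 0; first by rewrite !(mul0r, scale0r, scaler0, mulr0).
  have [->|/(ucontract_vdeg d) v2E] := eqVneq (ucontract f2 v2) 0; first by rewrite !(mul0r, scale0r, scaler0, mulr0).
  have [->|/(ucontract_vdeg d) KE] := eqVneq (ucontract fin K) 0; first by rewrite !(mul0r, scale0r, scaler0, mulr0).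
  rewrite /koszul unlock /= !scalerA [ucontract f1 v1 * (_ * _)]mulrCA !mulrA -!sgnD.
  congr (_ * _ * _ * _ *: _); apply: eq_sgn.
  have og : odeg d g' = tsum d f1 + tsum d f2 + (bsdeg pre + (wdeg L + (sdeg g + wdeg R) + bsdeg post)) + e.
    by move: vE; rewrite vdeg_rcons v1E v2E; lia.
  rewrite /s vdeg_cat /svdeg vdeg_rcons v1E v2E KE og /preCY_degree !oddzE.
  case: (oddz d); ring.
have [->|/(ucontract_vdeg d) KE] := eqVneq (ucontract fin K) 0; first by rewrite scale0r !scaler0.
rewrite /koszul unlock /= !scalerA !mulrA -!sgnD.
congr (_ * _ *: _); apply: eq_sgn; rewrite /s KE.
have -> : sdeg g = bsdeg (Y :: rcons mid Y') + 1 + tsum d fin.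
  by move: gE; rewrite KE /odeg /sdeg /preCY_degree; lia.
rewrite /necklace_sign jfst_sign_cat2 // jfst_sign_cat // !psum_tdegs_cat !tsum_cat bdeg_slot zjE zlE.
have -> : sdeg o = bsdeg (Y :: rcons mid Y') + 1 + tsum d fin by rewrite /sdeg /= /I; lia.
rewrite jfst_sign_ends // !bsdeg_cons !bsdeg_rcons !PoszD !oddzE.
by case: (oddz d); case: (oddz (tsum d fin)); ring.
Qed.

(** Here an inner output is connected, so the remaining ones are contracted on both
    sides of it. *)
Definition plug_inner f1 f2 p (phi : letter A -> k^o) v x y i : A x y i :=
  if drop p v is g :: r then (ucontract f1 (take p v) * phi g : k) *: ucontract_last f2 r x y i else 0.

Lemma plug_inner_multilinear f1 f2 p phi x y i : letter_linear phi ->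
  multilinear (fun v => plug_inner f1 f2 p phi v x y i).
Proof.
move=> phiP.
apply: (@multilinear_at _ _ _ p (fun l g r => (ucontract f1 l * phi g : k) *: ucontract_last f2 r x y i)).
- by move=> l r u v j c a b; rewrite phiP mulr_scale scalerDl -scalerA.
- move=> g r l l' u v j c a b; rewrite (ucontract_multilinear d) mulrDl scalerDl.
  by congr (_ + _); rewrite scalerA -mulrA.
- by move=> l g; apply: multilinear_shape => //; apply: (ucontract_last_multilinear d).
Qed.

Lemma output_at pre b c post v g r : output d (pre ++ b :: c :: post) (v ++ g :: r) ->
  size v = size pre -> lft g = blt b /\ rgt g = brt c.
Proof.
case=> o1 o2 _ sv; split.
  have := congr1 (fun w => nth (blt b) w (size pre)) o1.
  by rewrite !map_cat !nth_cat !size_map sv ltnn subnn.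
have := congr1 (fun w => nth (brt c) w (size pre)) o2.
rewrite !map_cat nth_cat !size_map sv ltnn subnn /= => ->.
rewrite /rot nth_cat size_drop size_cat /= !size_map; case: ltnP => [_|]; last by lia.
by rewrite nth_drop nth_cat size_map add1n ltnNge leqnSn subSnn.
Qed.

(** Diagrams with the root on the disc [G]: in the Stasheff term the piece of the
    word from [zl] to [zj] is now the input of the disc [F], all of whose outputs are
    contracted. The result is a functional, the dual component of the inner
    operation, and it is paired with the output of [G] between [Y] and [Y']: the
    inner operation of the Stasheff term is the outer disc of the diagram. *)
Lemma necklace_G pre zj mid zl post m n f1 fin f2 x y i :
  let E := take m zj.2 in let Y := bdrop m zj in
  let Y' := btake n zl in let R := drop n zl.2 in
  let bi := btake m zj :: rcons mid (bdrop n zl) in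
  let I := bsdeg bi + tsum d fin + 2 in
  size f1 = size pre -> size fin = (size mid).+1 -> size f2 = size post ->
  sgn k (necklace_sign (f1 ++ fin ++ f2) (pre ++ zj :: mid ++ zl :: post)) *:
    tlift (fun v => contract_last d (f1 ++ fin ++ f2) v x y i)
      (root_G d e M M pre zj mid zl post m n) =
  sgn k (bdeg Y' + bsdeg post + tsum d f2) *:
    jfst M (pre ++ Y :: Y' :: post)
      (f1 ++ @Letter k (dualq A) (brt Y') (blt Y) (I + (d - 1))
               (jsnd M bi fin (brt Y') (blt Y) I) :: f2) x y i.
Proof.
move=> E Y Y' R bi I sz1 szin sz2; set u := Letter _.
pose nu v := contract_last d (f1 ++ fin ++ f2) v x y i.
have nuP : multilinear nu by apply: contract_last_multilinear.
pose phi g : k^o := ucontracted M ((zj.1, E ++ g :: R) :: mid) fin.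
have phiP : letter_linear phi.
  by apply/(slot_linear [::] _ _ _ mid (ucontract_multilinear d fin)).
have zjE : bdeg zj = wdeg E + bdeg Y by rewrite /bdeg (wdeg_take_drop m).
have zlE : bdeg zl = bdeg Y' + wdeg R by rewrite /bdeg (wdeg_take_drop n).
have biE : bsdeg bi = wdeg E + (bsdeg mid + wdeg R) by rewrite bsdeg_cons bsdeg_rcons.
have szin' : size (rcons mid (bdrop n zl)) = size fin by rewrite size_rcons szin.
have phi0 g : phi g != 0 -> ldeg g = - (I + (d - 1)).
  move/ucontracted_deg; rewrite bsdeg_cons bdeg_slot /I biE /sdeg /preCY_degree; lia.
have outS v : output d (pre ++ Y :: Y' :: post) v ->
    exists K1 g v2 g', [/\ v = K1 ++ g :: rcons v2 g', size K1 = size pre & size v2 = size post].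
  move/output_size; rewrite size_cat /= => sv.
  have: size (drop (size pre) v) = (size post).+2 by rewrite size_drop sv addKn.
  have: size (take (size pre) v) = size pre by rewrite size_takel // sv leq_addr.
  rewrite -{3}(cat_take_drop (size pre) v).
  case: (drop _ v) => [|g K2] // szK1; case/lastP: K2 => [|v2 g'] //=.
  rewrite size_rcons => -[sv2]; by exists (take (size pre) v), g, v2, g'.
rewrite jfstE; last by rewrite !size_cat /= sz1 sz2 !addnS.
have -> : ucontracted_last M (pre ++ Y :: Y' :: post) (f1 ++ u :: f2) x y i =
    sgn k (jfst_sign d bi fin - (I + d) + (wdeg R - (I + d)) * bsdeg mid + wdeg R * (I + d)) *:
    tlift (fun v => plug_inner f1 f2 (size pre) phi v x y i) (M (pre ++ Y :: Y' :: post)).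
  rewrite -tlift_funZ; apply: multi_ext.
  - exact: (ucontract_last_multilinear d).
  - by apply: multilinear_shape => //; apply: plug_inner_multilinear.
  move=> _ v out; have [K1 [g [v2 [g' [vE szK1 szv2]]]]] := outS v out.
  rewrite vE in out; have [lg rg] := output_at out szK1.
  rewrite vE /plug_inner drop_size_cat // take_size_cat // -rcons_cons -rcons_cat !ucontract_last_rcons.
  rewrite ucontract_cat ?szK1 // [ucontract (u :: f2) _]/= !scalerA.
  have -> : pairing u g =
    sgn k (jfst_sign d bi fin - (I + d) + (wdeg R - (I + d)) * bsdeg mid + wdeg R * (I + d)) * phi g.
    have [eg|ng] := eqVneq (ldeg g) (- (I + (d - 1))); last first.
      have [->|/phi0 eg] := eqVneq (phi g) 0; last by rewrite eg eqxx in ng.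
      rewrite mulr0; apply/eqP; apply/negPn/negP => /pairing_neq0[_ _ eg].
      by rewrite eg eqxx in ng.
    rewrite -[LHS]/((jsnd M bi fin (brt Y') (blt Y) I : dual _) (proj (blt Y) (brt Y') (- (I + (d - 1))) g)).
    rewrite jsndE // -/E -/R -[ucontracted _ _ _]/(phi _) Letter_proj //.
    congr (_ * _); apply: eq_sgn; rewrite -[bdeg (bdrop _ _)]/(wdeg R) /sdeg [ldeg _]/=.
    by move: (jfst_sign d bi fin) => J; rewrite eg !oddzE; case: (oddz d); ring.
  by congr (_ *: _); rewrite mulrA; congr (_ * _); rewrite mulrCA.
rewrite /root_G -/E -/Y -/Y' -/R tliftZ // (tlift_comp _ _ (tlift_lin nuP)).
pose f K1 g K2 := koszul k [:: vdeg d K1; odeg d g; svdeg d K2; wdeg E; bsdeg mid; wdeg R]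
               [:: 3; 1; 5; 4; 0; 2]%N *:
      (sgn k ((d + 1) * (e + d + 1) + (d + 1) * wdeg E) *:
      tlift (fun w =>
        koszul k [:: vdeg d w; vdeg d K1; svdeg d K2] [:: 1; 0; 2]%N *:
        tpure (K1 ++ w ++ K2))
      (M ((zj.1, E ++ g :: R) :: mid))).
have kP (K1 K2 : seq (letter A)) : multilinear (fun w => koszul k [:: vdeg d w; vdeg d K1; svdeg d K2] [:: 1; 0; 2]%N *:
        tpure (K1 ++ w ++ K2)).
  apply: multilinear_shape => [w w' ew|]; first by rewrite (vdeg_shape d ew).
  by apply: multilinear_mid; apply: tpure_multilinear.
rewrite !scalerA -!sgnD -!tlift_funZ; apply: multi_sout.
- apply: multilinear_shape => //; apply: (multilinear_linear (tlift_lin nuP)).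
  apply: (@multilinear_at _ _ _ (size pre) f); rewrite /f.
  + move=> l r; apply: letter_linear_shape => [g g' eg|]; first by rewrite /odeg eg.
    apply: letter_linear_shape => //.
    by apply/(slot_linear [::] _ _ _ mid (kP l r)).
  + move=> g r; apply: multilinear_shape => [w w' ew|]; first by rewrite (vdeg_shape d ew).
    apply: multilinear_shape => //; apply: multilinear_tlift => v.
    apply: multilinear_shape => [w w' ew|]; first by rewrite (vdeg_shape d ew).
    exact: (multilinear_mid [::] _ (@tpure_multilinear _ _)).
  + move=> l g; apply: multilinear_shape => [w w' ew|]; first by rewrite /svdeg (vdeg_shape d ew).
    apply: multilinear_shape => //; apply: multilinear_tlift => v.
    apply: multilinear_shape => [w w' ew|]; first by rewrite /svdeg (vdeg_shape d ew).
    move=> l' r' a b c q p p'; rewrite !catA; exact: tpure_multilinear.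
- by apply: multilinear_shape => //; apply: plug_inner_multilinear.
move=> _ v g' out; have [K1 [g [v2 [g'' []]]]] := outS _ out.
rewrite -rcons_cons -rcons_cat => /rcons_inj[vE _] {g''} szK1 szv2.
rewrite vE /plug_inner rcons_cat rcons_cons drop_size_cat // take_size_cat //.
pose P := (ucontract f1 K1 : k) *: ((ucontract f2 v2 : k) *: proj x y i g').
have phiE : (ucontract f1 K1 * phi g : k) *: ucontract_last f2 (rcons v2 g') x y i =
    tlift (fun w => (ucontract fin w : k) *: P) (M ((zj.1, E ++ g :: R) :: mid)).
  rewrite ucontract_last_rcons mulrC -scalerA -/P /phi /ucontracted.
  by apply: (tlift_comp (h := fun c : k^o => (c : k) *: P)) => c a b; rewrite scalerDl -scalerA.
rewrite vdeg_cat vdeg_cons in out *.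
pose s := tsum d f1 * tsum d fin + psum (tdegs d (f1 ++ fin ++ f2)) + d * tsum d (f1 ++ fin ++ f2).
rewrite [X in tlift nu X](_ : _ = f K1 g (rcons v2 g')) //.
have -> : tlift nu (f K1 g (rcons v2 g')) =
  koszul k [:: vdeg d K1; odeg d g; svdeg d (rcons v2 g'); wdeg E; bsdeg mid; wdeg R]
               [:: 3; 1; 5; 4; 0; 2]%N *:
      (sgn k ((d + 1) * (e + d + 1) + (d + 1) * wdeg E) *: (sgn k s *:
       ((ucontract f1 K1 * phi g : k) *: ucontract_last f2 (rcons v2 g') x y i))).
  rewrite /f !tliftZ // (tlift_comp _ _ (tlift_lin nuP)) phiE.
  congr (_ *: (_ *: _)); rewrite -tlift_funZ; apply: multi_ext.
  - exact: multilinear_linear (tlift_lin nuP) (kP _ _).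
  - apply: multilinear_shape => // l l' a b j c a' b'.
    by rewrite (ucontract_multilinear d) scalerDl -scalerA.
  move=> _ w outw; have szw : size w = size fin by rewrite szin (output_size outw).
  rewrite tliftZ // tlift_pure // /nu contract_lastE -!rcons_cat ucontract_last_rcons.
  rewrite !ucontract_cat ?szK1 ?szw // /P.
  have [->|/(ucontract_vdeg d) K1E] := eqVneq (ucontract f1 K1) 0; first by rewrite !(mul0r, scale0r, scaler0, mulr0).
  have [->|/(ucontract_vdeg d) wE] := eqVneq (ucontract fin w) 0; first by rewrite !(mul0r, scale0r, scaler0, mulr0).
  rewrite /koszul unlock /= !scalerA !mulrA -!sgnD.
  congr (_ * _ *: _); rewrite mulrAC; congr (_ * _ * _); apply: eq_sgn.
  by rewrite /s K1E wE !oddzE; ring.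
have [p0|/phi0 gE] := eqVneq (phi g) 0; first by rewrite p0 !(mulr0, scale0r, scaler0).
have [c0|/(ucontract_vdeg d) K1E] := eqVneq (ucontract f1 K1) 0.
  by rewrite c0 !(mul0r, scale0r, scaler0).
rewrite ucontract_last_rcons.
have [c0|/(ucontract_vdeg d) v2E] := eqVneq (ucontract f2 v2) 0.
  by rewrite c0 !(mul0r, scale0r, scaler0).
rewrite /koszul unlock /= !scalerA !mulrA -!sgnD.
congr (_ * _ * _ * _ *: _); apply: eq_sgn.
have oE : odeg d g = 1 - I by rewrite /odeg gE; lia.
have vrE : vdeg d (rcons v2 g') =
    bsdeg pre + (bdeg Y + (bdeg Y' + bsdeg post)) + e + tsum d f1 - (1 - I).
  case: out => _ _; rewrite vE rcons_cat rcons_cons vdeg_cat vdeg_cons oE K1E.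
  by rewrite bsdeg_cat !bsdeg_cons; lia.
rewrite /svdeg vrE oE /s K1E v2E /necklace_sign jfst_sign_cat2 // jfst_sign_cat //.
rewrite !psum_tdegs_cat !tsum_cat zjE zlE jfst_sign_ends //.
rewrite [tdegs d (u :: f2)]/= /bdegs [map _ (_ :: _)]/= -!/(bdegs _) xtail_cons.
have -> : psum (bdeg Y' :: bdegs post) = bdeg Y' * bsdeg post + psum (bdegs post) by rewrite bsdegE.
rewrite -bsdegE !bsdeg_cons.
have -> : tdeg d u = I - 1 by rewrite /tdeg /u /=; lia.
rewrite -[bdeg (btake m zj)]/(wdeg E) -[bdeg (bdrop n zl)]/(wdeg R).
have IE : oddz I = xorb (xorb (oddz (wdeg E)) (xorb (oddz (bsdeg mid)) (oddz (wdeg R)))) (oddz (tsum d fin)).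
  by rewrite /I biE !oddzE; ring.
move: (I) IE => J IE; rewrite [size (u :: f2)]/= !PoszD !oddzE IE.
ring.
Qed.

End Terms.

(** * Cutting words *)

Section Splittings.
Variables (T : Type) (V : zmodType).
Implicit Types (s u : seq T) (H : seq T -> seq T -> V).

(** A sum over the cuts of [s] in two pieces, defined recursively and without
    indices so that letters can be moved from one end of a word to the other. *)
Fixpoint split_sum H s : V :=
  if s is x :: s' then H [::] s + split_sum (fun a b => H (x :: a) b) s' else H [::] [::].

Lemma split_sum_ext H H' s : (forall a b, a ++ b = s -> H a b = H' a b) -> split_sum H s = split_sum H' s.
Proof.
elim: s H H' => [|x s IH] H H' e /=; first by rewrite e.
rewrite e // (IH _ (fun a b => H' (x :: a) b)) // => a b ab.
by apply: e; rewrite -ab.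
Qed.

Lemma split_sum_rcons H s x :
  split_sum H (rcons s x) = split_sum (fun a b => H a (rcons b x)) s + H (rcons s x) [::].
Proof.
elim: s H => [|y s IH] H //=; rewrite IH addrA.
by congr (_ + _ + _).
Qed.

Lemma split_sum_cat_cons H s x u :
  split_sum H (s ++ x :: u) =
  split_sum (fun a b => H a (b ++ x :: u)) s + split_sum (fun a b => H (s ++ x :: a) b) u.
Proof. by elim: s H => [|y s IH] H //=; rewrite IH addrA. Qed.

Lemma split_sumE H s :
  split_sum H s = \sum_(0 <= i < (size s).+1) H (take i s) (drop i s).
Proof.
elim: s H => [|x s IH] H /=; first by rewrite big_nat1.
by rewrite big_nat_recl // IH.
Qed.

Lemma split_sumD H H' s : split_sum H s + split_sum H' s = split_sum (fun a b => H a b + H' a b) s.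
Proof.
elim: s H H' => [|x s IH] H H' //=; rewrite -IH.
by rewrite addrACA.
Qed.

End Splittings.

Lemma split_sum_raddf (T : Type) (V W : zmodType) (h : V -> W) (H : seq T -> seq T -> V) s :
  {morph h : a b / a + b} -> h (split_sum H s) = split_sum (fun a b => h (H a b)) s.
Proof. by move=> hD; elim: s H => [|x s IH] H //=; rewrite hD IH. Qed.

Lemma sum_triangle (V : zmodType) n (f : nat -> nat -> V) :
  \sum_(0 <= i < n) \sum_(i.+1 <= j < n.+1) f i j =
  \sum_(0 <= j < n.+1) \sum_(0 <= i < j) f i j.
Proof.
elim: n => [|n IH]; first by rewrite big_nil big_nat1 big_nil.
have E : \sum_(0 <= i < n) \sum_(i.+1 <= j < n.+2) f i j =
         \sum_(0 <= i < n) (\sum_(i.+1 <= j < n.+1) f i j + f i n.+1).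
  by rewrite !big_nat; apply: eq_bigr => i /andP[_ ilt]; rewrite big_nat_recr //= ltnW.
rewrite big_nat_recr //= E big_split /= IH [X in _ + X = _]big_nat1.
by rewrite [RHS]big_nat_recr //= [X in _ = _ + X]big_nat_recr //= addrA.
Qed.

Section Insertions.
Variables (k : fieldType) (Q R : quiver k) (sm : operation Q Q) (op : operation Q R).
Implicit Types w : seq (letter Q).

Definition insertion_term x y n w1 w2 w3 : R x y n :=
  if w2 is h :: t then
    sgn k (wdeg w1) *: op (w1 ++ out idfun 1 sm h t :: w3) x y n
  else 0.

Lemma insertionsE w x y n :
  insertions sm op w x y n =
  split_sum (fun u w3 => split_sum (fun w1 w2 => insertion_term x y n w1 w2 w3) u) w.
Proof.
rewrite split_sumE /insertions sum_triangle big_nat [RHS]big_nat.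
apply: eq_bigr => j /andP[_]; rewrite ltnS => jw.
have sj : size (take j w) = j by rewrite size_takel.
rewrite split_sumE sj big_nat_recr //= [X in _ = _ + X](_ : _ = 0) ?addr0; last first.
  by rewrite /insertion_term drop_oversize ?sj.
by rewrite big_nat [RHS]big_nat; apply: eq_bigr => i /andP[_ ij]; rewrite /insertion_term take_takel // ltnW.
Qed.

End Insertions.

Section WordSplittings.
Variables (k : fieldType) (Q : quiver k) (V : zmodType).
Implicit Types (bs pre post : seq (block Q)) (fs : seq (letter Q)).
Implicit Types (H : seq (letter Q) -> seq (letter Q) -> V).

(** A cut of a word of pure letters falls in some position of some block. *)
Lemma split_sum_word H bs fs : size bs = (size fs).+1 ->
  split_sum H (word bs fs) =
  \sum_(0 <= j < size bs)
    if drop j bs is b :: r then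
      \sum_(0 <= m < (size b.2).+1)
        H (word (btake m b :: r) (drop j fs))
          (word (rcons (take j bs) (bdrop m b)) (take j fs))
    else 0.
Proof.
elim: bs fs H => [//|b bs IH] [|f fs] H [].
  by move/size0nil=> ->; rewrite big_nat1 /= split_sumE.
move=> sz; rewrite [word _ _]/= split_sum_cat_cons addrC big_nat_recl //=; congr (_ + _).
  by rewrite split_sumE.
by rewrite (IH fs).
Qed.

End WordSplittings.

Section WellFormed.
Variables (k : fieldType) (Q : quiver k).
Implicit Types (bs pre post mid : seq (block Q)) (fs f : seq (letter Q)) (b : block Q).

Lemma wf_glue X Y pre b post f1 f2 : size f1 = size pre ->
  wf (blt b) Y (rcons pre b) f1 -> wf X (brt b) (b :: post) f2 ->
  wf X Y (pre ++ b :: post) (f1 ++ f2).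
Proof.
move=> sz [c1 l1 r1] [c2 l2 r2]; split.
- by move: c1; rewrite all_rcons all_cat => /andP[_ ->].
- move: l1; rewrite !map_cat map_rcons rcons_cat => /rcons_inj[->].
  by congr (_ ++ _).
- move: r1 r2; rewrite !map_cat map_rcons -cats1 /= => E [->].
  by rewrite -cat_rcons -cats1 E.
Qed.

Lemma wf_cut X Y pre b post f1 f2 : size f1 = size pre ->
  wf X Y (pre ++ b :: post) (f1 ++ f2) ->
  wf (blt b) Y (rcons pre b) f1 /\ wf X (brt b) (b :: post) f2.
Proof.
move=> sz [c l r].
move: c; rewrite all_cat /= => /and3P[c1 c2 c3].
move: l; rewrite !map_cat rcons_cat => /eqP; rewrite eqseq_cat ?size_map //.
case/andP=> /eqP l1 /eqP l2.
have : rcons (map (@brt _ _) pre) (brt b) ++ map (@brt _ _) post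
     == (Y :: map (@lft _ _) f1) ++ map (@lft _ _) f2.
  by rewrite cat_rcons cat_cons -map_cat -r map_cat.
rewrite eqseq_cat ?size_rcons /= ?size_map ?sz // => /andP[/eqP r1 /eqP r2].
split; split; rewrite /= ?all_rcons ?c1 ?c2 ?c3 ?map_rcons ?l1 ?r1 ?r2 //.
Qed.

Lemma wf_last X Y pre b b' fs : wf X Y (rcons pre b) fs ->
  chain b'.1 b'.2 -> brt b' = brt b -> wf (blt b') Y (rcons pre b') fs.
Proof.
case=> c l r cb rb; split.
- by move: c; rewrite !all_rcons cb => /andP[].
- by move: l; rewrite !map_rcons => /rcons_inj[-> _].
- by move: r; rewrite !map_rcons rb.
Qed.

Lemma wf_head X Y b b' post fs : wf X Y (b :: post) fs ->
  chain b'.1 b'.2 -> blt b' = blt b -> wf X (brt b') (b' :: post) fs.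
Proof.
case=> c l r cb lb; split.
- by move: c; rewrite /= cb => /andP[].
- by move: l; rewrite /= lb.
- by move: r => /= [_ ->].
Qed.

Lemma wf_cons X Y b bs u fs : wf X Y bs fs -> chain b.1 b.2 ->
  lft u = Y -> rgt u = blt b -> wf X (brt b) (b :: bs) (u :: fs).
Proof.
by case=> c l r cb lu ru; split=> /=; rewrite ?cb ?c ?l ?r ?ru ?lu.
Qed.

Lemma wf_eq X Y b bs fs : wf X Y (b :: bs) fs -> Y = brt b.
Proof. by case=> _ _ []. Qed.

Lemma wf_word X Y bs fs : wf X Y bs fs ->
  chain X (word bs fs) /\ last X [seq rgt l | l <- word bs fs] = Y.
Proof.
elim: bs fs Y => [|b bs IH] [|f fs] Y wfP; have := wf_size wfP => // -[].
  move/size0nil=> bs0; move: wfP; rewrite {}bs0 => -[/= /andP[cb _]] [] <- [<-].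
  by rewrite cb.
move=> sz; case: wfP => /= /andP[cb cbs] [lb lbs] [rb rbs].
have /IH[cw lw] : wf X (lft f) bs fs by [].
rewrite chain_cat cw lw map_cat last_cat lw /= eqxx -lb cb; split=> //.
Qed.

Lemma chain_take m (b : block Q) : chain b.1 b.2 -> chain b.1 (take m b.2).
Proof. by rewrite -{1}(cat_take_drop m b.2) chain_cat => /andP[]. Qed.

Lemma chain_bdrop m (b : block Q) : chain b.1 b.2 ->
  chain (bdrop m b).1 (bdrop m b).2.
Proof. by rewrite -{1}(cat_take_drop m b.2) chain_cat => /andP[]. Qed.

Lemma brt_bdrop m (b : block Q) : brt (bdrop m b) = brt b.
Proof.
by rewrite /brt /= -last_cat -map_cat cat_take_drop.
Qed.

Lemma word_rcons_cons pre y o B f1 : size f1 = size pre ->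
  word (rcons pre (y, o :: B)) f1 = o :: word (rcons pre (y, B)) f1.
Proof.
elim: pre f1 => [|b pre IH] [|f f1] //= [/IH ->] //.
Qed.

Lemma word_slot pre x x' y L o R post f1 f2 : size f1 = size pre ->
  word ((x', L) :: post) f2 ++ o :: word (rcons pre (y, R)) f1 =
  word (pre ++ (x, L ++ o :: R) :: post) (f1 ++ f2).
Proof.
by move=> sz; rewrite -word_rcons_cons // (word_glue post f2 x x' y L (o :: R) (esym sz)).
Qed.

End WellFormed.

Section FirstComponent.
Variables (k : fieldType) (d : int) (A : quiver k).
Local Notation e := (preCY_degree d).
Local Notation D := (doubleq d A).
Implicit Types (bs pre mid post : seq (block D)) (fs f fin : seq (letter D)).

Lemma fst_block_btake m (b : block D) : btake m (fst_block b) = fst_block (btake m b).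
Proof. by rewrite /btake /fst_block /= map_take. Qed.

Lemma brt_fst_block (b : block D) : brt (fst_block b) = brt b.
Proof. by rewrite /brt /= -map_comp. Qed.

Lemma fst_block_bdrop m (b : block D) : bdrop m (fst_block b) = fst_block (bdrop m b).
Proof.
by rewrite /bdrop fst_block_btake brt_fst_block /fst_block /= map_drop.
Qed.

Lemma wdeg_fst (w : seq (letter D)) : wdeg [seq fst_letter l | l <- w] = wdeg w.
Proof. by rewrite /wdeg big_map. Qed.

Lemma bdeg_fst_block (b : block D) : bdeg (fst_block b) = wdeg b.2.
Proof. exact: wdeg_fst. Qed.

Lemma tdeg_snd (l : letter D) : tdeg d (snd_letter l) = sdeg l.
Proof. by rewrite /tdeg /sdeg /= addrA addrAC addrK. Qed.

Lemma wdeg_cat (Q : quiver k) (u v : seq (letter Q)) : wdeg (u ++ v) = wdeg u + wdeg v.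
Proof. by rewrite /wdeg big_cat. Qed.

Lemma wdeg_cons (Q : quiver k) (l : letter Q) v : wdeg (l :: v) = sdeg l + wdeg v.
Proof. by rewrite /wdeg big_cons. Qed.

Lemma wdeg_word bs fs : size bs = (size fs).+1 ->
  wdeg (word bs fs) = bsdeg (map (@fst_block _ _ _) bs) + tsum d (map (@snd_letter _ _ _ _ _) fs).
Proof.
elim: bs fs => [|b bs IH] [|f fs] //= [].
  move/size0nil=> -> /=; rewrite bsdeg_cons bsdeg_nil /tsum sumz_nil !addr0.
  by rewrite bdeg_fst_block.
move/IH => sz; rewrite wdeg_cat wdeg_cons sz bsdeg_cons /tsum /= sumz_cons tdeg_snd bdeg_fst_block.
by rewrite addrC [RHS]addrACA (addrC (sdeg f)).
Qed.

Variable M : multi d A e.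

(** With [choice_sum_word], the operation on a word of pure letters is given by a single
    term of its defining sum. *)
Lemma jmap_word X Y bs fs x y i : wf X Y bs fs -> pure bs fs -> word bs fs <> [::] ->
  jmap M (word bs fs) x y i =
  jpair M (map (@fst_block _ _ _) bs) (map (@snd_letter _ _ _ _ _) fs) x y i.
Proof.
move=> wfP pP; have [cw _] := wf_word wfP; move: cw.
case wE: (word bs fs) => [//|l w] /andP[/eqP lX _] _.
rewrite jmapE lX -wE.
case/lastP: bs wfP pP {wE} => [|bs [x0 B]]; first by case.
move=> wfP pP; rewrite (choice_sum_word _ _ (jpair_bimultilinear M x y i) pP); last first.
  by case: wfP => _; rewrite map_rcons => /rcons_inj[].
have -> : X = x0 by case: wfP => _; rewrite map_rcons => /rcons_inj[].
by rewrite map_rcons.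
Qed.

End FirstComponent.

Lemma allP_take (T : Type) (P : T -> Prop) n s : allP P s -> allP P (take n s).
Proof. by rewrite -{1}(cat_take_drop n s) => /allP_cat[]. Qed.

Lemma allP_drop (T : Type) (P : T -> Prop) n s : allP P s -> allP P (drop n s).
Proof. by rewrite -{1}(cat_take_drop n s) => /allP_cat[]. Qed.

Lemma outE (k : fieldType) (Q : quiver k) (sm : operation Q Q) h t X Y n :
  lft h = X -> rgt (last h t) = Y -> wdeg (h :: t) + 1 + 1 = n ->
  out idfun 1 sm h t = Letter (sm (h :: t) X Y n).
Proof. by move=> <- <- <-. Qed.

(** * The A-valued part of the Stasheff identity *)

Section Cuts.
Variables (k : fieldType) (d : int) (A : quiver k).
Local Notation e := (preCY_degree d).
Local Notation D := (doubleq d A).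
Local Notation fbs := (map (@fst_block k d A)).
Local Notation sfs := (map (@snd_letter k d A A idfun)).
Implicit Types (bs pre mid post : seq (block D)) (fs f fin : seq (letter D)).
Implicit Types (b z : block D) (X Y : obj D).
Variable M : multi d A e.
Local Notation it := (@insertion_term k D D (jmap M : operation D D) (jmap M : operation D D)).

(** The value of the inner operation on a word of pure letters, as a letter; its
    components in the two summands are [jletterA] and [jletterF]. *)
Definition jletter X Y bs fs : letter D :=
  let I := bsdeg (fbs bs) + tsum d (sfs fs) + 2 in
  @Letter k D X Y I (jpair M (fbs bs) (sfs fs) X Y I).

Lemma insertion_term_word X Y bs fs x y n w1 w2 w3 : wf X Y bs fs -> pure bs fs ->
  word bs fs = w2 -> w2 <> [::] ->
  it x y n w1 w2 w3 =
  sgn k (wdeg w1) *: jmap M (w1 ++ jletter X Y bs fs :: w3) x y n.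
Proof.
move=> wfP pP w2E w2N; have [cw lw] := wf_word wfP.
move: (wdeg_word (wf_size wfP)) (jmap_word M X Y (bsdeg (fbs bs) + tsum d (sfs fs) + 2) wfP pP).
move: cw lw; rewrite w2E; case: w2 w2E w2N => [//|h t] wE _ /andP[/eqP hX _] lw wd jE.
rewrite /insertion_term (@outE _ _ _ _ _ X Y (bsdeg (fbs bs) + tsum d (sfs fs) + 2)) //.
- by rewrite jE.
- by rewrite -lw /= last_map.
- by rewrite wd -addrA.
Qed.

Definition jletterA X Y bs fs : letter D :=
  let I := bsdeg (fbs bs) + tsum d (sfs fs) + 2 in
  @Letter k D X Y I (jfst M (fbs bs) (sfs fs) X Y I, 0).

Definition jletterF X Y bs fs : letter D :=
  let I := bsdeg (fbs bs) + tsum d (sfs fs) + 2 in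
  @Letter k D X Y I (0, jsnd M (fbs bs) (sfs fs) X Y I).

Lemma jmap_jletter X Y bs fs w1 w3 x y n :
  jmap M (w1 ++ jletter X Y bs fs :: w3) x y n =
  jmap M (w1 ++ jletterA X Y bs fs :: w3) x y n +
  jmap M (w1 ++ jletterF X Y bs fs :: w3) x y n.
Proof.
rewrite /jletter /jletterA /jletterF; set I := _ + 2.
have -> : jpair M (fbs bs) (sfs fs) X Y I =
    1 *: ((jfst M (fbs bs) (sfs fs) X Y I, 0) : D X Y I)
    + (0, jsnd M (fbs bs) (sfs fs) X Y I).
  by rewrite scale1r; congr pair; rewrite /= ?addr0 ?add0r.
by rewrite jmap_multilinear scale1r.
Qed.

Lemma jletterF1 X Y b x y n w1 w3 : jmap M (w1 ++ jletterF X Y [:: b] [::] :: w3) x y n = 0.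
Proof.
apply: (multilinear_zero w1 w3 (jmap_multilinear M x y n)).
by rewrite /= jsnd1.
Qed.

(** The contraction of a value of the necklace product with the functionals of a
    word, normalized by the global sign. *)
Definition signed_contraction X Y n bs fs (t : tens A) : A X Y n :=
  sgn k (necklace_sign d (sfs fs) (fbs bs)) *: tlift (fun v => contract_last d (sfs fs) v X Y n) t.

Lemma pure_cut bs fs b post f2 : pure (bs ++ b :: post) (fs ++ f2) ->
  [/\ pure bs fs, allP isA b.2 & pure post f2].
Proof. by case=> /allP_cat[p1 [p2 p3]] /allP_cat[p4 p5]. Qed.

Lemma pure_glue bs fs b post f2 : pure bs fs -> allP isA b.2 -> pure post f2 ->
  pure (bs ++ b :: post) (fs ++ f2).
Proof. by move=> [p1 p4] p2 [p3 p5]; split; apply/allP_cat. Qed.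

Lemma fst_block_slot (x : obj D) L o R :
  fst_block ((x, L ++ o :: R) : block D) =
  (x, [seq fst_letter l | l <- L] ++ fst_letter o :: [seq fst_letter l | l <- R]).
Proof. by rewrite /fst_block /= map_cat. Qed.

(** A cut with both ends in the same block gives the first kind of diagram: the
    inner operation is applied to letters of [A] only, so its dual component
    vanishes. *)
Lemma insertion_term_F1 X Y n pre z post f1 f2 m m' :
  size f1 = size pre -> size f2 = size post ->
  wf X Y (pre ++ z :: post) (f1 ++ f2) -> pure (pre ++ z :: post) (f1 ++ f2) ->
  (m < m')%N -> (m' <= size z.2)%N ->
  (it X Y n (word (btake m z :: post) f2)
     (drop m (take m' z.2)) (word (rcons pre (bdrop m' z)) f1)).1 =
  signed_contraction X Y n (pre ++ z :: post) (f1 ++ f2)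
    (root_F1 d M M (fbs pre) (fst_block z) (fbs post) m m').
Proof.
move=> sz1 sz2 wfP pP lt le; have [wf1 wf2] := wf_cut sz1 wfP.
have [pP1 zA pP2] := pure_cut pP.
have cz : chain z.1 z.2 by case: wf2 => /= /andP[].
pose Yb := bdrop m (btake m' z).
have cY : chain Yb.1 Yb.2 by apply: chain_bdrop; apply: chain_take.
have wfY : wf (blt Yb) (brt Yb) [:: Yb] [::] by split=> //=; rewrite cY.
have pY : pure [:: Yb] [::] by do 2!split=> //; apply/allP_drop/allP_take.
rewrite (insertion_term_word _ _ _ _ _ wfY pY) //; last first.
  by move/(congr1 size); rewrite size_drop size_takel //=; lia.
rewrite jmap_jletter jletterF1 addr0; set o := jletterA _ _ _ _.
rewrite (word_slot z.1 _ _ _ _ _ _ _ sz1).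
pose z' : block D := (z.1, take m z.2 ++ o :: drop m' z.2).
have ez : take m z.2 = take m (take m' z.2) by rewrite take_takel // ltnW.
have cz' : chain z'.1 z'.2.
  rewrite chain_cat; apply/andP; split; first exact: (chain_take m cz).
rewrite /=; apply/andP; split; first by rewrite /brt /= -ez.
  by have := chain_bdrop m' cz; rewrite /= brt_bdrop.
have rz' : brt z' = brt z.
  rewrite {1}/brt /= map_cat last_cat /= brt_bdrop.
  by have := brt_bdrop m' z; rewrite {1}/brt /= => ->.
have wf' : wf X Y (pre ++ z' :: post) (f1 ++ f2).
  apply: wf_glue => //; first exact: (wf_last wf1).
  exact: (wf_head wf2).
have zA' : allP isA z'.2.
  by apply/allP_cat; split; [exact: allP_take|split=> //; exact: allP_drop].
rewrite -/z' (jmap_word M X Y n wf') //; last first.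
- by rewrite /z' -(word_slot _ z.1 z.1) //; case: (word _ _).
- exact: pure_glue.
rewrite wdeg_word; last by rewrite /= sz2.
rewrite /signed_contraction !map_cat [map _ (z' :: _)]/= [map _ (z :: _)]/= fst_block_slot.
have o1 : fst_letter o = Letter (jfst M [:: fst_block Yb] [::] (blt (fst_block Yb)) (brt (fst_block Yb)) (bdeg (fst_block Yb) + 2)).
  rewrite brt_fst_block /o /jletterA /fst_letter /= bsdeg_cons bsdeg_nil.
  by rewrite /tsum sumz_nil !addr0.
have := @necklace_F1 _ _ _ M (fbs pre) (fst_block z) (fbs post) m m' (sfs f1) (sfs f2) X Y n.
cbv zeta; rewrite !size_map => -> //; last exact: ltnW.
rewrite !fst_block_btake !fst_block_bdrop -/Yb -o1 bsdeg_cons bdeg_fst_block.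
by rewrite -!map_take -!map_drop wdeg_fst.
Qed.

(** A cut with its ends in two different blocks gives two diagrams: the two
    components of the inner value are used by the two remaining kinds. *)
Lemma insertion_term_F2_G X Y n pre zj mid zl post f1 fin f2 m m' :
  size f1 = size pre -> size fin = (size mid).+1 -> size f2 = size post ->
  wf X Y (pre ++ zj :: mid ++ zl :: post) (f1 ++ fin ++ f2) ->
  pure (pre ++ zj :: mid ++ zl :: post) (f1 ++ fin ++ f2) ->
  (it X Y n (word (btake m' zl :: post) f2)
     (word (btake m zj :: rcons mid (bdrop m' zl)) fin)
     (word (rcons pre (bdrop m zj)) f1)).1 =
  signed_contraction X Y n (pre ++ zj :: mid ++ zl :: post) (f1 ++ fin ++ f2)
    (root_F2 d M M (fbs pre) (fst_block zj) (fbs mid) (fst_block zl) (fbs post) m m'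
     + root_G d e M M (fbs pre) (fst_block zj) (fbs mid) (fst_block zl) (fbs post) m m').
Proof.
move=> sz1 szin sz2 wfP pP; have [wf1 wf23] := wf_cut sz1 wfP.
have szin' : size fin = size (zj :: mid) by rewrite szin.
have [wfi wf2] := wf_cut (pre := zj :: mid) szin' wf23.
have [pP1 zjA pP23] := pure_cut pP.
have [pPi zlA pP2] := pure_cut pP23.
have czj : chain zj.1 zj.2 by case: wf23 => /= /andP[].
have czl : chain zl.1 zl.2 by case: wf2 => /= /andP[].
pose ib := btake m zj :: rcons mid (bdrop m' zl).
have cY : chain (btake m zj).1 (btake m zj).2 by exact: (chain_take m czj).
have cY' : chain (bdrop m' zl).1 (bdrop m' zl).2 by exact: chain_bdrop.
pose X' := blt (bdrop m' zl); pose Y' := brt (btake m zj).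
have wfi' : wf X' Y' ib fin.
  have := wf_last wfi cY' (brt_bdrop _ _); rewrite rcons_cons => w.
  exact: (wf_head w).
have pib : pure ib fin.
  case: pPi => p1 p2; split=> //=; split; first exact: allP_take.
  by apply/allP_rcons; split=> //; apply: allP_drop.
rewrite (insertion_term_word _ _ _ _ _ wfi' pib) //; last first.
  by move/(congr1 size); rewrite /ib; case: (fin) szin => [|u f] //= _; rewrite size_cat /= addnS.
rewrite jmap_jletter /signed_contraction tliftD; last exact: contract_last_multilinear.
rewrite !scalerDr -[LHS]/((_ *: jmap M _ _ _ _).1 + (_ *: jmap M _ _ _ _).1).
have fib : fbs ib = btake m (fst_block zj) :: rcons (fbs mid) (bdrop m' (fst_block zl)).
  by rewrite /ib /= map_rcons fst_block_btake fst_block_bdrop.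
congr (_ + _).
  set o := jletterA _ _ _ _; rewrite (word_slot zl.1 _ _ _ _ _ _ _ sz1).
  pose z' : block D := (zl.1, take m' zl.2 ++ o :: drop m zj.2).
  have cz' : chain z'.1 z'.2.
    rewrite chain_cat; apply/andP; split; first exact: (chain_take m' czl).
    rewrite /=; apply/andP; split; first by [].
    by have := chain_bdrop m czj.
  have rz' : brt z' = brt zj.
    rewrite {1}/brt /= map_cat last_cat /=.
    by have := brt_bdrop m zj; rewrite {1}/brt /= => ->.
  have wf' : wf X Y (pre ++ z' :: post) (f1 ++ f2).
    apply: wf_glue => //; first exact: (wf_last wf1).
    exact: (wf_head wf2).
  have zA' : allP isA z'.2.
    by apply/allP_cat; split; [exact: allP_take|split=> //; exact: allP_drop].
  rewrite -/z' (jmap_word M X Y n wf') //; last first.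
  - by rewrite /z' -(word_slot _ zl.1 zl.1) //; case: (word _ _).
  - exact: pure_glue.
  rewrite wdeg_word; last by rewrite /= sz2.
  rewrite !map_cat /= !map_cat /= fst_block_slot.
  have := @necklace_F2 _ _ _ M (fbs pre) (fst_block zj) (fbs mid) (fst_block zl) (fbs post) m m' (sfs f1) (sfs fin) (sfs f2) X Y n.
  cbv zeta; rewrite !size_map => -> //.
  rewrite bsdeg_cons bdeg_fst_block -!map_take -!map_drop wdeg_fst.
  by rewrite -fib fst_block_btake fst_block_bdrop brt_fst_block.
set o := jletterF _ _ _ _.
have sz1' : size (rcons pre (bdrop m zj)) = (size f1).+1 by rewrite size_rcons sz1.
rewrite -(word_cat _ _ _ sz1') cat_rcons.
have wf' : wf X Y (pre ++ bdrop m zj :: btake m' zl :: post) (f1 ++ o :: f2).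
  apply: wf_glue => //.
    by apply: (wf_last wf1); [exact: chain_bdrop|exact: brt_bdrop].
  apply: wf_cons => //; last exact: chain_bdrop.
  by apply: (wf_head wf2); [exact: (chain_take m' czl)|].
rewrite (jmap_word M X Y n wf') //; last first.
- by rewrite -cat_rcons (word_cat _ _ _ sz1'); case: (word _ _).
- apply: pure_glue => //; first exact: allP_drop.
  case: pP2 => p1 p2; split=> //=; split=> //; exact: allP_take.
rewrite wdeg_word; last by rewrite /= sz2.
rewrite !map_cat /= !map_cat /=.
have := @necklace_G _ _ _ M (fbs pre) (fst_block zj) (fbs mid) (fst_block zl) (fbs post) m m' (sfs f1) (sfs fin) (sfs f2) X Y n.
cbv zeta; rewrite !size_map => -> //.
rewrite bsdeg_cons !fst_block_btake !fst_block_bdrop bdeg_fst_block.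
by rewrite -(fst_block_btake m zj) -(fst_block_bdrop m' zl) -fib brt_fst_block.
Qed.

Lemma signed_contractionD X Y n bs fs s t :
  signed_contraction X Y n bs fs (s + t) = signed_contraction X Y n bs fs s + signed_contraction X Y n bs fs t.
Proof.
by rewrite /signed_contraction tliftD ?scalerDr //; apply: contract_last_multilinear.
Qed.

Lemma signed_contraction0 X Y n bs fs : signed_contraction X Y n bs fs 0 = 0.
Proof.
by rewrite /signed_contraction tlift0 ?scaler0 //; apply: contract_last_multilinear.
Qed.

Lemma signed_contraction_sum X Y n bs fs I (r : seq I) P F :
  signed_contraction X Y n bs fs (\sum_(i <- r | P i) F i) =
  \sum_(i <- r | P i) signed_contraction X Y n bs fs (F i).
Proof. exact: (big_morph _ (signed_contractionD X Y n bs fs) (signed_contraction0 X Y n bs fs)). Qed.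

Local Arguments word : simpl never.

(** The cuts of a word of pure letters and the two-disc diagrams of the same type
    correspond to each other, with the same signs up to the global one. *)
Lemma insertions_word X Y n bs fs : wf X Y bs fs -> pure bs fs ->
  (insertions (jmap M : operation D D) (jmap M : operation D D) (word bs fs) X Y n).1 =
  signed_contraction X Y n bs fs (necklace d e M M (fbs bs)).
Proof.
move=> wfP pP; have sz := wf_size wfP.
have fstD : {morph (fun u : D X Y n => u.1) : a b / a + b} by [].
rewrite insertionsE (split_sum_raddf _ _ fstD) split_sum_word // /necklace signed_contraction_sum size_map.
rewrite !big_nat; apply: eq_bigr => j /= jlt.
rewrite -map_drop -map_take.
case rE: (drop j bs) => [|b r]; first by rewrite /= signed_contraction0.
rewrite [RHS]/=.
have bsE : bs = take j bs ++ b :: r by rewrite -rE cat_take_drop.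
have fsE : fs = take j fs ++ drop j fs by rewrite cat_take_drop.
set pre := take j bs in bsE *; set f1 := take j fs in fsE *; set f2 := drop j fs in fsE *.
have sz1 : size f1 = size pre by rewrite !size_takel // -1?ltnS -?sz // ltnW.
have sz2 : size f2 = size r.
  by move: sz; rewrite bsE fsE !size_cat sz1 /= addnS => -[] /addnI.
pose CT := signed_contraction X Y n bs fs.
(* The cuts whose right end is at position [m'] of the block [b] and whose left end
   is in the block [q] of [r]. *)
pose B q m' := if drop q r is zl :: post then
    \sum_(0 <= n' < (size zl.2).+1)
      CT (root_F2 d M M (fbs pre) (fst_block b) (fbs (take q r)) (fst_block zl) (fbs post) m' n'
          + root_G d e M M (fbs pre) (fst_block b) (fbs (take q r)) (fst_block zl) (fbs post) m' n')
  else 0.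
transitivity (\sum_(0 <= m' < (size b.2).+1)
    (\sum_(0 <= m < m') CT (root_F1 d M M (fbs pre) (fst_block b) (fbs r) m m')
     + \sum_(0 <= q < size r) B q m')); last first.
  rewrite big_split /= signed_contractionD; congr (_ + _).
    rewrite -sum_triangle signed_contraction_sum size_map; apply: eq_bigr => m _.
    by rewrite signed_contraction_sum.
  rewrite exchange_big signed_contraction_sum size_map /=; apply: eq_bigr => q _.
  rewrite -map_drop -map_take /B; case: (drop q r) => [|zl post] /=.
    by rewrite signed_contraction0 big1.
  rewrite signed_contraction_sum size_map; apply: eq_bigr => m _.
  by rewrite signed_contraction_sum size_map.
rewrite !big_nat; apply: eq_bigr => m' /andP[_]; rewrite ltnS => m'le.
rewrite (split_sum_raddf _ _ fstD) split_sum_word; last by rewrite /= sz2.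
rewrite [size (_ :: _)]/=.
rewrite big_nat_recl //; congr (_ + _).
  rewrite !drop0 !take0 big_nat_recr //= size_takel // [X in _ + X](_ : _ = 0) ?addr0.
    rewrite !big_nat; apply: eq_bigr => m /= mlt.
    rewrite /CT; have := @insertion_term_F1 X Y n pre b r f1 f2 m m' sz1 sz2.
    rewrite -bsE -fsE => <- //.
    rewrite (_ : btake m (btake m' b) = btake m b) // /btake /= take_takel //; exact: ltnW.
  by rewrite -[word [:: _] [::]]/(drop m' (take m' b.2)) drop_oversize ?size_takel.
apply: eq_bigr => q _; rewrite /B [drop _ (_ :: _)]/=; case qE: (drop q r) => [//|zl post].
apply: eq_bigr => n' _.
have qlt : (q < size r)%N.
  by rewrite ltnNge; apply/negP => /drop_oversize; rewrite qE.
have rE' : r = take q r ++ zl :: post by rewrite -qE cat_take_drop.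
have f2E : f2 = take q.+1 f2 ++ drop q.+1 f2 by rewrite cat_take_drop.
rewrite /CT; have := @insertion_term_F2_G X Y n pre b (take q r) zl post f1 (take q.+1 f2) (drop q.+1 f2) m' n' sz1.
rewrite -rE' -f2E -bsE -fsE => <- //.
- by rewrite !size_takel ?sz2 // ltnW.
- by rewrite size_drop sz2 -(size_drop q.+1) -add1n -drop_drop qE /= drop0.
Qed.

End Cuts.

Section InsertionsMultilinear.
Variables (k : fieldType) (Q R : quiver k) (sm : operation Q Q) (op : operation Q R).
Hypothesis smP : forall x y i, multilinear (fun w => sm w x y i).
Hypothesis opP : forall x y i, multilinear (fun w => op w x y i).

Lemma split_sum_linear (V : lmodType k) T c (H H1 H2 : seq T -> seq T -> V) s :
  (forall a b, H a b = c *: H1 a b + H2 a b) ->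
  split_sum H s = c *: split_sum H1 s + split_sum H2 s.
Proof.
elim: s H H1 H2 => [|x s IH] H H1 H2 e /=; first exact: e.
rewrite e (IH _ (fun a b => H1 (x :: a) b) (fun a b => H2 (x :: a) b)) //.
by rewrite scalerDr addrACA.
Qed.

Lemma wdeg_letter l r x y i (a b : Q x y i) :
  wdeg (l ++ Letter a :: r) = wdeg (l ++ Letter b :: r).
Proof. by rewrite !wdeg_cat !wdeg_cons. Qed.

Lemma insertion_term_inner l r x y i (c : k) (a b : Q x y i) u v n w1 w3 :
  insertion_term sm op u v n w1 (l ++ Letter (c *: a + b) :: r) w3 =
  c *: insertion_term sm op u v n w1 (l ++ Letter a :: r) w3
  + insertion_term sm op u v n w1 (l ++ Letter b :: r) w3.
Proof.
pose X := if l is h :: _ then lft h else x.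
pose Y := last y [seq rgt z | z <- r].
pose N := wdeg (l ++ Letter a :: r) + 1 + 1.
have E (w : Q x y i) : insertion_term sm op u v n w1 (l ++ Letter w :: r) w3 =
    sgn k (wdeg w1) *: op (w1 ++ Letter (sm (l ++ Letter w :: r) X Y N) :: w3) u v n.
  rewrite /insertion_term; case lE: l => [|h l'] /=; rewrite (@outE _ _ _ _ _ X Y N) //.
  - by rewrite /X lE.
  - by rewrite /Y -(last_map (@rgt k Q)).
  - by rewrite /N lE -[Letter w :: r]cat0s (wdeg_letter [::] r w a).
  - by rewrite /X lE.
  - by rewrite last_cat /= /Y -(last_map (@rgt k Q)).
  - by rewrite -cat_cons (wdeg_letter _ _ w a) /N lE.
by rewrite !E smP opP scalerDr !scalerA mulrC.
Qed.

Lemma insertions_multilinear u v n :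
  multilinear (fun w => insertions sm op w u v n).
Proof.
move=> l r x y i c a b; rewrite !insertionsE !split_sum_cat_cons.
rewrite scalerDr addrACA; congr (_ + _); apply: split_sum_linear => p q.
  apply: split_sum_linear => w1 [|h t]; rewrite /insertion_term ?scaler0 ?addr0 //.
  rewrite -!cat_cons !catA opP scalerDr !scalerA mulrC.
  by [].
rewrite !split_sum_cat_cons scalerDr addrACA; congr (_ + _); apply: split_sum_linear => w1 w2.
  exact: insertion_term_inner.
case: w2 => [|h t]; rewrite /insertion_term ?scaler0 ?addr0 //.
rewrite -!catA opP scalerDr !scalerA mulrC (wdeg_letter _ _ (c *: a + b) b).
by rewrite (wdeg_letter _ _ a b).
Qed.

End InsertionsMultilinear.

Section FirstVanishes.
Variables (k : fieldType) (d : int) (A : quiver k) (M : preCY d A).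
Local Notation D := (doubleq d A).

Lemma is_type_fst_block X Y (bs : seq (block D)) fs : wf X Y bs fs -> word bs fs <> [::] ->
  is_type (map (@fst_block k d A) bs).
Proof.
have cf (s : seq (letter D)) x :
    @chain k A x [seq fst_letter l | l <- s] = @chain k D x s.
  by elim: s x => [|l s IH] x //=; rewrite IH.
case: bs => [|b bs] wfP; first by have := wf_size wfP.
have : all (fun b => chain b.1 b.2) (map (@fst_block k d A) (b :: bs)).
  by case: wfP => ch _ _; rewrite all_map; apply: sub_all ch => z /=; rewrite cf.
case: bs wfP => [|b' bs] // wfP /= /andP[ch _].
have := wf_size wfP => /= -[/esym/size0nil ->] /=; rewrite size_map.
by case: (b.2) ch => //= ? ? ->.
Qed.

Lemma insertions_first h t X Y n : chain X (h :: t) ->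
  last X [seq rgt l | l <- h :: t] = Y ->
  (insertions (jmap M : operation D D) (jmap M : operation D D) (h :: t) X Y n).1 = 0.
Proof.
move=> cw lw.
pose mu w : A X Y n := (insertions (jmap M : operation D D) (jmap M : operation D D) w X Y n).1.
rewrite -/(mu _); apply: (pure_zero _ cw lw).
  have H := @insertions_multilinear _ D D _ _ (jmap_multilinear M) (jmap_multilinear M) X Y n.
  by move=> l r x y i c a b; rewrite /mu H.
move=> bs fs wfP pP sh; rewrite /mu insertions_word // preCY_eq.
  exact: signed_contraction0.
by apply: (is_type_fst_block wfP) => w0; rewrite w0 in sh.
Qed.

End FirstVanishes.

(** * The natural bilinear form *)

Section NaturalFormTheory.
Variables (k : fieldType) (d : int) (A B : quiver k) (phi0 : obj A -> obj B).
Variable phi : forall x y i, {linear A x y i -> B (phi0 x) (phi0 y) i}.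
Local Notation S := (sumq d phi0).
Local Notation form := (natural_form (d := d) phi).
Implicit Types l : letter S.

Lemma phi_pairing_linear1 l' : letter_linear (fun l => phi_pairing phi l l' : k^o).
Proof. by move=> x y i c a b; apply: (pairing_letter_linear _ c a.2 b.2). Qed.

Lemma phi_pairing_linear2 l : letter_linear (fun l' => phi_pairing phi l l' : k^o).
Proof.
move=> x y i c a b; rewrite /phi_pairing /lmap /fst_letter /= linearP.
exact: pairing_linear.
Qed.

Lemma scale_comb (s1 s2 s3 c : k) (p q p' q' : k^o) :
  s1 * (c *: p + q) - s2 * (s3 * (c *: p' + q')) =
  c *: (s1 * p - s2 * (s3 * p') : k^o) + (s1 * q - s2 * (s3 * q')).
Proof.
rewrite -![_ *: _]/(_ * _ : k) !mulrDr opprD addrACA; congr (_ + _).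
by rewrite mulrN (mulrCA s1) (mulrCA s3) (mulrCA s2).
Qed.

Lemma form_linear1 l' : letter_linear (fun l => form l l' : k^o).
Proof.
move=> x y i c a b; rewrite /natural_form !phi_pairing_linear1 !phi_pairing_linear2.
rewrite ![sdeg (Letter _)]/=; exact: scale_comb.
Qed.

Lemma form_antisym l l' : form l' l = - (sgn k (sdeg l * sdeg l') * form l l').
Proof.
rewrite /natural_form [sdeg l' * _]mulrC (mulrBr (sgn k _)) opprB; congr (_ - _).
by rewrite [RHS]mulrA sgn_sq mul1r.
Qed.

Lemma form_linear2 l : letter_linear (fun l' => form l l' : k^o).
Proof.
move=> x y i c a b; rewrite /natural_form !phi_pairing_linear1 !phi_pairing_linear2.
rewrite /sdeg /=; exact: scale_comb.
Qed.

Lemma phi_pairing_deg l l' : phi_pairing phi l l' != 0 -> sdeg l + sdeg l' + (d - 1 + 2) = 0.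
Proof. by case/pairing_neq0=> _ _ /=; rewrite /sdeg; lia. Qed.

Lemma form_deg l l' : form l l' != 0 -> sdeg l + sdeg l' + (d - 1 + 2) = 0.
Proof.
rewrite /natural_form => H.
have [E|/phi_pairing_deg //] := eqVneq (phi_pairing phi l l') 0.
have [E'|/phi_pairing_deg <-] := eqVneq (phi_pairing phi l' l) 0.
  by move: H; rewrite E E' !mulr0 subrr eqxx.
by rewrite [sdeg l' + _]addrC.
Qed.

Lemma form_bilinear : bilinear_form (d - 1) form.
Proof.
split.
- move=> x y i j b; exact: (form_linear1 (Letter b)).
- move=> x y i j a; exact: (form_linear2 (Letter a)).
by move=> x y i j a b H; apply/eqP; apply/negPn/negP => /form_deg E; rewrite E eqxx in H.
Qed.

End NaturalFormTheory.

(** * Almost cyclicity of the operation *)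

Section CyclicCore.
Variables (k : fieldType) (d : int) (A : quiver k).
Local Notation e := (preCY_degree d).
Implicit Types (bs : seq (block A)) (fs : seq (letter (dualq A))).

Lemma pairing_linear_letter (f : letter (dualq A)) x y i :
  linear (fun a : A x y i => pairing f (Letter a) : k^o).
Proof. exact: pairing_linear. Qed.

Lemma pairing_ucontracted_last (M : multi d A e) bs fs (f : letter (dualq A)) X Y i :
  size bs = (size fs).+1 -> rgt f = X -> lft f = Y -> i = - ldeg f ->
  pairing f (Letter (ucontracted_last M bs fs X Y i)) = ucontracted M bs (rcons fs f).
Proof.
move=> sz eX eY ei; subst.
rewrite /ucontracted_last (tlift_comp (h := fun a => pairing f (Letter a) : k^o)); last exact: pairing_linear_letter.
apply: (@multi_ext k d A M k^o) => [||_ v out].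
- apply: (multilinear_linear (h := fun a => pairing f (Letter a) : k^o)); first exact: pairing_linear_letter.
  exact: (ucontract_last_multilinear d).
- exact: (ucontract_multilinear d).
have := output_size out; elim/last_ind: v out => [|v g _] out.
  by rewrite sz.
rewrite size_rcons sz => -[szv]; rewrite ucontract_last_rcons -!cats1 ucontract_cat ?szv // /= mulr1.
rewrite {1}/pairing proj_id.
have := dual_linear (lval f : dual _) (ucontract fs v) (@proj k A (rgt f) (lft f) (- ldeg f) g) 0.
by rewrite addr0 dual_apply0 addr0 => ->.
Qed.

(** Cyclic invariance after contraction: the sign of the rotation of the outputs is
    traded, by the degrees of the pairings, for the one of the functionals. *)
Lemma ucontracted_cyclic (M : preCY d A) b bs f fs : is_type (b :: bs) ->
  ucontracted M (b :: bs) (f :: fs) =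
  sgn k (bdeg b * bsdeg bs + tdeg d f * tsum d fs) * ucontracted M (rcons bs b) (rcons fs f).
Proof.
move=> tP; rewrite /ucontracted preCY_cyclic // tliftZ; last exact: (ucontract_multilinear d).
rewrite sgnD -mulrA; congr (_ * _).
rewrite /tau_out (tlift_comp _ _ (tlift_lin (ucontract_multilinear d _))).
transitivity (tlift (fun v => sgn k (tdeg d f * tsum d fs) *: (ucontract (rcons fs f) v : k^o))
    (M (rcons bs b))); last by rewrite tlift_funZ.
pose g r l : tens A := sgn k (odeg d l * vdeg d r) *: tpure (l :: r).
apply: multi_ext.
- apply: (multilinear_linear (tlift_lin (ucontract_multilinear d _))).
  apply: (multilinear_last (f := g)) => [r|l]; rewrite /g.
    apply: letter_linear_shape => [l l' el|]; first by rewrite /odeg el.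
    exact: (multilinear_letter [::] _ (@tpure_multilinear _ _)).
  apply: multilinear_shape => [r r' er|]; first by rewrite (vdeg_shape d er).
  move=> p q x y i c a' b'; exact: (@tpure_multilinear _ _ (l :: p)).
- by apply: multilinear_shape => //; apply: (ucontract_multilinear d).
move=> _ v out; elim/last_ind: v out => [|r l _] out.
  by have := output_size out; rewrite size_rcons.
rewrite [X in tlift _ X](_ : _ = g r l); last exact: (match_rcons g).
rewrite /g tliftZ ?tlift_pure //; try exact: (ucontract_multilinear d).
have [szE|szN] := eqVneq (size r) (size fs); last first.
  have -> : ucontract (f :: fs) (l :: r) = 0.
    by apply/eqP/negPn/negP => /ucontract_size [] /eqP; rewrite (negPf szN).
  rewrite scaler0 (_ : ucontract _ _ = 0) ?scaler0 //.
  by apply/eqP/negPn/negP => /ucontract_size; rewrite !size_rcons => -[] /eqP; rewrite (negPf szN).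
rewrite -!cats1 ucontract_cat // /= mulr1 [ucontract fs r * _]mulrC.
have [->|/(pairing_odeg d) ->] := eqVneq (pairing f l) 0; first by rewrite !mul0r !scaler0.
have [->|/(ucontract_vdeg d) ->] := eqVneq (ucontract fs r) 0; first by rewrite !mulr0 !scaler0.
by congr (_ *: _); apply: eq_sgn; rewrite !oddzE.
Qed.

End CyclicCore.

Section CyclicValues.
Variables (k : fieldType) (d : int) (A : quiver k) (M : preCY d A).
Local Notation e := (preCY_degree d).
Local Notation D := (doubleq d A).
Local Notation fbs := (map (@fst_block k d A)).
Local Notation sfs := (map (@snd_letter k d A A idfun)).
Local Notation form := (Gamma_double d A).
Implicit Types (bs : seq (block D)) (fs w : seq (letter D)) (z : letter D).

Definition closed_value w z : k^o :=
  form (@Letter k D (rgt z) (lft z) (wdeg w + 2) (jmap M w (rgt z) (lft z) (wdeg w + 2))) z.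

(** The degree of the form leaves a single total degree for which there is
    something to prove, and this relation enters the signs below. *)
Lemma closed_deg w z : closed_value w z != 0 -> wdeg w + sdeg z + d + 2 = 0.
Proof. by move/form_deg; rewrite /sdeg /=; move: (wdeg w) (ldeg z) => p q; lia. Qed.

Lemma pairing_zero_l (f : letter (dualq A)) (l : letter A) : lval f = 0 -> pairing f l = 0.
Proof. by rewrite /pairing => ->. Qed.

Lemma pairing_zero_r (f : letter (dualq A)) (l : letter A) : lval l = 0 -> pairing f l = 0.
Proof.
case: l => x y i a /= ->; have := pairing_linear_letter f (-1) (0 : A x y i) 0.
by rewrite scaler0 addr0 scaleN1r addNr.
Qed.

Lemma closed_A w z : isA z ->
  closed_value w z = sgn k (wdeg w) *
   pairing (@Letter k (dualq A) (rgt z) (lft z) (wdeg w + 2 + (d - 1)) (jmap M w (rgt z) (lft z) (wdeg w + 2)).2) (fst_letter z).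
Proof.
move=> zA; rewrite /closed_value /Gamma_double /natural_form /phi_pairing.
rewrite (@pairing_zero_l (snd_letter z)) // !mulr0 subr0.
by congr (_ * _); apply: eq_sgn; rewrite /sdeg /= !oddzE; case: (oddz (wdeg w)).
Qed.

Lemma closed_F w z : isF z ->
  closed_value w z = sgn k (wdeg w * sdeg z) *
   pairing (snd_letter z) (@Letter k A (rgt z) (lft z) (wdeg w + 2) (jmap M w (rgt z) (lft z) (wdeg w + 2)).1).
Proof.
move=> zF; rewrite /closed_value /Gamma_double /natural_form /phi_pairing.
rewrite (@pairing_zero_r _ (lmap _ (fst_letter z))) // mulr0 sub0r mulrA -mulNr; congr (_ * _).
rewrite -sgnD !sgnE [sdeg (Letter _)]/sdeg [ldeg _]/= !oddzE.
by case: (oddz (ldeg z)); case: (oddz (wdeg w)); rewrite /= ?opprK.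
Qed.

(** Pairing the [A]-valued component with a functional contracts also the last
    output. *)
Lemma closed_word_F bs fs z : isF z -> wf (rgt z) (lft z) bs fs -> pure bs fs ->
  word bs fs <> [::] -> wdeg (word bs fs) + sdeg z + d + 2 = 0 ->
  closed_value (word bs fs) z =
  sgn k (wdeg (word bs fs) * sdeg z + jfst_sign d (fbs bs) (sfs fs)) *
  ucontracted M (fbs bs) (rcons (sfs fs) (snd_letter z)).
Proof.
move=> zF wfP pP w0 dg; rewrite closed_F // (jmap_word _ _ _ _ wfP) //.
have sz : size (fbs bs) = (size (sfs fs)).+1 by rewrite !size_map (wf_size wfP).
rewrite sgnD -mulrA; congr (_ * _); rewrite [_.1]/= jfstE //.
rewrite -(pairing_ucontracted_last M sz (X := rgt z) (Y := lft z) (i := wdeg (word bs fs) + 2)) //; last first.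
  by move: dg; rewrite /sdeg /=; move: (wdeg _) (ldeg z) => p q; lia.
have := pairing_linear_letter (snd_letter z) (sgn k (jfst_sign d (fbs bs) (sfs fs))) (ucontracted_last M (fbs bs) (sfs fs) (rgt z) (lft z) (wdeg (word bs fs) + 2)) 0.
rewrite addr0 => ->.
by rewrite [X in _ + X](_ : _ = 0) ?addr0 //; apply: pairing_zero_r.
Qed.

(** An element of [A] closes up the word by joining its first and last blocks into
    a single one. *)
Lemma closed_word_A b1 mid bn fs z : isA z ->
  wf (rgt z) (lft z) (b1 :: rcons mid bn) fs -> pure (b1 :: rcons mid bn) fs ->
  word (b1 :: rcons mid bn) fs <> [::] ->
  wdeg (word (b1 :: rcons mid bn) fs) + sdeg z + d + 2 = 0 ->
  closed_value (word (b1 :: rcons mid bn) fs) z =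
  sgn k (wdeg (word (b1 :: rcons mid bn) fs)) *
  (sgn k (jfst_sign d (fbs (b1 :: rcons mid bn)) (sfs fs) + sdeg z
    + (wdeg bn.2 + sdeg z) * bsdeg (fbs mid) + wdeg bn.2 * sdeg z) *
  ucontracted M (fbs ((b1.1, b1.2 ++ z :: bn.2) :: mid)) (sfs fs)).
Proof.
move=> zA wfP pP w0 dg; rewrite closed_A // (jmap_word _ _ _ _ wfP) //.
set W := word _ _ in w0 dg *.
have sz : size (rcons (fbs mid) (fst_block bn)) = size (sfs fs).
  by have := wf_size wfP; rewrite /= !size_rcons !size_map => -[].
rewrite [_.2]/=; congr (_ * _).
rewrite /pairing [lval _]/= map_rcons.
rewrite jsndE // Letter_proj //; last first.
  by move: dg; rewrite /sdeg /=; move: (wdeg _) (ldeg z) => p q; lia.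
rewrite [fbs (_ :: mid)]/= fst_block_slot bdeg_fst_block -map_rcons.
by [].
Qed.

Lemma closed_word1 b z : isA z -> wf (rgt z) (lft z) [:: b] [::] -> pure [:: b] [::] ->
  b.2 <> [::] -> closed_value b.2 z = 0.
Proof.
move=> zA wfP pP w0; rewrite closed_A //.
have := jmap_word M (rgt z) (lft z) (wdeg b.2 + 2) wfP pP.
rewrite [word _ _]/= => -> //; rewrite pairing_zero_l ?mulr0 //.
by rewrite /= jsnd1.
Qed.

Lemma word_rcons x B a bs fs :
  word (((x, rcons B a) : block D) :: bs) fs = rcons (word ((x, B) :: bs) fs) a.
Proof. by case: fs => [|f fs] //=; rewrite rcons_cat. Qed.

Lemma word_push x C a bs fs : size bs = size fs ->
  word (rcons bs ((x, a :: C) : block D)) fs = a :: word (rcons bs (x, C)) fs.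
Proof. by move=> sz; apply: word_rcons_cons. Qed.

Lemma word_obj x y C bs fs : word (rcons bs ((x, C) : block D)) fs = word (rcons bs (y, C)) fs.
Proof. by elim: bs fs => [|b bs IH] [|f fs] //=; rewrite IH. Qed.

Lemma word_snoc bs fs f x : size bs = (size fs).+1 ->
  word (rcons bs ((x, [::]) : block D)) (rcons fs f) = f :: word bs fs.
Proof. by move=> sz; rewrite -!cats1 word_cat. Qed.

Lemma wf_uncons X Y b bs f fs : wf X Y (b :: bs) (f :: fs) ->
  [/\ wf X (lft f) bs fs, rgt f = blt b, Y = brt b & chain b.1 b.2].
Proof. by case=> /= /andP[c1 c2] [l1 l2] [r1 r2]. Qed.

Lemma wf_snoc X Y bs fs f : wf X Y bs fs -> rgt f = X ->
  wf (lft f) Y (rcons bs ((lft f, [::]) : block D)) (rcons fs f).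
Proof.
case=> c l r e; split; first by rewrite all_rcons.
  by rewrite !map_rcons l e.
by rewrite !map_rcons r.
Qed.

Lemma wdeg_rcons w z : wdeg (rcons w z) = wdeg w + sdeg z.
Proof. by rewrite -cats1 wdeg_cat wdeg_cons /wdeg big_nil addr0. Qed.

Lemma xtail_rcons (t s : seq int) u : size s = size t -> xtail (rcons t u) s = xtail t s.
Proof.
have H s' : size s' = (size t).+1 -> xsum (rcons t u) s' = xsum t s'.
  elim: t s' {s} => [|x t IH] [|y s'] //= [].
    by move/size0nil->; rewrite sumz_nil mulr0.
  by move=> sz; rewrite IH.
by move=> sz; apply: H; rewrite /= sz.
Qed.

Lemma xsum_rcons (t s : seq int) c : size s = size t ->
  xsum t (rcons s c) = xsum t s + sumz t * c.
Proof.
elim: t s => [|x t IH] [|y s] //=; first by rewrite sumz_nil mul0r addr0.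
by case=> /IH ->; rewrite sumz_rcons sumz_cons mulrDr mulrDl addrACA.
Qed.

Lemma xsum_rcons2 (t s : seq int) u c : size s = (size t).+1 ->
  xsum (rcons t u) (rcons s c) = xsum t s + (sumz t + u) * c.
Proof.
elim: t s => [|x t IH] [|y s] //= [].
  by move/size0nil->; rewrite /= sumz_cons !sumz_nil !addr0 !add0r.
move=> /IH ->; rewrite sumz_rcons sumz_cons.
by move: (sumz s) (sumz t) (xsum t s) => p q r; lia.
Qed.

Lemma jfst_sign_head (b : block A) (post : seq (block A)) (fs : seq (letter (dualq A))) :
  jfst_sign d (b :: post) fs = xtail (tdegs d fs) (bdegs post) + d * (size fs)%:Z
    + (bdeg b * bsdeg post + psum (bdegs post)).
Proof. by rewrite /jfst_sign /= xsum_head bsdegE. Qed.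

Lemma tdegs_rcons (fs : seq (letter (dualq A))) f :
  tdegs d (rcons fs f) = rcons (tdegs d fs) (tdeg d f).
Proof. by rewrite /tdegs map_rcons. Qed.

Lemma tdegs_cons (fs : seq (letter (dualq A))) f :
  tdegs d (f :: fs) = tdeg d f :: tdegs d fs.
Proof. by []. Qed.

Lemma tsum_rcons (fs : seq (letter (dualq A))) f :
  tsum d (rcons fs f) = tsum d fs + tdeg d f.
Proof. by rewrite /tsum tdegs_rcons sumz_rcons. Qed.

Lemma xtail_cons1 (t : int) (ts s : seq int) : xtail (t :: ts) s = t * sumz s + xsum ts s.
Proof. by []. Qed.

Lemma wdeg_nil (Q : quiver k) : wdeg (Nil (letter Q)) = 0.
Proof. by rewrite /wdeg big_nil. Qed.

(** The block of the letter [a] is at the end of the word on the left and is the one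
    completed by [a] on the right: both sides are the same value of [M]. *)
Lemma rotate_FA x B a bs fs f :
  let X := rgt f in let w' := word (((x, B) : block D) :: bs) fs in
  wf X (lft f) ((x, rcons B a) :: bs) fs -> pure ((x, rcons B a) :: bs) fs -> isF f ->
  wdeg w' + sdeg a + sdeg f + d + 2 = 0 ->
  closed_value (rcons w' a) f = sgn k (sdeg f * wdeg (rcons w' a)) * closed_value (f :: w') a.
Proof.
move=> X w' wfP pP fF dg.
have sz : size bs = size fs by have := wf_size wfP; move=> -[].
have [cB /eqP la] : chain x B /\ lft a == brt ((x, B) : block D).
  case: wfP => /= /andP[+ _] _ _; rewrite -cats1 chain_cat /= andbT => /andP[cB la].
  by split.
have ra : rgt a = lft f by rewrite (wf_eq wfP) /brt /= map_rcons last_rcons.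
case: (pP) => -[/allP_rcons[BA aA] bsA] fsF.
rewrite -word_rcons closed_word_F //; last 2 first.
- by rewrite word_rcons; case: (word _ _).
- by rewrite word_rcons wdeg_rcons.
have wf2 : wf (rgt a) (lft a) ((x, B) :: rcons bs (lft f, [::])) (rcons fs f).
  rewrite ra la -rcons_cons; apply: wf_snoc => //.
  exact: (wf_head wfP).
have fw : f :: w' = word ((x, B) :: rcons bs (lft f, [::])) (rcons fs f).
  by rewrite -rcons_cons word_snoc //= sz.
have dg' : wdeg (f :: w') + sdeg a + d + 2 = 0.
  by rewrite wdeg_cons -dg; move: (wdeg w') (sdeg a) (sdeg f) => p q r; lia.
rewrite fw in dg' *; rewrite closed_word_A //; last first.
- by rewrite -fw.
- split; last by apply/allP_rcons.
  by split=> //; apply/allP_rcons.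
rewrite -fw in dg' *.
rewrite -rcons_cons !map_rcons [fbs (_ :: _)]/= [fbs (_ :: _)]/=.
rewrite [(x, B).2]/= [(x, B).1]/= [(_, [::]).2]/= !cats1.
rewrite !mulrA -!sgnD; congr (_ * _); apply: eq_sgn.
rewrite rcons_cons jfst_sign_ends; last by rewrite size_rcons !size_map sz.
rewrite jfst_sign_head !bdeg_fst_block wdeg_rcons wdeg_nil tdegs_rcons.
rewrite xtail_rcons ?size_map // size_rcons !size_map [(x, B).2]/= wdeg_cons word_rcons wdeg_rcons.
rewrite -/w'; move: dg; move: (wdeg w') (sdeg a) (sdeg f) => r p q dg.
(* The degree of the form determines the parity of the rest of the word. *)
have rE : oddz r = xorb (oddz p) (xorb (oddz q) (oddz d)).
  by have -> : r = - p - q - d - 2 by [lia]; rewrite !oddzE; case: (oddz p); case: (oddz q); case: (oddz d).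
rewrite !oddzE rE; case: (oddz q); case: (oddz p); ring.
Qed.

(** Moving a functional through the closing point shifts the functionals by one
    place, so that the two sides differ by one turn of [M]. *)
Lemma rotate_FF g bs fs f : rgt g = lft f ->
  let X := rgt f in let w' := word bs fs in
  wf X (lft g) bs fs -> pure bs fs -> isF f -> isF g ->
  wdeg w' + sdeg g + sdeg f + d + 2 = 0 ->
  closed_value (rcons w' g) f = sgn k (sdeg f * wdeg (rcons w' g)) * closed_value (f :: w') g.
Proof.
move=> rg X w' wfP pP fF gF dg.
have sz : size bs = (size fs).+1 := wf_size wfP.
have wf1 : wf X (lft f) (((lft f, [::]) : block D) :: bs) (g :: fs).
  exact: (@wf_cons _ _ _ _ ((lft f, [::]) : block D) _ _ _ wfP).
have w1 : rcons w' g = word (((lft f, [::]) : block D) :: bs) (g :: fs) by rewrite /= cats1.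
have p1 : pure (((lft f, [::]) : block D) :: bs) (g :: fs) by case: pP.
have wf2 : wf (rgt g) (lft g) (rcons bs ((lft f, [::]) : block D)) (rcons fs f).
  by rewrite rg; apply: (wf_snoc wfP).
have p2 : pure (rcons bs ((lft f, [::]) : block D)) (rcons fs f).
  by case: pP => q1 q2; split; apply/allP_rcons.
have w2 : f :: w' = word (rcons bs ((lft f, [::]) : block D)) (rcons fs f) by rewrite word_snoc.
rewrite {1}w1 closed_word_F -?w1 //; last 2 first.
- by case: (w').
- by rewrite wdeg_rcons.
rewrite [closed_value (f :: w') g](_ : _ = closed_value (word (rcons bs ((lft f, [::]) : block D)) (rcons fs f)) g);
  last by rewrite w2.
rewrite closed_word_F -?w2 //; last first.
  by rewrite wdeg_cons -dg; move: (wdeg w') (sdeg g) (sdeg f) => p q r; lia.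
rewrite [fbs (_ :: _)]/= [sfs (_ :: _)]/= !map_rcons.
rewrite rcons_cons ucontracted_cyclic; last first.
  by apply: (is_type_fst_block wf1); rewrite -w1; case: (w').
rewrite !mulrA -!sgnD; congr (_ * _); apply: eq_sgn.
rewrite jfst_sign_head tdegs_cons xtail_cons1 /jfst_sign bdegs_rcons tdegs_rcons psum_rcons.
rewrite xsum_rcons2 ?size_map // !bdeg_fst_block wdeg_rcons wdeg_cons wdeg_nil size_rcons [size (_ :: _)]/=.
have := wdeg_word sz; rewrite -/w' => ->.
rewrite tsum_rcons !tdeg_snd !size_map -!bsdegE.
move: (sdeg f) (sdeg g) => p q; rewrite !oddzE.
by case: (oddz q); ring.
Qed.

(** Both letters belong to the block through the closing point, so both sides are
    the same value of [M], as in [rotate_FA]. *)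
Lemma rotate_AA x B a' bs X0 C fs a :
  let w' := word (((x, B) : block D) :: rcons bs (X0, C)) fs in
  wf (rgt a) (lft a) (((x, rcons B a') : block D) :: rcons bs (X0, C)) fs ->
  pure (((x, rcons B a') : block D) :: rcons bs (X0, C)) fs -> isA a ->
  wdeg w' + sdeg a' + sdeg a + d + 2 = 0 ->
  closed_value (rcons w' a') a = sgn k (sdeg a * wdeg (rcons w' a')) * closed_value (a :: w') a'.
Proof.
move=> w' wfP pP aA dg.
have sz : size fs = (size bs).+1.
  by have := wf_size wfP; rewrite /= size_rcons => -[].
have [cB la'] : chain x B /\ lft a' = brt ((x, B) : block D).
  case: wfP => /= /andP[+ _] _ _; rewrite -cats1 chain_cat /= andbT => /andP[cB /eqP la].
  by split.
have la : lft a = rgt a' by rewrite (wf_eq wfP) /brt /= map_rcons last_rcons.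
have [X0E cC] : X0 = rgt a /\ chain X0 C.
  case: wfP => /= /andP[_ c] l _; move: c l.
  by rewrite all_rcons map_rcons -rcons_cons => /andP[cC _] /rcons_inj[_ e]; split.
have wf2 : wf (rgt a') (lft a') (((x, B) : block D) :: rcons bs (lft a, a :: C)) fs.
  rewrite la' -la -rcons_cons.
  have wB := wf_head wfP (b' := (x, B)) cB (erefl _).
  rewrite -rcons_cons in wB.
  apply: (wf_last (b' := (lft a, a :: C)) wB); last by rewrite /brt /= -X0E.
  by rewrite /= eqxx -X0E.
have [p1 p2] := pP; have /= [/allP_rcons[BA a'A] /allP_rcons[bsA CA]] := p1.
have pure2 : pure (((x, B) : block D) :: rcons bs (lft a, a :: C)) fs.
  by split=> //=; split=> //; apply/allP_rcons.
have w2 : a :: w' = word (((x, B) : block D) :: rcons bs (lft a, a :: C)) fs.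
  by rewrite -rcons_cons word_push ?sz // (word_obj _ X0).
rewrite [closed_value (a :: w') a'](_ : _ = closed_value (word (((x, B) : block D) :: rcons bs (lft a, a :: C)) fs) a');
  last by rewrite w2.
rewrite [closed_value (rcons w' a') a](_ : _ = closed_value (word (((x, rcons B a') : block D) :: rcons bs (X0, C)) fs) a);
  last by rewrite word_rcons.
rewrite closed_word_A //; last 2 first.
- by rewrite word_rcons; case: (word _ _).
- by rewrite word_rcons wdeg_rcons.
rewrite closed_word_A -?w2 //; last first.
  by rewrite wdeg_cons -dg; move: (wdeg w') (sdeg a) (sdeg a') => p q r; lia.
have fbs1 : fbs (((x, rcons B a').1, (x, rcons B a').2 ++ a :: (X0, C).2) :: bs) =
    (x, [seq fst_letter l | l <- B] ++ fst_letter a' :: [seq fst_letter l | l <- a :: C]) :: fbs bs.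
  by rewrite /= /fst_block /= map_cat map_rcons cat_rcons.
have fbs2 : fbs (((x, B).1, (x, B).2 ++ a' :: (lft a, a :: C).2) :: bs) =
    (x, [seq fst_letter l | l <- B] ++ fst_letter a' :: [seq fst_letter l | l <- a :: C]) :: fbs bs.
  by rewrite /= /fst_block /= map_cat.
have fbc b c : fbs (b :: rcons bs c) = fst_block b :: rcons (fbs bs) (fst_block c).
  by rewrite -map_rcons.
rewrite !fbc fbs1 fbs2 !mulrA -!sgnD; congr (_ * _); apply: eq_sgn.
rewrite word_rcons -/w' !jfst_sign_ends ?size_map // !bdeg_fst_block.
rewrite ![_.2]/= !wdeg_rcons !wdeg_cons.
have wE : wdeg w' = wdeg B + (bsdeg (fbs bs) + wdeg C) + tsum d (sfs fs).
  by rewrite wdeg_word ?fbc ?bsdeg_cons ?[size (_ :: _)]/= ?size_rcons ?sz //=; rewrite ?bsdeg_rcons !bdeg_fst_block.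
move: dg wE; move: (wdeg w') (sdeg a) (sdeg a') => r p q dg wE.
have rE : oddz r = xorb (oddz p) (xorb (oddz q) (oddz d)).
  by have -> : r = - p - q - d - 2 by [lia]; rewrite !oddzE; case: (oddz p); case: (oddz q); case: (oddz d).
have : oddz r = xorb (oddz (wdeg B)) (xorb (xorb (oddz (bsdeg (fbs bs))) (oddz (wdeg C))) (oddz (tsum d (sfs fs)))).
  by rewrite wE !oddzE; ring.
rewrite !oddzE rE => {}wE.
have -> : oddz (tsum d (sfs fs)) = xorb (xorb (oddz p) (xorb (oddz q) (oddz d))) (xorb (oddz (wdeg B)) (xorb (oddz (bsdeg (fbs bs))) (oddz (wdeg C)))).
  by rewrite wE; ring.
case: (oddz q); case: (oddz p); case: (oddz (wdeg C)); ring.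
Qed.

Lemma is_type_rcons (bs : seq (block A)) b : is_type (rcons bs b) = is_type (b :: bs).
Proof.
case: bs => [|b' bs]; first by [].
have many c s : (0 < size s)%N -> is_type (c :: s) = all (fun z : block A => chain z.1 z.2) (c :: s).
  by case: s.
rewrite rcons_cons !many ?size_rcons // [LHS]/= all_rcons [RHS]/=.
by rewrite andbCA.
Qed.

(** The functional [g] becomes the closing letter, which turns [M] by one step as in
    [rotate_FF]. *)
Lemma rotate_AF x g bs X0 C fs a :
  let w' := word (rcons bs ((X0, C) : block D)) fs in
  wf (rgt a) (lft a) (((x, [::]) : block D) :: rcons bs (X0, C)) (g :: fs) ->
  pure (((x, [::]) : block D) :: rcons bs (X0, C)) (g :: fs) -> isA a ->
  wdeg w' + sdeg g + sdeg a + d + 2 = 0 ->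
  closed_value (rcons w' g) a = sgn k (sdeg a * wdeg (rcons w' g)) * closed_value (a :: w') g.
Proof.
move=> w' wfP pP aA dg.
have sz : size fs = size bs.
  by have := wf_size wfP; rewrite /= size_rcons => -[].
have [wfh gx ax _] := wf_uncons wfP.
have {}ax : x = lft a by rewrite ax.
have [X0E cC] : X0 = rgt a /\ chain X0 C.
  case: wfh => c l _; move: c l.
  by rewrite all_rcons !map_rcons => /andP[cC _] /rcons_inj[_ e]; split.
have wf2 : wf (rgt g) (lft g) (rcons bs ((lft a, a :: C) : block D)) fs.
  rewrite gx -[blt _]/x ax.
  apply: (wf_last (b' := (lft a, a :: C)) wfh); last by rewrite /brt /= -X0E.
  by rewrite /= eqxx -X0E.
have [p1 [gF p2]] := pP; have /= [_ /allP_rcons[bsA CA]] := p1.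
have pure2 : pure (rcons bs ((lft a, a :: C) : block D)) fs.
  by split=> //=; apply/allP_rcons.
have w1 : rcons w' g = word (((x, [::]) : block D) :: rcons bs (X0, C)) (g :: fs) by rewrite /= cats1.
have w2 : a :: w' = word (rcons bs ((lft a, a :: C) : block D)) fs.
  by rewrite word_push ?sz // (word_obj _ X0).
rewrite [closed_value (a :: w') g](_ : _ = closed_value (word (rcons bs ((lft a, a :: C) : block D)) fs) g);
  last by rewrite w2.
rewrite {1}w1 closed_word_A -?w1 //; last 2 first.
- by case: (w').
- by rewrite wdeg_rcons.
rewrite closed_word_F -?w2 //; last first.
  by rewrite wdeg_cons -dg; move: (wdeg w') (sdeg a) (sdeg g) => p q r; lia.
have fbr c : fbs (rcons bs c) = rcons (fbs bs) (fst_block c) by exact: map_rcons.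
have fbs1 : fbs (((x, [::]).1, (x, [::] : seq (letter D)).2 ++ a :: (X0, C).2) :: bs) =
    fst_block ((lft a, a :: C) : block D) :: fbs bs by rewrite /= /fst_block /= ax.
rewrite fbs1 [sfs (_ :: _)]/= ucontracted_cyclic -?fbr; last first.
  rewrite -is_type_rcons -fbr; apply: (is_type_fst_block wf2).
  by rewrite -w2.
have fbc b c : fbs (b :: rcons bs c) = fst_block b :: rcons (fbs bs) (fst_block c).
  by rewrite -map_rcons.
rewrite fbc -fbr !mulrA -!sgnD; congr (_ * _); apply: eq_sgn.
rewrite jfst_sign_head tdegs_cons xtail_cons1 /jfst_sign !fbr !bdegs_rcons !psum_rcons.
rewrite !xsum_rcons ?size_map // !bdeg_fst_block ![_.2]/= sumz_rcons bsdeg_rcons bdeg_fst_block.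
have wE : wdeg w' = bsdeg (fbs bs) + wdeg C + tsum d (sfs fs).
  by rewrite wdeg_word ?size_rcons ?sz // fbr bsdeg_rcons bdeg_fst_block.
rewrite !wdeg_rcons !wdeg_cons wdeg_nil tdeg_snd -!bsdegE [size (_ :: _)]/= ?size_map.
move: dg; rewrite -/(tsum d _) ?size_map wE.
move: (sdeg a) (sdeg g) (wdeg C) (bsdeg (fbs bs)) (tsum d (sfs fs)) => p q c b t dg.
have tE : oddz t = xorb (oddz c) (xorb (oddz b) (xorb (oddz q) (xorb (oddz p) (oddz d)))).
  have -> : t = - c - b - q - p - d - 2 by lia.
  by rewrite !oddzE; ring.
rewrite !oddzE tE.
case: (oddz q); case: (oddz p); case: (oddz c); case: (oddz b); case: (oddz d); ring.
Qed.

End CyclicValues.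

Section Rotation.
Variables (k : fieldType) (d : int) (A : quiver k) (M : preCY d A).
Local Notation e := (preCY_degree d).
Local Notation D := (doubleq d A).
Local Notation fbs := (map (@fst_block k d A)).
Local Notation sfs := (map (@snd_letter k d A A idfun)).
Local Notation form := (Gamma_double d A).
Local Notation closed_value := (closed_value M).
Implicit Types (bs : seq (block D)) (fs w : seq (letter D)) (z : letter D).

Definition rotates w' l z : Prop :=
  closed_value (rcons w' l) z = sgn k (sdeg z * wdeg (rcons w' l)) * closed_value (z :: w') l.

Lemma rotates_deg w' l z : wdeg w' + sdeg l + sdeg z + d + 2 != 0 -> rotates w' l z.
Proof.
move=> H; have z1 : closed_value (rcons w' l) z = 0.
  by apply/eqP/negPn/negP => /closed_deg; rewrite wdeg_rcons => E; rewrite E eqxx in H.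
have z2 : closed_value (z :: w') l = 0.
  apply/eqP/negPn/negP => /closed_deg; rewrite wdeg_cons => E; move/eqP: H; apply.
  by rewrite -E; move: (wdeg w') (sdeg l) (sdeg z) => p q r; lia.
by rewrite /rotates z1 z2 mulr0.
Qed.

(** The cases are distinguished by the summands of the two letters at the closing
    point. A word with letters in [A] only, closed by an element of [A], gives [0]
    on both sides. *)
Lemma rotates_pure bs fs w' l z : word bs fs = rcons w' l ->
  wf (rgt z) (lft z) bs fs -> pure bs fs -> isA z \/ isF z -> rotates w' l z.
Proof.
move=> wE wfP pP zP.
have [dg|] := eqVneq (wdeg w' + sdeg l + sdeg z + d + 2) 0; last exact: rotates_deg.
have sz := wf_size wfP.
case: bs wfP pP wE sz => [//|[x b] bs] wfP pP wE [sz].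
case/lastP: b wfP pP wE => [|B a] wfP pP wE.
  case: fs wfP pP wE sz => [|g fs] wfP pP; first by case: (w').
  rewrite /= cats1 => /rcons_inj[ew el] [szb]; rewrite -{}ew -{}el in dg *.
  case: zP => zP; last first.
    have [wf1 gx zx _] := wf_uncons wfP.
    have rg : rgt g = lft z by rewrite gx zx.
    have pP1 : pure bs fs by case: pP => -[_ p1] [_ p2].
    have gF : isF g by case: pP => _ [].
    exact: (rotate_FF M rg wf1 pP1 zP gF dg).
  case/lastP: bs szb wfP pP dg => [//|bs [X0 C]] szb wfP pP dg.
  exact: (rotate_AF M wfP pP zP dg).
rewrite word_rcons in wE; have [ew el] := rcons_inj wE; move: dg; rewrite -{}ew -{}el => dg.
move=> {wE}; rewrite /rotates.
case: zP => zP; last exact: (rotate_FA M wfP pP zP dg).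
case/lastP: bs sz wfP pP dg => [|bs [X0 C]] sz wfP pP dg; last exact: (rotate_AA M wfP pP zP dg).
have fs0 : fs = [::] by case: (fs) sz.
rewrite fs0 in wfP pP *.
have cB : chain x B /\ lft a = brt ((x, B) : block D).
  case: wfP => /= /andP[+ _] _ _; rewrite -cats1 chain_cat /= andbT => /andP[cB /eqP la].
  by split.
have la : lft z = rgt a by rewrite (wf_eq wfP) /brt /= map_rcons last_rcons.
have zx : rgt z = x by case: wfP => _ [].
have p1 : allP isA (rcons B a) by case: pP => -[].
have p2 : allP isA B /\ isA a by move/allP_rcons: p1.
have -> : closed_value (rcons (word [:: ((x, B) : block D)] [::]) a) z = 0.
  apply: (@closed_word1 _ _ _ _ (x, rcons B a)) => //=; first by case: (B).
rewrite [closed_value (z :: _) a](_ : _ = 0) ?mulr0 //.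
apply: (@closed_word1 _ _ _ _ (lft z, z :: B)) => //=; first exact: p2.2.
  split=> //=; rewrite ?eqxx /= ?andbT ?la ?zx; first by exact: cB.1.
    by [].
  by rewrite cB.2 /brt /= zx.
by split=> //=; split=> //; split=> //; exact: p2.1.
Qed.

Lemma closed_linear w : letter_linear (closed_value w).
Proof. by move=> x y i c a b; apply: form_linear2. Qed.

Lemma closed_multilinear z : multilinear (fun w => closed_value w z).
Proof.
move=> l r x y i c a b; rewrite /closed_value jmap_multilinear.
rewrite (wdeg_letter l r (c *: a + b) b) (wdeg_letter l r a b).
exact: form_linear1.
Qed.

Lemma sub_comb (s c : k) (p q p' q' : k^o) :
  c *: p + q - s * (c *: p' + q') = c *: (p - s * p' : k^o) + (q - s * q').
Proof.
by rewrite -![_ *: _]/(_ * _ : k) !mulrDr opprD addrACA mulrN (mulrCA s).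
Qed.

Lemma rotates_all w' l z : chain (rgt z) (rcons w' l) ->
  last (rgt z) [seq rgt u | u <- rcons w' l] = lft z -> rotates w' l z.
Proof.
pose F z K g : k^o := closed_value (rcons K g) z - sgn k (sdeg z * wdeg (rcons K g)) * closed_value (z :: K) g.
move=> cw lw; apply/eqP; rewrite -subr_eq0; apply/eqP; rewrite -/(F z w' l).
have F_multilinear z' : multilinear (fun v => if v is h :: t then F z' (belast h t) (last h t) else 0).
  apply: multilinear_last => [K|g].
    move=> x y i c a b; rewrite /F -!cats1 (closed_multilinear _ K [::]).
    rewrite closed_linear !(wdeg_letter _ _ (c *: a + b) a) !(wdeg_letter _ _ b a).
    exact: sub_comb.
  move=> l0 r0 x y i c a b; rewrite /F !rcons_cat !rcons_cons (closed_multilinear z').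
  rewrite -!(cat_cons z') (closed_multilinear g).
  rewrite !(wdeg_letter _ _ (c *: a + b) a) !(wdeg_letter _ _ b a).
  exact: sub_comb.
have main z' : lft z' = lft z -> rgt z' = rgt z -> isA z' \/ isF z' -> F z' w' l = 0.
  move=> el er zP.
  pose mu v := if v is h :: t then F z' (belast h t) (last h t) else 0.
  have muE K g : mu (rcons K g) = F z' K g.
    by case: K => [//|h t]; rewrite /= belast_rcons last_rcons.
  rewrite -muE; apply: (pure_zero (F_multilinear z') cw lw) => bs fs wfP pP sh.
  case wE: (word bs fs) => [|h t] //; rewrite -/(mu (h :: t)) lastI muE.
  by rewrite /F (@rotates_pure bs fs (belast h t) (last h t) z') ?subrr // ?el ?er // -lastI.
have -> : z = @Letter k D (lft z) (rgt z) (ldeg z) (1 *: ((lval z).1, 0) + (0, (lval z).2)).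
  case: z {cw lw main} => x y i [a f] /=; congr (@Letter k D x y i _).
  by rewrite scale1r; congr pair; rewrite /= ?addr0 ?add0r.
have FD x y i c (a b : D x y i) : F (Letter (c *: a + b)) w' l = c *: F (Letter a) w' l + F (Letter b) w' l.
  rewrite /F closed_linear (closed_multilinear l [::]).
  exact: sub_comb.
by rewrite FD !main //; [rewrite scaler0 addr0|right|left].
Qed.

Lemma belast_joint (Q : quiver k) (h z : letter Q) t : composable (h :: t) -> rgt z = lft h ->
  rgt (last z (belast h t)) = lft (last h t).
Proof.
case/lastP: t => [//|t l] /= + _; rewrite belast_rcons last_rcons /= -cats1 chain_cat.
by case/andP=> _ /= /andP[/eqP -> _]; rewrite last_map.
Qed.

Lemma composable_chain (Q : quiver k) (h : letter Q) t :
  composable (h :: t) = chain (lft h) (h :: t).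
Proof. by rewrite /= eqxx. Qed.

Lemma last_rgt (Q : quiver k) x (h : letter Q) t : last x [seq rgt u | u <- h :: t] = rgt (last h t).
Proof. by rewrite /= last_map. Qed.

Lemma jmap_cyclic : almost_cyclic (jmap M : operation D D) form.
Proof.
move=> h t z ch lz rz.
have := @rotates_all (belast h t) (last h t) z.
rewrite -lastI last_rgt rz -composable_chain lz => /(_ ch (erefl _)).
rewrite /rotates -lastI /closed_value => H.
rewrite (@outE _ _ _ h t (rgt z) (lft z) (wdeg (h :: t) + 2)) //; last by rewrite -addrA.
rewrite H (@outE _ _ _ z (belast h t) (rgt (last h t)) (lft (last h t)) (wdeg (z :: belast h t) + 2)) //.
  exact: belast_joint.
by rewrite -addrA.
Qed.

End Rotation.

(** * The full Stasheff identity, by rotation *)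

Section StasheffIdentity.
Variables (k : fieldType) (d : int) (A : quiver k) (M : preCY d A).
Local Notation e := (preCY_degree d).
Local Notation D := (doubleq d A).
Local Notation fbs := (map (@fst_block k d A)).
Local Notation sfs := (map (@snd_letter k d A A idfun)).
Local Notation form := (Gamma_double d A).
Local Notation closed_value := (closed_value M).
Local Notation sm := (jmap M : operation D D).
Implicit Types (bs : seq (block D)) (fs u v w : seq (letter D)) (l z : letter D).

Lemma jmap_degree_word X Y bs fs i : wf X Y bs fs -> pure bs fs -> word bs fs <> [::] ->
  i != wdeg (word bs fs) + 2 -> jmap M (word bs fs) X Y i = 0.
Proof.
move=> wfP pP w0 iN; rewrite (jmap_word _ _ _ _ wfP) //.
have sz := wf_size wfP; rewrite wdeg_word // in iN.
have j1 : jfst M (fbs bs) (sfs fs) X Y i = 0.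
  rewrite jfstE ?size_map //.
  have [-> |/ucontracted_last_deg E] := eqVneq (ucontracted_last M (fbs bs) (sfs fs) X Y i) 0; first by rewrite scaler0.
  by rewrite E eqxx in iN.
have j2 : jsnd M (fbs bs) (sfs fs) X Y i = 0.
  case: bs {wfP pP w0 j1} iN sz => [//|b1 bs] iN [sz].
  case/lastP: bs iN sz => [|mid bn] iN sz; first exact: jsnd1.
  have fE : fbs (b1 :: rcons mid bn) = fst_block b1 :: rcons (fbs mid) (fst_block bn) by rewrite -map_rcons.
  apply: dualP => b; rewrite fE in iN *; rewrite jsndE; last first.
    by rewrite -map_rcons !size_map sz.
  set c := ucontracted _ _ _; have [-> |/ucontracted_deg E] := eqVneq c 0; first by rewrite mulr0.
  case/eqP: iN; move: E; rewrite !bsdeg_cons bsdeg_rcons /bdeg.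
  rewrite wdeg_cat wdeg_cons /sdeg /= /preCY_degree.
  by move: (wdeg _) (wdeg _) (bsdeg _) (tsum _ _) => p q r s; lia.
by rewrite /jpair j1 j2.
Qed.

Lemma jmap_degree X Y h t i : chain X (h :: t) -> last X [seq rgt l | l <- h :: t] = Y ->
  i != wdeg (h :: t) + 2 -> jmap M (h :: t) X Y i = 0.
Proof.
move=> cw lw iN; apply: (pure_zero (jmap_multilinear M X Y i) cw lw) => bs fs wfP pP sh.
have dE : wdeg (word bs fs) = wdeg (h :: t).
  have E w : wdeg w = \sum_(p <- map (@shape k D) w) (p.2 - 1) by rewrite big_map.
  by rewrite !E sh.
apply: (jmap_degree_word wfP pP); last by rewrite dE.
by move=> w0; rewrite w0 in sh.
Qed.

Lemma jmap_homogeneous : homogeneous (R := D) idfun 1 sm.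
Proof.
split=> [X Y i|]; first exact: (jmap_multilinear M X Y i).
move=> h t i; rewrite composable_chain => ch iN; apply: jmap_degree => //.
  exact: last_rgt.
by rewrite -addrA in iN.
Qed.

Definition output_letter w x y : letter D := @Letter k D x y (wdeg w + 2) (jmap M w x y (wdeg w + 2)).

Lemma out_output_letter h t : out idfun 1 sm h t = output_letter (h :: t) (lft h) (rgt (last h t)).
Proof. by rewrite (@outE _ _ _ h t (lft h) (rgt (last h t)) (wdeg (h :: t) + 2)) // -addrA. Qed.

(** The form applied to one term of the Stasheff identity and to a letter closing up
    the word. *)
Definition nested_term w1 w2 w3 z : k^o :=
  if w2 is [::] then 0 else
  let x := last (rgt z) [seq rgt l | l <- w1] in
  sgn k (wdeg w1) * closed_value (w1 ++ output_letter w2 x (last x [seq rgt l | l <- w2]) :: w3) z.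

(** The form applied to the whole Stasheff sum: a family of scalars which turns the
    identity into a statement about closed words, where rotations make sense. *)
Definition closed_stasheff w z : k^o := split_sum (fun u w3 => split_sum (fun w1 w2 => nested_term w1 w2 w3 z) u) w.

Lemma form_scale c (X Y : obj D) n (a : D X Y n) z : form (Letter (c *: a)) z = c * form (Letter a) z.
Proof.
have := form_linear1 (fun x y i => (idfun : {linear A x y i -> A x y i})) z c a 0.
rewrite addr0 => E; rewrite /Gamma_double E.
by rewrite (letter_linear0 _ _ _ (form_linear1 _ z)) addr0.
Qed.

Lemma insertions_closed_stasheff w z : chain (rgt z) w -> last (rgt z) [seq rgt l | l <- w] = lft z ->
  form (@Letter k D _ _ (wdeg w + 3) (insertions sm sm w (rgt z) (lft z) (wdeg w + 3))) z = closed_stasheff w z.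
Proof.
move=> cw lw; rewrite insertionsE /closed_stasheff.
pose h (a : D (rgt z) (lft z) (wdeg w + 3)) : k^o := form (Letter a) z.
have hD : {morph h : a b / a + b}.
  move=> a b; rewrite /h -[a]scale1r.
  by rewrite /Gamma_double form_linear1 !scale1r.
rewrite -/(h _) (split_sum_raddf _ _ hD); apply: split_sum_ext => u w3 uw.
rewrite (split_sum_raddf _ _ hD); apply: split_sum_ext => w1 w2 ew.
case: w2 ew => [|l w2] ew.
  by rewrite /h /= /Gamma_double (letter_linear0 _ _ _ (form_linear1 _ z)).
rewrite /h /insertion_term form_scale out_output_letter /nested_term; congr (_ * _).
move: cw; rewrite -uw -ew !chain_cat /= => /andP[/andP[_ /andP[/eqP <- _]] _].
rewrite (last_map (@rgt k D)) /closed_value.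
set W := w1 ++ output_letter _ _ _ :: w3.
have -> : wdeg ((w1 ++ l :: w2) ++ w3) + 3 = wdeg W + 2.
  rewrite /W !wdeg_cat [wdeg (_ :: w3)]wdeg_cons /sdeg [ldeg _]/=.
  by move: (wdeg w1) (wdeg (l :: w2)) (wdeg w3) => p q r; lia.
by [].
Qed.

(** If the last letter lies outside the inner operation, it is moved to the front by
    the cyclicity of the outer operation. *)
Lemma nested_rotate1 w1 w2 w3 l z :
  chain (rgt z) (w1 ++ w2 ++ rcons w3 l) ->
  last (rgt z) [seq rgt l | l <- w1 ++ w2 ++ rcons w3 l] = lft z ->
  nested_term w1 w2 (rcons w3 l) z =
  sgn k (sdeg z * wdeg (w1 ++ w2 ++ rcons w3 l)) * nested_term (z :: w1) w2 w3 l.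
Proof.
case: w2 => [|h t] cw lw; rewrite /nested_term ?mulr0 //.
rewrite [last _ [seq _ | _ <- z :: w1]]/=.
set x := last (rgt z) _; set y := last x _; set o := output_letter _ x y.
move: cw; rewrite !chain_cat -/x -/y => /and3P[c1 c2 c3].
rewrite -rcons_cons -rcons_cat rotates_all; last 2 first.
- by rewrite rcons_cat chain_cat c1 /= -/x eqxx.
- by rewrite -lw rcons_cat !map_cat !last_cat /= !map_rcons !last_rcons.
rewrite !mulrA -!sgnD; congr (_ * _); apply: eq_sgn.
rewrite !wdeg_rcons !wdeg_cat !wdeg_cons !wdeg_rcons /o {2}/sdeg [ldeg _]/= wdeg_cons.
move: (sdeg z) (sdeg h) (wdeg t) (sdeg l) (wdeg w1) (wdeg w3) => p q r s t1 t3.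
by rewrite !oddzE; case: (oddz p); ring.
Qed.

(** If the last letter is an input of the inner operation, exchanging the arguments
    of the form makes the inner operation the outer one, whose cyclicity then moves
    that letter. This uses cyclicity twice and antisymmetry once. *)
Lemma nested_rotate2 w1 w2 l z :
  chain (rgt z) (w1 ++ rcons w2 l) -> rgt l = lft z ->
  nested_term w1 (rcons w2 l) [::] z =
  sgn k (sdeg z * wdeg (w1 ++ rcons w2 l)) * nested_term [::] (z :: w1) w2 l.
Proof.
move=> cw lw; rewrite /nested_term.
have -> T (a b : T) : (if rcons w2 l is [::] then a else b) = b by case: (w2).
set x := last (rgt z) _; rewrite map_rcons last_rcons [last _ _]/= [last _ _]/= -/x.
move: cw; rewrite chain_cat -/x => /andP[c1 c2].
set o := output_letter _ x _; set p := output_letter _ _ x.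
rewrite cats1 rotates_all; last 2 first.
- by rewrite -cats1 chain_cat c1 /= -/x eqxx.
- by rewrite map_rcons last_rcons.
have -> : closed_value (z :: w1) o = - (sgn k (sdeg o * sdeg p) * closed_value (rcons w2 l) p).
  exact: (form_antisym (fun x y i => (idfun : {linear A x y i -> A x y i})) o p).
rewrite rotates_all ?map_rcons ?last_rcons //.
rewrite -mulN1r -[-1]/(sgn k 1) !mulrA -!sgnD; congr (_ * _); apply: eq_sgn.
have oE : sdeg o = wdeg w2 + sdeg l + 1.
  by rewrite {1}/sdeg /= wdeg_rcons; move: (wdeg w2) (sdeg l) => q r; lia.
have pE : sdeg p = sdeg z + wdeg w1 + 1.
  by rewrite {1}/sdeg /= wdeg_cons; move: (wdeg w1) (sdeg z) => q r; lia.
rewrite !wdeg_rcons !wdeg_cat wdeg_rcons wdeg_nil oE pE.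
move: (sdeg z) (sdeg l) (wdeg w1) (wdeg w2) => q s t1 t3.
by rewrite !oddzE; case: (oddz q); case: (oddz s); case: (oddz t1); case: (oddz t3).
Qed.

(** A rotation permutes the terms. Those whose inner operation does not reach the
    last letter go to those whose inner operation does not contain the new first
    letter; those whose inner operation ends at the last letter go to those whose
    inner operation starts at the new first letter, and covers the letters that the
    old one did not cover. *)
Lemma closed_stasheff_rotate w' l z : chain (rgt z) (rcons w' l) -> rgt l = lft z ->
  closed_stasheff (rcons w' l) z = sgn k (sdeg z * wdeg (rcons w' l)) * closed_stasheff (z :: w') l.
Proof.
move=> cw lw; rewrite /closed_stasheff split_sum_rcons [RHS]/= add0r split_sum_rcons [nested_term (rcons w' l) _ _ _]/= addr0.
rewrite -[X in _ = _ * X]split_sumD mulrDr addrC.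
pose h (a : k^o) : k^o := sgn k (sdeg z * wdeg (rcons w' l)) * a.
have hD : {morph h : a b / a + b} by move=> a b; rewrite /h mulrDr.
rewrite -!/(h _) !(split_sum_raddf _ _ hD); congr (_ + _); apply: split_sum_ext => u w3 uw.
  rewrite nested_rotate2 -?rcons_cat ?uw //.
rewrite (split_sum_raddf _ _ hD); apply: split_sum_ext => w1 w2 ew.
by rewrite nested_rotate1 ?catA ?ew -?rcons_cat ?uw // map_rcons last_rcons.
Qed.

Lemma closed_stasheff_linear w : letter_linear (closed_stasheff w).
Proof.
move=> x y i c a b; apply: split_sum_linear => u w3; apply: split_sum_linear => w1 [|h t].
  by rewrite /= scaler0 addr0.
by rewrite /nested_term closed_linear mulr_scale.
Qed.

(** A functional only sees the component of the Stasheff sum in [A]. *)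
Lemma closed_stasheff_F w z : isF z -> chain (rgt z) w ->
  last (rgt z) [seq rgt l | l <- w] = lft z -> closed_stasheff w z = 0.
Proof.
move=> zF cw lw; rewrite -insertions_closed_stasheff // /Gamma_double /natural_form /phi_pairing.
rewrite [X in _ * X - _]pairing_zero_r ?mulr0 ?sub0r //.
rewrite pairing_zero_r ?mulr0 ?oppr0 //=.
case: w cw lw => [|h t] cw lw; last exact: insertions_first.
by rewrite /insertions big_geq.
Qed.

Lemma output_letter_A w : allP isA w -> w <> [::] -> forall x y, chain x w ->
  last x [seq rgt l | l <- w] = y -> isA (output_letter w x y).
Proof.
move=> wA w0 x y cw lw; rewrite /isA [_.2]/=.
have wfP : wf x y [:: ((x, w) : block D)] [::] by split; rewrite /= ?cw // -lw.
have pP : pure [:: ((x, w) : block D)] [::] by [].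
have := jmap_word M x y (wdeg w + 2) wfP pP; rewrite [word _ _]/= => -> //.
exact: jsnd1.
Qed.

(** Operations on elements of [A] have no dual component, and two elements of [A]
    pair to zero. *)
Lemma closed_stasheff_A w z : isA z -> allP isA w -> chain (rgt z) w ->
  last (rgt z) [seq rgt l | l <- w] = lft z -> closed_stasheff w z = 0.
Proof.
move=> zA wA cw lw; rewrite /closed_stasheff.
have spl0 T (s : seq T) : split_sum (fun _ _ => 0 : k^o) s = 0.
  by elim: s => //= x s ->; rewrite addr0.
rewrite -(spl0 _ w); apply: split_sum_ext => u w3 uw; rewrite -(spl0 _ u).
apply: split_sum_ext => w1 w2 ew; rewrite /nested_term; case: w2 ew => [//|h t] ew.
move: wA cw lw; rewrite -uw -ew !allP_cat !chain_cat !map_cat !last_cat.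
set x := last (rgt z) _; set y := last x _ => -[[A1 A2] A3] /andP[/andP[c1 c2] c3] lw.
have oA : isA (output_letter (h :: t) x y) by apply: output_letter_A.
rewrite [closed_value _ _](_ : _ = 0) ?mulr0 //.
apply: (@closed_word1 _ _ _ _ (rgt z, w1 ++ output_letter (h :: t) x y :: w3)) => //.
- by split; rewrite /= ?/brt /= ?map_cat ?last_cat ?chain_cat ?c1 /= ?eqxx ?c3 ?lw.
- by split=> //; split=> //; apply/allP_cat.
- by case: (w1).
Qed.

(** The closing letter splits into two components. A functional gives zero. An
    element of [A] is rotated to the front of the word, where the letters of [A]
    accumulate in [v], until all the letters of the closed word lie in [A]. *)
Lemma closed_stasheff0 u v z : allP isA v -> chain (rgt z) (v ++ u) ->
  last (rgt z) [seq rgt l | l <- v ++ u] = lft z -> closed_stasheff (v ++ u) z = 0.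
Proof.
elim/last_ind: u v z => [|u l IH] v z vA cw lw.
all: have zE : z = @Letter k D (lft z) (rgt z) (ldeg z) (1 *: ((lval z).1, 0) + (0, (lval z).2)).
1,3: case: z {cw lw} => x y i [a f] /=; congr (@Letter k D x y i _);
  by rewrite scale1r; congr pair; rewrite /= ?addr0 ?add0r.
all: rewrite zE closed_stasheff_linear scale1r [X in _ + X]closed_stasheff_F ?addr0 //.
  by rewrite cats0 in cw lw *; apply: closed_stasheff_A.
set z' := Letter _.
have [c0 l1] : chain (rgt z) (v ++ u) /\ last (rgt z) [seq rgt t | t <- v ++ u] = lft l.
  by move: cw; rewrite -rcons_cat -cats1 chain_cat /= => /andP[cw /andP[/eqP -> _]].
have l2 : rgt l = lft z by rewrite -lw -rcons_cat map_rcons last_rcons.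
rewrite -rcons_cat in cw *; rewrite closed_stasheff_rotate // -cat_cons IH ?mulr0 //=.
by rewrite l2 eqxx c0.
Qed.

(** The dual component of the Stasheff sum is tested on elements of [A], used as
    closing letters. *)
Lemma jmap_Ainf : Ainf_structure sm.
Proof.
split; first exact: jmap_homogeneous.
move=> h t n; rewrite composable_chain => ch; set w := h :: t.
set X := lft h; set Y := rgt (last h t).
have lw : last X [seq rgt l | l <- w] = Y by exact: last_rgt.
(* In all other degrees the sum vanishes by homogeneity. *)
have [nE|nN] := eqVneq n (wdeg w + 3); last first.
  rewrite insertionsE.
  have spl0 T (s : seq T) : split_sum (fun _ _ => 0 : D X Y n) s = 0.
    by elim: s => //= x s ->; rewrite addr0.
  rewrite -(spl0 _ w); apply: split_sum_ext => u w3 uw; rewrite -(spl0 _ u).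
  apply: split_sum_ext => w1 [//|h' t'] ew; rewrite /insertion_term out_output_letter.
  set o := output_letter _ _ _.
  move: ch lw nN; rewrite -[h :: t]/w -uw -ew !chain_cat !map_cat !last_cat.
  rewrite [chain _ (h' :: t')]/= => /andP[/andP[c1 /andP[/eqP l1 c2]] c3] l2 nN.
  have co : chain X (w1 ++ o :: w3).
    by rewrite chain_cat c1 /= -l1 eqxx -(last_map (@rgt k D)).
  have lo : last X [seq rgt l | l <- w1 ++ o :: w3] = Y.
    by rewrite map_cat last_cat /= -(last_map (@rgt k D)).
  have no : n != wdeg (w1 ++ o :: w3) + 2.
    apply: contra nN => /eqP ->; apply/eqP.
    rewrite !wdeg_cat [wdeg (o :: w3)]wdeg_cons /sdeg [ldeg _]/=.
    by move: (wdeg w1) (wdeg (h' :: t')) (wdeg w3) => p q r; lia.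
  move: co lo no; case: (w1 ++ o :: w3) => [|h1 t1] co lo no; first by rewrite scaler0.
  by rewrite jmap_degree ?scaler0.
rewrite [LHS]surjective_pairing -[RHS]/(0, 0); congr pair; first exact: insertions_first.
apply: dualP => b.
pose z := @Letter k D Y X (- (n + (d - 1))) (b, 0).
have := @closed_stasheff0 w [::] z; rewrite /= -/w.
move=> /(_ I ch lw); rewrite -insertions_closed_stasheff //.
rewrite /Gamma_double /natural_form /phi_pairing.
rewrite [pairing (snd_letter z) _]pairing_zero_l // !mulr0 subr0 => /eqP.
rewrite mulf_eq0 (negPf (sgn_neq0 _ _)) /= => /eqP.
rewrite -nE /pairing [lmap _ _](_ : _ = @Letter k A Y X (- (n + (d - 1))) b) //.
by rewrite [proj _ _ _ _](@proj_id k A Y X (- (n + (d - 1))) b).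
Qed.

End StasheffIdentity.

(** * Transport along a strict morphism *)

Section Transport.
Variables (k : fieldType) (d : int) (A B : quiver k).
Variables (MA : preCY d A) (MB : preCY d B) (Phi : strict_morphism MA MB).
Local Notation e := (preCY_degree d).
Local Notation S := (mixedq Phi).
Local Notation lphi := (lmap (phi Phi)).
Local Notation p0 := (phi0 Phi).
Local Notation fstl := (@fst_letter k d A B p0).
Local Notation sndl := (@snd_letter k d A B p0).
Implicit Types (w fs : seq (letter S)) (bs : seq (block A)) (f : letter S).

Definition image_block (b : block A) : block B := (p0 b.1, map lphi b.2).

Lemma lmap_multilinear (W : lmodType k) (mu : seq (letter B) -> W) :
  multilinear mu -> multilinear (fun v => mu (map lphi v)).
Proof.
by move=> muP l r x y i c a b; rewrite !map_cat /= /lmap /= linearP muP.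
Qed.

(** The signs of [s_{d+1}] on both sides of the strictness condition are equal, and
    are removed here. *)
Lemma strict_tlift (W : lmodType k) (nu : seq (letter B) -> W) bs :
  multilinear nu -> is_type bs ->
  tlift (fun v => nu (map lphi v)) (MA bs) = tlift nu (MB (map image_block bs)).
Proof.
move=> nuP tP; pose mu v := tlift nu (sout_word d v).
have muP : multilinear mu.
  apply: (@multilinear_linear _ _ _ _ (tlift nu)); first exact: tlift_lin.
  exact: sout_word_multilinear.
(* The sign of [s_{d+1}] is an involution, so [mu] undoes it on either side. *)
have muE v g : mu (rcons v g) = sgn k ((d + 1) * vdeg d v) *: nu (rcons v g).
  rewrite /mu; case: v => [|h t]; rewrite /= ?belast_rcons ?tliftZ ?tlift_pure //.
rewrite -(@multi_sout _ _ _ MB _ mu nu) //; last first.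
  by move=> _ v g _; rewrite muE scalerA sgn_sq scale1r.
rewrite -(phi_strict Phi tP) (tlift_comp _ _ (tlift_lin muP)).
rewrite (@multi_sout _ _ _ MA _ _ (fun v => nu (map lphi v))) //.
- apply: (@multilinear_linear _ _ _ _ (tlift mu)); first exact: tlift_lin.
  exact: lmap_multilinear (@tpure_multilinear _ _).
- exact: lmap_multilinear.
move=> _ v g _; rewrite tlift_pure // map_rcons muE scalerA.
have -> : vdeg d (map lphi v) = vdeg d v by rewrite /vdeg big_map.
by rewrite sgn_sq scale1r.
Qed.

(** The functional composed with [Phi]. *)
Definition pull_letter (f : letter S) : letter (dualq A) := snd_letter (varphiA Phi f).

(** The hypotheses on the objects are essential: [Phi] may identify objects, so that
    the pairing over [B] can be nonzero where the one over [A] vanishes for lack of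
    composability. *)
Lemma pairing_pull (f : letter S) (l : letter A) : lft l = rgt f -> rgt l = lft f ->
  pairing (pull_letter f) l = pairing (sndl f) (lphi l).
Proof.
case: l => x y i a /= ex ey; subst.
have [ei|iN] := eqVneq i (- (ldeg f + (d - 1))).
  by subst; rewrite /pairing !proj_id.
transitivity (0 : k).
  by apply/eqP/negPn/negP => /pairing_neq0[_ _] E; case/eqP: iN; exact: E.
by apply/esym/eqP/negPn/negP => /pairing_neq0[_ _] E; case/eqP: iN; exact: E.
Qed.

Lemma ctr_pull fs (v : seq (letter A)) : [seq lft l | l <- v] = [seq rgt f | f <- fs] ->
  [seq rgt l | l <- v] = [seq lft f | f <- fs] ->
  ucontract (map pull_letter fs) v = ucontract (map sndl fs) (map lphi v).
Proof.
elim: fs v => [|f fs IH] [|l v] //= [l1 l2] [r1 r2].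
by rewrite IH // pairing_pull.
Qed.

Lemma proj_lmap X Y i (l : letter A) : lft l = X -> rgt l = Y ->
  phi Phi X Y i (proj X Y i l) = proj (p0 X) (p0 Y) i (lphi l).
Proof.
move=> <- <-; have [<-|iN] := eqVneq (ldeg l) i.
  by case: l => x y i' a; rewrite !proj_id.
rewrite (_ : proj _ _ i l = 0) ?linear0; last first.
  by apply/eqP/negPn/negP => /proj_neq0[_ _ E]; case/eqP: iN; exact: E.
rewrite (_ : proj _ _ i _ = 0) //.
by apply/eqP/negPn/negP => /proj_neq0[_ _ E]; case/eqP: iN; exact: E.
Qed.

(** The objects of the outputs of [MA] match those of the functionals, so that
    [pairing_pull] applies to each of them. *)
Lemma ucontracted_image bs fs : is_type bs -> [seq blt b | b <- bs] = [seq rgt f | f <- fs] ->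
  rot 1 [seq brt b | b <- bs] = [seq lft f | f <- fs] ->
  ucontracted MA bs (map pull_letter fs) = ucontracted MB (map image_block bs) (map sndl fs).
Proof.
move=> tP l r; rewrite /ucontracted.
rewrite -(strict_tlift (W := k^o) (nu := ucontract (map sndl fs))) //; last exact: (ucontract_multilinear d).
apply: (@multi_ext k d A MA k^o); first exact: (ucontract_multilinear d).
  by apply: lmap_multilinear; apply: (ucontract_multilinear d).
by move=> _ v [o1 o2 _]; apply: ctr_pull; rewrite ?o1 ?o2.
Qed.

Lemma ucontracted_last_image X Y bs fs i : is_type bs ->
  [seq blt b | b <- bs] = rcons [seq rgt f | f <- fs] X ->
  [seq brt b | b <- bs] = Y :: [seq lft f | f <- fs] ->
  phi Phi X Y i (ucontracted_last MA bs (map pull_letter fs) X Y i) =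
  ucontracted_last MB (map image_block bs) (map sndl fs) (p0 X) (p0 Y) i.
Proof.
move=> tP l r; rewrite /ucontracted_last (tlift_comp _ _ (linearP (phi Phi X Y i))).
rewrite -(strict_tlift (nu := fun v => ucontract_last (map sndl fs) v (p0 X) (p0 Y) i)) //; last exact: (ucontract_last_multilinear d).
apply: (@multi_ext k d A MA).
- apply: multilinear_linear; first exact: linearP.
  exact: (ucontract_last_multilinear d).
- by apply: (@lmap_multilinear _ (fun v => ucontract_last (map sndl fs) v (p0 X) (p0 Y) i)); apply: (ucontract_last_multilinear d).
move=> _ v [o1 o2 _]; rewrite l in o1; rewrite r rot1_cons in o2.
case/lastP: v o1 o2 => [|v g]; first by case: (fs).
rewrite !map_rcons => /rcons_inj[v1 g1] /rcons_inj[v2 g2].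
by rewrite !ucontract_last_rcons linearZ /= ctr_pull // proj_lmap.
Qed.

End Transport.

Section MapWords.
Variables (k : fieldType) (Q R : quiver k) (g0 : obj Q -> obj R) (g : letter Q -> letter R).
Hypothesis g_lft : forall l, lft (g l) = g0 (lft l).
Hypothesis g_rgt : forall l, rgt (g l) = g0 (rgt l).
Implicit Types (bs : seq (block Q)) (fs : seq (letter Q)).

Definition map_block (b : block Q) : block R := (g0 b.1, map g b.2).

Lemma word_map bs fs : map g (word bs fs) = word (map map_block bs) (map g fs).
Proof. by elim: bs fs => [|b bs IH] [|f fs] //=; rewrite map_cat /= IH. Qed.

Lemma chain_map x (w : seq (letter Q)) : chain x w -> chain (g0 x) (map g w).
Proof.
elim: w x => [|l w IH] x //= /andP[/eqP <- cw].
by rewrite g_lft eqxx g_rgt IH.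
Qed.

Lemma last_map_rgt x (w : seq (letter Q)) :
  last (g0 x) [seq rgt l | l <- map g w] = g0 (last x [seq rgt l | l <- w]).
Proof.
by rewrite -map_comp -[in RHS]last_map -map_comp; congr (last _ _); apply: eq_map => l /=.
Qed.

Lemma brt_map_block b : brt (map_block b) = g0 (brt b).
Proof. exact: last_map_rgt. Qed.

Lemma wf_map X Y bs fs : wf X Y bs fs -> wf (g0 X) (g0 Y) (map map_block bs) (map g fs).
Proof.
case=> c l r; split.
- rewrite all_map; apply: sub_all c => b /=; exact: chain_map.
- have -> : [seq blt b | b <- map map_block bs] = map g0 [seq blt b | b <- bs] by rewrite -!map_comp.
  by rewrite l map_rcons -!map_comp; congr rcons; apply: eq_map => f /=.
have -> : [seq brt b | b <- map map_block bs] = map g0 [seq brt b | b <- bs].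
  by rewrite -!map_comp; apply: eq_map => b; apply: brt_map_block.
by rewrite r /= -!map_comp; congr cons; apply: eq_map => f /=.
Qed.

Lemma composable_map h t : composable (h :: t) -> composable (map g (h :: t)).
Proof. by move=> /= c; rewrite g_rgt; apply: chain_map. Qed.

End MapWords.

Section Intertwine.
Variables (k : fieldType) (d : int) (A B : quiver k).
Variables (MA : preCY d A) (MB : preCY d B) (Phi : strict_morphism MA MB).
Local Notation e := (preCY_degree d).
Local Notation S := (mixedq Phi).
Local Notation DA := (doubleq d A).
Local Notation DB := (doubleq d B).
Local Notation p0 := (phi0 Phi).
Local Notation fstl := (@fst_letter k d A B p0).
Local Notation sndl := (@snd_letter k d A B p0).
Local Notation vA := (varphiA Phi).
Local Notation vB := (varphiB Phi).
Local Notation img := (map (image_block Phi)).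
Implicit Types (w fs : seq (letter S)) (bs : seq (block S)).

Definition blockA : block S -> block DA := @map_block k S DA idfun vA.
Definition blockB : block S -> block DB := @map_block k S DB p0 vB.
Definition mixed_fst_block (b : block S) : block A := (b.1, map fstl b.2).

Lemma pullback_comb x y i c (f g : dual (B (p0 x) (p0 y) i)) :
  pullback (c *: f + g) = c *: pullback f + pullback g.
Proof. exact: dualP. Qed.

Lemma varphiA_comb x y i c (a b : S x y i) :
  vA (Letter (c *: a + b)) =
  @Letter k DA x y i (c *: lval (vA (Letter a)) + lval (vA (Letter b))).
Proof.
congr (@Letter k DA x y i _).
by rewrite -[RHS]/(_, _) -pullback_comb.
Qed.

Lemma varphiB_comb x y i c (a b : S x y i) :
  vB (Letter (c *: a + b)) =
  @Letter k DB (p0 x) (p0 y) i (c *: lval (vB (Letter a)) + lval (vB (Letter b))).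
Proof.
congr (@Letter k DB (p0 x) (p0 y) i _).
by rewrite -[RHS]/(_, _) /= linearP.
Qed.

Lemma varphiA_multilinear (W : lmodType k) (mu : seq (letter DA) -> W) :
  multilinear mu -> multilinear (fun v => mu (map vA v)).
Proof.
by move=> muP l r x y i c a b; rewrite !map_cat !map_cons varphiA_comb muP.
Qed.

Lemma varphiB_multilinear (W : lmodType k) (mu : seq (letter DB) -> W) :
  multilinear mu -> multilinear (fun v => mu (map vB v)).
Proof.
by move=> muP l r x y i c a b; rewrite !map_cat !map_cons varphiB_comb muP.
Qed.

Lemma allP_map T U (P : U -> Prop) (P' : T -> Prop) (g : T -> U) s :
  (forall x, P' x -> P (g x)) -> allP P' s -> allP P (map g s).
Proof. by move=> H; elim: s => //= x s IH [/H ? /IH]. Qed.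

Lemma pure_blockA bs fs : pure bs fs -> pure (map blockA bs) (map vA fs).
Proof.
case=> p1 p2; split; last exact: allP_map p2.
apply: allP_map p1 => b; apply: allP_map => l; rewrite /isA /= => ->.
exact: dualP.
Qed.

Lemma pure_blockB bs fs : pure bs fs -> pure (map blockB bs) (map vB fs).
Proof.
case=> p1 p2; split; last first.
  by apply: allP_map p2 => l; rewrite /isF /= => ->; rewrite linear0.
by apply: allP_map p1 => b; apply: allP_map.
Qed.

Lemma fst_block_A bs : map (@fst_block k d A) (map blockA bs) = map mixed_fst_block bs.
Proof.
rewrite -map_comp; apply: eq_map => b; rewrite /= /fst_block /mixed_fst_block /=.
by rewrite -map_comp.
Qed.

Lemma fst_block_B bs : map (@fst_block k d B) (map blockB bs) = img (map mixed_fst_block bs).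
Proof.
rewrite -!map_comp; apply: eq_map => b; rewrite /= /fst_block /image_block /=.
by rewrite -!map_comp.
Qed.

Lemma snd_A fs : map (@snd_letter k d A A idfun) (map vA fs) = map (@pull_letter _ _ _ _ _ _ Phi) fs.
Proof. by rewrite -map_comp. Qed.

Lemma snd_B fs : map (@snd_letter k d B B idfun) (map vB fs) = map sndl fs.
Proof. by rewrite -map_comp. Qed.

Lemma bdeg_image (b : block A) : bdeg (image_block Phi b) = bdeg b.
Proof. by rewrite /bdeg /wdeg big_map. Qed.

Lemma bsdeg_image (s : seq (block A)) : bsdeg (img s) = bsdeg s.
Proof. by rewrite /bsdeg big_map; apply: eq_bigr => b _; apply: bdeg_image. Qed.

Lemma jfst_sign_image (s : seq (block A)) fs :
  jfst_sign d (img s) (map sndl fs) = jfst_sign d s (map (@pull_letter _ _ _ _ _ _ Phi) fs).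
Proof.
rewrite /jfst_sign !size_map /tdegs /bdegs -!map_comp.
have -> : [seq (@bdeg k B \o image_block Phi) i | i <- s] = [seq bdeg b | b <- s].
  by apply: eq_map => b; apply: bdeg_image.
by [].
Qed.

Lemma jmap_wordA X Y bs fs x y i : wf X Y bs fs -> pure bs fs -> word bs fs <> [::] ->
  jmap MA (map vA (word bs fs)) x y i =
  jpair MA (map mixed_fst_block bs) (map (@pull_letter _ _ _ _ _ _ Phi) fs) x y i.
Proof.
move=> wfP pP w0; have wfA := @wf_map k S DA idfun vA (fun _ => erefl) (fun _ => erefl) _ _ _ _ wfP.
rewrite (@word_map k S DA idfun) (jmap_word _ _ _ _ wfA) -?(@word_map k S DA idfun).
- by rewrite fst_block_A snd_A.
- exact: pure_blockA.
- by case: (word _ _) w0.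
Qed.

Lemma jmap_wordB X Y bs fs x y i : wf X Y bs fs -> pure bs fs -> word bs fs <> [::] ->
  jmap MB (map vB (word bs fs)) x y i =
  jpair MB (img (map mixed_fst_block bs)) (map sndl fs) x y i.
Proof.
move=> wfP pP w0; have wfB := @wf_map k S DB p0 vB (fun _ => erefl) (fun _ => erefl) _ _ _ _ wfP.
rewrite (@word_map k S DB p0) (jmap_word _ _ _ _ wfB) -?(@word_map k S DB p0).
- by rewrite fst_block_B snd_B.
- exact: pure_blockB.
- by case: (word _ _) w0.
Qed.

Lemma wf_mixed_fst_block X Y bs fs : wf X Y bs fs -> word bs fs <> [::] ->
  [/\ is_type (map mixed_fst_block bs), [seq blt b | b <- map mixed_fst_block bs] = rcons [seq rgt f | f <- fs] X &
   [seq brt b | b <- map mixed_fst_block bs] = Y :: [seq lft f | f <- fs]].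
Proof.
move=> wfP w0; have wfA := @wf_map k S DA idfun vA (fun _ => erefl) (fun _ => erefl) _ _ _ _ wfP.
split.
- rewrite -fst_block_A; apply: (is_type_fst_block wfA).
  by rewrite -word_map; case: (word _ _) w0.
- by case: wfP => _ <- _; rewrite -map_comp.
case: wfP => _ _ <-; rewrite -map_comp; apply: eq_map => b.
by rewrite /brt /= -map_comp.
Qed.

Lemma sub_lincomb (V : lmodType k) c (p q p' q' : V) :
  c *: p + q - (c *: p' + q') = c *: (p - p') + (q - q').
Proof. by rewrite scalerBr opprD addrACA. Qed.

(** Both sides contract the same functionals of [B]: with the images of the outputs
    on the right, and after composition with [Phi] on the left. *)
Lemma jmap_first X Y w i : chain X w -> last X [seq rgt l | l <- w] = Y ->
  phi Phi X Y i (jmap MA (map vA w) X Y i).1 = (jmap MB (map vB w) (p0 X) (p0 Y) i).1.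
Proof.
move=> cw lw; apply/eqP; rewrite -subr_eq0; apply/eqP.
pose mu u := phi Phi X Y i (jmap MA (map vA u) X Y i).1 - (jmap MB (map vB u) (p0 X) (p0 Y) i).1.
rewrite -/(mu w).
have muP : multilinear mu.
  move=> l r x y j c a b; rewrite /mu.
  rewrite (varphiA_multilinear (jmap_multilinear MA X Y i)).
  rewrite (varphiB_multilinear (jmap_multilinear MB (p0 X) (p0 Y) i)).
  rewrite -[(_ + _ : DA X Y i).1]/(c *: _.1 + _.1) -[(_ + _ : DB _ _ _).1]/(c *: _.1 + _.1).
  rewrite linearP; exact: sub_lincomb.
apply: (pure_zero muP cw lw) => bs fs wfP pP sh.
case wE : (word bs fs) => [|l r]; first by rewrite /mu /= linear0 subrr.
have w0 : word bs fs <> [::] by rewrite wE.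
rewrite -wE /mu (jmap_wordA _ _ _ wfP) // (jmap_wordB _ _ _ wfP) //.
have [tP l1 l2] := wf_mixed_fst_block wfP w0; have sz := wf_size wfP.
rewrite [(jpair _ _ _ _ _ _).1]/= [(jpair MB _ _ _ _ _).1]/= !jfstE ?size_map //.
by rewrite linearZ /= (ucontracted_last_image _ tP l1 l2) jfst_sign_image subrr.
Qed.

(** For an element [b] of [A], the value of the left-hand side at [b] closes up the
    word over [B] with the image of [b]. *)
Lemma jmap_second X Y w i : chain X w -> last X [seq rgt l | l <- w] = Y ->
  pullback (jmap MB (map vB w) (p0 X) (p0 Y) i).2 = (jmap MA (map vA w) X Y i).2.
Proof.
move=> cw lw; apply/eqP; rewrite -subr_eq0; apply/eqP.
pose mu u : dualq A X Y (i + (d - 1)) :=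
  pullback (jmap MB (map vB u) (p0 X) (p0 Y) i).2 - (jmap MA (map vA u) X Y i).2.
rewrite -/(mu w).
have muP : multilinear mu.
  move=> l r x y j c a b; rewrite /mu.
  rewrite (varphiA_multilinear (jmap_multilinear MA X Y i)).
  rewrite (varphiB_multilinear (jmap_multilinear MB (p0 X) (p0 Y) i)).
  rewrite -[(_ + _ : DA X Y i).2]/(c *: _.2 + _.2) -[(_ + _ : DB _ _ _).2]/(c *: _.2 + _.2).
  rewrite pullback_comb; exact: sub_lincomb.
have pull0 (f : dual (B (p0 Y) (p0 X) (- (i + (d - 1))))) : f = 0 -> pullback f = 0 by move=> ->; apply: dualP.
apply: (pure_zero muP cw lw) => bs fs wfP pP sh.
case wE : (word bs fs) => [|l r]; first by rewrite /mu pull0 ?subrr.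
have w0 : word bs fs <> [::] by rewrite wE.
rewrite -wE /mu (jmap_wordA _ _ _ wfP) // (jmap_wordB _ _ _ wfP) //.
have sz := wf_size wfP; rewrite /jpair ![(_, _).2]/=.
case: bs wfP pP sh wE w0 sz => [//|b1 bs] wfP pP sh wE w0 [sz].
case/lastP: bs wfP pP sh wE w0 sz => [|mid bn] wfP pP sh wE w0 sz.
  by rewrite !jsnd1 pull0 ?subrr.
apply/eqP; rewrite subr_eq0; apply/eqP; apply: dualP => b.
have sE : map mixed_fst_block (b1 :: rcons mid bn) = mixed_fst_block b1 :: rcons (map mixed_fst_block mid) (mixed_fst_block bn).
  by rewrite -map_rcons.
have sE' : img (map mixed_fst_block (b1 :: rcons mid bn)) =
    image_block Phi (mixed_fst_block b1) :: rcons (img (map mixed_fst_block mid)) (image_block Phi (mixed_fst_block bn)).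
  by rewrite sE /= map_rcons.
have [tP l1 l2] := wf_mixed_fst_block wfP w0.
rewrite -[LHS]/((jsnd MB _ _ _ _ _ : dual _) (phi Phi _ _ _ b)).
rewrite sE' jsndE; last by rewrite size_rcons !size_map -sz size_rcons.
rewrite -sE'.
rewrite jfst_sign_image sE jsndE; last by rewrite size_rcons !size_map -sz size_rcons.
pose m : block A := ((mixed_fst_block b1).1, (mixed_fst_block b1).2 ++ Letter b :: (mixed_fst_block bn).2).
rewrite bsdeg_image bdeg_image; congr (_ * _).
have -> : ((image_block Phi (mixed_fst_block b1)).1, (image_block Phi (mixed_fst_block b1)).2 ++
      @Letter k B (p0 Y) (p0 X) (- (i + (d - 1))) (phi Phi Y X (- (i + (d - 1))) b)
      :: (image_block Phi (mixed_fst_block bn)).2) = image_block Phi m.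
  by rewrite /image_block /= map_cat.
rewrite -[_ :: img _]/(img (m :: map mixed_fst_block mid)); apply/esym.
move: l1; rewrite sE /= map_rcons => l1.
move: l2; rewrite sE /= map_rcons => -[l2 l3].
have [l1a l1b] := rcons_inj (l1 : rcons (_ :: _) _ = _).
(* The element [b] joins the first and the last block into [m]; the remaining
   blocks give the type on which both categories are evaluated. *)
have mr : brt m = brt (mixed_fst_block bn).
  by rewrite /brt /m /= map_cat last_cat /= -/(brt _) l1b.
apply: ucontracted_image.
- have : all (fun z : block A => chain z.1 z.2) (map mixed_fst_block (b1 :: rcons mid bn)).
    by move: tP; rewrite sE; case: (rcons _ _) (size_rcons (map mixed_fst_block mid) (mixed_fst_block bn)).
  rewrite sE /= all_rcons => /and3P[c1 c3 c2].
  have cm : chain m.1 m.2.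
    by rewrite /m /= chain_cat c1 /= -l1b c3 andbT -/(brt (mixed_fst_block b1)) l2.
  by case E: (map mixed_fst_block mid) c2 => [|b' s] /=; [rewrite size_cat addnS|]; rewrite ?cm.
- exact: l1a.
by rewrite /= rot1_cons mr.
Qed.

End Intertwine.

(** * Strict isometries are cyclic morphisms *)

Section StrictOperations.
Variables (k : fieldType) (Q R : quiver k) (F0 : obj Q -> obj R).
Variable g : forall x y i, Q x y i -> R (F0 x) (F0 y) i.
Hypothesis g_linear : forall x y i, linear (@g x y i).
Variable f : letter Q -> letter R.
Hypothesis fE : forall l, f l = Letter (g (lval l)).

Lemma out_linear h : out F0 0 (linear_operation f) h [::] = f h.
Proof.
rewrite /out /linear_operation /= fE Letter_proj //= wdeg_cons wdeg_nil /sdeg.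
by move: (ldeg h) => n; lia.
Qed.

Lemma linear_operation_multilinear x y i :
  multilinear (fun w => linear_operation f w x y i).
Proof.
move=> [|l l'] [|r r'] u v j c a b /=; rewrite ?scaler0 ?addr0 //.
  by rewrite !fE ![lval _]/= g_linear; apply: proj_linear.
all: by case: l' => [|? ?] /=; rewrite scaler0 addr0.
Qed.

Lemma linear_operation_homogeneous : homogeneous F0 0 (linear_operation f).
Proof.
split=> [x y i|h [|l t] i ch iN] //; first exact: linear_operation_multilinear.
apply/eqP/negPn/negP => /= /proj_neq0[_ _]; rewrite fE /= => E; case/eqP: iN.
by rewrite wdeg_cons wdeg_nil /sdeg E; move: (ldeg h) => n; lia.
Qed.

(** A strict family of maps vanishes on words with more than one letter, so only the
    decomposition into letters contributes. *)
Lemma sum_splits (V : lmodType k) (G : seq (letter R) -> V) s : multilinear G ->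
  \sum_(p <- splits s) G [seq out F0 0 (linear_operation f) b.1 b.2 | b <- p] = G (map f s).
Proof.
elim: s G => [|x s IH] G GP; first by rewrite /= big_seq1.
rewrite /= big_flatten big_map -(IH (fun v => G (f x :: v))); last first.
  by move=> l r u v i c a b; apply: (GP (f x :: l)).
apply: eq_bigr => -[|[h t] p] _; rewrite big_cons ?big_seq1 ?big_nil /= ?addr0 out_linear //.
by rewrite [X in _ + X](multilinear_zero [::] _ GP) ?addr0.
Qed.

Lemma split_sum_head T (V : zmodType) (H : seq T -> seq T -> V) s :
  (forall x a b, H (x :: a) b = 0) -> split_sum H s = H [::] s.
Proof.
have spl0 (H' : seq T -> seq T -> V) u : (forall a b, H' a b = 0) -> split_sum H' u = 0.
  by elim: u H' => [|y u IH] H' e /=; rewrite e // add0r IH.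
by move=> e; case: s => [|x s] //=; rewrite spl0 ?addr0.
Qed.

Lemma split_sum_tail T (V : zmodType) (H : seq T -> seq T -> V) s :
  (forall a x b, H a (x :: b) = 0) -> split_sum H s = H s [::].
Proof.
elim: s H => [|x s IH] H e //=; rewrite e add0r.
by rewrite (IH (fun a b => H (x :: a) b)).
Qed.

Variables (smQ : operation Q Q) (smR : operation R R).
Hypothesis smQ_Ainf : Ainf_structure smQ.
Hypothesis smR_Ainf : Ainf_structure smR.
Hypothesis f_out : forall h t, composable (h :: t) ->
  f (out idfun 1 smQ h t) = out idfun 1 smR (f h) (map f t).

Lemma insertions_linear h t x y n :
  insertions smQ (linear_operation f) (h :: t) x y n =
  proj x y n (f (out idfun 1 smQ h t)).
Proof.
rewrite insertionsE split_sum_tail => [|a z b].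
  by rewrite split_sum_head /= ?wdeg_nil ?scale1r // => z a [|? ?] //=; case: a => [|? ?] /=; rewrite scaler0.
by rewrite split_sum_head => [|z' a' [|? ?]] //=; [case: a => [|? ?] //=; rewrite scaler0|case: a' => [|? ?]; rewrite scaler0].
Qed.

Lemma strict_Ainf_morphism : Ainf_morphism smQ smR F0 (linear_operation f).
Proof.
split=> //; first exact: linear_operation_homogeneous.
move=> h t n ch; rewrite insertions_linear f_out //.
have [[smRl smRd] _] := smR_Ainf.
rewrite (@sum_splits _ (fun w => smR w (F0 (lft h)) (F0 (rgt (last h t))) n)) //.
have lE : lft (f h) = F0 (lft h) by rewrite fE.
have rE : rgt (last (f h) (map f t)) = F0 (rgt (last h t)) by rewrite last_map fE.
rewrite (outE _ lE rE (erefl _)) map_cons.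
have [<-|nN] := eqVneq (wdeg (f h :: map f t) + 1 + 1) n; first by rewrite proj_id.
have := smRd (f h) (map f t) n; rewrite lE rE => -> //; last by rewrite eq_sym.
  by apply/eqP/negPn/negP => /proj_neq0[_ _] /= E; rewrite E eqxx in nN.
apply: (@composable_map _ _ _ F0 f) => // l; by rewrite fE.
Qed.

Lemma strict_linear_operation : strict_operation (linear_operation f) F0.
Proof. by move=> h [|l t]. Qed.

Variables (e : int) (gamma : letter Q -> letter Q -> k) (Gamma : letter R -> letter R -> k).
Hypothesis gamma_cyclic : almost_cyclic_Ainf e smQ gamma.
Hypothesis Gamma_cyclic : almost_cyclic_Ainf e smR Gamma.
Hypothesis Gamma_linear1 : forall l, letter_linear (fun l' => Gamma l' l : k^o).
Hypothesis Gamma_linear2 : forall l, letter_linear (fun l' => Gamma l l' : k^o).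
Hypothesis f_isometry : forall a b, lft b = rgt a -> rgt b = lft a ->
  Gamma (f a) (f b) = gamma a b.

(** The sums in the second cyclicity condition vanish term by term, since one of two
    blocks with at least three letters in total is longer than one. *)
Lemma strict_cyclic_morphism :
  cyclic_Ainf_morphism e smQ gamma smR Gamma F0 (linear_operation f).
Proof.
split=> //; first exact: strict_Ainf_morphism.
  by move=> a b l r; rewrite !out_linear f_isometry.
move=> h t sz _ _; rewrite big_nat big1 // => i /andP[i1 i2].
have out0 a l u : exists x y n, out F0 0 (linear_operation f) a (l :: u) = Letter (0 : R x y n).
  by do 3!eexists.
have E : (size (take i (h :: t)) + size (drop i (h :: t)) > 2)%N.
  by rewrite -size_cat cat_take_drop.
case: (take i _) (drop i _) E => [|a u] [|b v] //.
case: u => [|l u] E; last first.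
  have [x [y [n ->]]] := out0 a l u; exact: (letter_linear0 _ _ _ (Gamma_linear1 _)).
case: v E => [|l v] // _.
have [x [y [n ->]]] := out0 b l v; exact: (letter_linear0 _ _ _ (Gamma_linear2 _)).
Qed.

End StrictOperations.

(** * The mixed structure *)

Section Mixed.
Variables (k : fieldType) (d : int) (A B : quiver k).
Variables (MA : preCY d A) (MB : preCY d B) (Phi : strict_morphism MA MB).
Local Notation S := (mixedq Phi).
Local Notation DA := (doubleq d A).
Local Notation DB := (doubleq d B).
Local Notation p0 := (phi0 Phi).
Local Notation vA := (varphiA Phi).
Local Notation vB := (varphiB Phi).
Local Notation sm := (sm_mixed Phi).
Local Notation smA := (jmap MA : operation DA DA).
Local Notation smB := (jmap MB : operation DB DB).
Implicit Types (w u : seq (letter S)) (h z : letter S).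

Lemma chain_varphiA X w : chain X w -> @chain k DA X (map vA w).
Proof. exact: (@chain_map _ S DA idfun vA). Qed.

Lemma chain_varphiB X w : chain X w -> @chain k DB (p0 X) (map vB w).
Proof. exact: (@chain_map _ S DB p0 vB). Qed.

Lemma last_varphiA X w : last X [seq rgt l | l <- map vA w] = last X [seq rgt l | l <- w].
Proof. exact: (@last_map_rgt _ S DA idfun vA). Qed.

Lemma last_varphiB X w : last (p0 X) [seq rgt l | l <- map vB w] = p0 (last X [seq rgt l | l <- w]).
Proof. exact: (@last_map_rgt _ S DB p0 vB). Qed.

Lemma wdeg_varphiA w : wdeg (map vA w) = wdeg w.
Proof. by rewrite /wdeg big_map. Qed.

Lemma wdeg_varphiB w : wdeg (map vB w) = wdeg w.
Proof. by rewrite /wdeg big_map. Qed.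

Lemma varphiA_out h t : composable (h :: t) ->
  vA (out idfun 1 sm h t) = out idfun 1 smA (vA h) (map vA t).
Proof.
rewrite composable_chain => ch.
rewrite (@outE k DA smA (vA h) (map vA t) (lft h) (rgt (last h t)) (wdeg (h :: t) + 1 + 1)) //.
- congr (@Letter k DA _ _ _ _); rewrite [lval _]/= /sm_mixed /=.
  rewrite (jmap_second _ ch (last_rgt _ _ _)).
  by rewrite [RHS]surjective_pairing.
- by rewrite last_map.
- by rewrite -map_cons wdeg_varphiA.
Qed.

Lemma varphiB_out h t : composable (h :: t) ->
  vB (out idfun 1 sm h t) = out idfun 1 smB (vB h) (map vB t).
Proof.
rewrite composable_chain => ch.
rewrite (@outE k DB smB (vB h) (map vB t) (p0 (lft h)) (p0 (rgt (last h t))) (wdeg (h :: t) + 1 + 1)) //.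
- congr (@Letter k DB _ _ _ _); rewrite [lval _]/= /sm_mixed /=.
  rewrite (jmap_first _ ch (last_rgt _ _ _)).
  by rewrite [RHS]surjective_pairing.
- by rewrite last_map.
- by rewrite -map_cons wdeg_varphiB.
Qed.

Lemma mixed_multilinear x y i : multilinear (fun w => sm w x y i).
Proof.
move=> l r u v j c a b; rewrite /sm_mixed.
rewrite (varphiA_multilinear (jmap_multilinear MA x y i)).
by rewrite (varphiB_multilinear (jmap_multilinear MB (p0 x) (p0 y) i)).
Qed.

Lemma split_sum_map (V : zmodType) T U (g : T -> U) (H : seq U -> seq U -> V) s :
  split_sum H (map g s) = split_sum (fun a b => H (map g a) (map g b)) s.
Proof. by elim: s H => [|x s IH] H //=; rewrite IH. Qed.

Lemma composable_inner x w1 h t w3 : chain x ((w1 ++ h :: t) ++ w3) -> composable (h :: t).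
Proof. by rewrite !chain_cat => /andP[/andP[_ /andP[_ c]] _]. Qed.

(** Since [varphiA] commutes with the operations, the first component of the Stasheff
    sum is that of the image under [varphiA], and the second one that of the image
    under [varphiB]. *)
Lemma insertions_mixed1 w X n : chain X w -> forall Y,
  (insertions sm sm w X Y n).1 = (insertions smA smA (map vA w) X Y n).1.
Proof.
move=> cw Y; rewrite !insertionsE split_sum_map.
have fD (Q : zmodType) (Q' : zmodType) : {morph (fun p : Q * Q' => p.1) : a b / a + b} by [].
rewrite (split_sum_raddf _ _ (fD _ _)) (split_sum_raddf _ _ (fD (A X Y n) _)).
apply: split_sum_ext => u w3 uw; rewrite split_sum_map.
rewrite (split_sum_raddf _ _ (fD _ _)) (split_sum_raddf _ _ (fD (A X Y n) _)).
apply: split_sum_ext => w1 w2 ew; case: w2 ew => [|h t] ew //=.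
have ct : composable (h :: t) by move: cw; rewrite -uw -ew; apply: composable_inner.
rewrite wdeg_varphiA; congr (_ *: _).
by rewrite map_cat map_cons varphiA_out.
Qed.

Lemma insertions_mixed2 w X n : chain X w -> forall Y,
  (insertions sm sm w X Y n).2 = (insertions smB smB (map vB w) (p0 X) (p0 Y) n).2.
Proof.
move=> cw Y; rewrite !insertionsE split_sum_map.
have fD (Q : zmodType) (Q' : zmodType) : {morph (fun p : Q * Q' => p.2) : a b / a + b} by [].
rewrite (split_sum_raddf _ _ (fD (A X Y n) _)) (split_sum_raddf _ _ (fD (B (p0 X) (p0 Y) n) _)).
apply: split_sum_ext => u w3 uw; rewrite split_sum_map.
rewrite (split_sum_raddf _ _ (fD (A X Y n) _)) (split_sum_raddf _ _ (fD (B (p0 X) (p0 Y) n) _)).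
apply: split_sum_ext => w1 w2 ew; case: w2 ew => [|h t] ew //=.
have ct : composable (h :: t) by move: cw; rewrite -uw -ew; apply: composable_inner.
rewrite wdeg_varphiB; congr (_ *: _).
by rewrite map_cat map_cons varphiB_out.
Qed.

Lemma mixed_Ainf : Ainf_structure sm.
Proof.
split.
  split=> [x y i|h t i]; first exact: mixed_multilinear.
  rewrite composable_chain -addrA => ch iN; rewrite /sm_mixed map_cons map_cons.
  rewrite (jmap_degree MA (X := lft h) (Y := rgt (last h t))); last 3 first.
  - by rewrite -map_cons; apply: chain_varphiA.
  - by rewrite -map_cons last_varphiA [last _ _]/= last_map.
  - by rewrite -map_cons wdeg_varphiA.
  rewrite (jmap_degree MB (X := p0 (lft h)) (Y := p0 (rgt (last h t)))) //.
  - by rewrite -map_cons; apply: chain_varphiB.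
  - by rewrite -map_cons last_varphiB; congr (phi0 Phi _); rewrite [last _ _]/= last_map.
  - by rewrite -map_cons wdeg_varphiB.
move=> h t n ch; have ch' := ch; rewrite composable_chain in ch'.
rewrite [LHS]surjective_pairing insertions_mixed1 // insertions_mixed2 //.
rewrite -[RHS]/(0, 0) ![map _ (h :: t)]/=; congr pair.
  have [_ IA] := jmap_Ainf MA; have := IA (vA h) (map vA t) n.
  rewrite last_map => -> //; exact: (@composable_map _ S DA idfun vA _ _ h t ch).
have [_ IB] := jmap_Ainf MB; have := IB (vB h) (map vB t) n.
rewrite last_map => -> //; exact: (@composable_map _ S DB p0 vB _ _ h t ch).
Qed.

Lemma isometryA h z : lft z = rgt h -> rgt z = lft h ->
  Gamma_double d A (vA h) (vA z) = Gamma_Phi Phi h z.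
Proof.
move=> e1 e2; rewrite /Gamma_double /Gamma_Phi /natural_form.
congr (_ * _ - _ * (_ * _)).
  exact: (@pairing_pull _ _ _ _ _ _ Phi h (fst_letter z)).
exact: (@pairing_pull _ _ _ _ _ _ Phi z (fst_letter h)).
Qed.

(** Pulled back from [A] along the isometry [varphiA]. *)
Lemma mixed_cyclic : almost_cyclic sm (Gamma_Phi Phi).
Proof.
move=> h t z ch lz rz.
have cz : composable (z :: belast h t).
  case/lastP: t ch lz => [//|t l] ch lz; rewrite belast_rcons /= rz eqxx /=.
  by move: ch; rewrite /= -cats1 chain_cat => /andP[].
rewrite -!isometryA //; last by rewrite belast_joint.
rewrite !varphiA_out //.
have := @jmap_cyclic _ _ _ MA (vA h) (map vA t) (vA z).
rewrite last_map => -> //; last exact: (@composable_map _ S DA idfun vA _ _ h t ch).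
by rewrite -map_cons wdeg_varphiA belast_map.
Qed.

End Mixed.

Theorem proposition5p13 (k : fieldType)
    (char_neq2 : 2%N \notin [pchar k]) (char_neq3 : 3%N \notin [pchar k])
    (d : int) (A B : quiver k) (MA : preCY d A) (MB : preCY d B)
    (Phi : strict_morphism MA MB) :
  let sphiA := linear_operation (varphiA Phi) in
  let sphiB := linear_operation (varphiB Phi) in
  (cyclic_Ainf_morphism (d - 1) (sm_mixed Phi) (Gamma_Phi Phi)
       (jmap MA) (Gamma_double d A) idfun sphiA
   /\ strict_operation sphiA idfun) /\
  (cyclic_Ainf_morphism (d - 1) (sm_mixed Phi) (Gamma_Phi Phi)
       (jmap MB) (Gamma_double d B) (phi0 Phi) sphiB
   /\ strict_operation sphiB (phi0 Phi)).
Proof.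
move=> sphiA sphiB.
have mixedP : almost_cyclic_Ainf (d - 1) (sm_mixed Phi) (Gamma_Phi Phi).
  by split; [apply: mixed_Ainf|apply: form_bilinear|apply: mixed_cyclic].
have doubleP C (MC : preCY d C) : almost_cyclic_Ainf (d - 1) (jmap MC) (Gamma_double d C).
  by split; [apply: jmap_Ainf|apply: form_bilinear|apply: jmap_cyclic].
split; split; try exact: strict_linear_operation.
  apply: (@strict_cyclic_morphism k (mixedq Phi) (doubleq d A) idfun
    (fun x y i p => (p.1, pullback p.2))) => //.
  - by move=> x y i c a b; rewrite pullback_comb.
  - exact: mixed_Ainf.
  - exact: jmap_Ainf.
  - exact: varphiA_out.
  - exact: form_linear1.
  - exact: form_linear2.
  - exact: isometryA.
apply: (@strict_cyclic_morphism k (mixedq Phi) (doubleq d B) (phi0 Phi)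
    (fun x y i p => (phi Phi x y i p.1, p.2))) => //.
- by move=> x y i c a b; rewrite linearP.
- exact: mixed_Ainf.
- exact: jmap_Ainf.
- exact: varphiB_out.
- exact: form_linear1.
- exact: form_linear2.
Qed.
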